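(* Let $n\ge 3$, $s\in(0,1)$, and let $\Omega\subset\mathbb{R}^n$ be a domain. Let $u\in C(\mathbb{R}^n)\cap L^1_{\omega_s}(\mathbb{R}^n)$ be such that for some $\eta_0>0$ $$\mathcal{K}^s u\ge \eta_0\quad\text{in }\Omega$$ in the viscosity sense. Moreover, assume there exists $K>0$ such that for every $x\in\Omega$ at which $u$ can be touched from above by a $C^2$-function, $$\mathcal{I}^s u(x,y+z)+\mathcal{I}^s u(x,y-z)-2\,\mathcal{I}^s u(x,y)\le 2K|z|^{2s}\qquad\text{for a.e. } y,z\in\mathbb{R}^n.$$ Then there is $\Lambda\ge 1$, depending only on $n,s,K,\eta_0$, such that for every $x\in\Omega$ at which $u$ can be touched from above by a $C^2$-function, $$\mathcal{K}^s u(x)=C_{n,s}\min_{A\in\mathcal{A}_2\cap\mathcal{N}(\Lambda)}\mathrm{P.V.}\int_{\mathbb{R}^n}\frac{u(x+Ay)-u(x)}{|y|^{n+2s}}\,dy,$$ i.e., $\mathcal{K}^s$ is uniformly elliptic in $\Omega$ and the infimum defining $\mathcal{K}^s u(x)$ is attained. Moreover, $\Lambda=O(1)$ as $s\to1$ (with $n,K,\eta_0$ fixed).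
   Context: $\mathcal{S}^n_+$ is the set of symmetric positive definite real $n\times n$ matrices. For $A\in\mathcal{S}^n_+$, $\lambda_1(A),\dots,\lambda_n(A)$ are its eigenvalues with multiplicity. Let $\sigma_1(\zeta)=\sum_i\zeta_i$, $\sigma_2(\zeta)=\sum_{i<j}\zeta_i\zeta_j$, $\Gamma_2=\{\zeta\in\mathbb{R}^n:\sigma_1(\zeta)>0,\ \sigma_2(\zeta)>0\}$ and $$\mathcal{A}_2=\Big\{A\in\mathcal{S}^n_+:\ \lambda_i(A)^2=\sum_{j\ne i}\zeta_j\ (i=1,\dots,n)\ \text{for some }\zeta\in\Gamma_2\text{ with }\sigma_2(\zeta)=1\Big\}.$$ For $\Lambda\ge1$, $\mathcal{N}(\Lambda)=\{A\in\mathcal{S}^n_+:\Lambda^{-1}I\le A\le\Lambda I\}$. $L^1_{\omega_s}(\mathbb{R}^n)$ is the set of $u$ with $\int_{\mathbb{R}^n}\frac{|u(y)|}{1+|y|^{n+2s}}\,dy<\infty$. Let $C_{n,s}=\dfrac{4^s s\,\Gamma(\frac{n+2s}{2})}{\pi^{n/2}\Gamma(1-s)}$ and $\delta u(x,y)=u(x+y)+u(x-y)-2u(x)$. Define $$\mathcal{K}^su(x)=C_{n,s}\inf_{A\in\mathcal{A}_2}\mathrm{P.V.}\int_{\mathbb{R}^n}\frac{u(x+Ay)-u(x)}{|y|^{n+2s}}\,dy,\qquad \mathcal{I}^su(x,y)=(1-s)\int_{-\infty}^\infty\frac{\delta u(x,ry)}{|r|^{1+2s}}\,dr.$$ $u$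 can be touched from above by a $C^2$-function at $x\in\Omega$ if there are an open neighborhood $N\subset\Omega$ of $x$ and $\psi\in C^2(N)$ with $\psi(x)=u(x)$ and $\psi(y)>u(y)$ for all $y\in N\setminus\{x\}$. $\mathcal{K}^su\ge\eta_0$ in $\Omega$ in the viscosity sense means: for all such $x,N,\psi$, the function $v$ equal to $\psi$ in $N$ and to $u$ in $\mathbb{R}^n\setminus N$ satisfies $\mathcal{K}^sv(x)\ge\eta_0$. (It is known that then $\mathcal{K}^su(x)\ge\eta_0$ holds classically at every such $x$.) Under the hypotheses, the values of $\mathcal{I}^su(x,\cdot)$ in the second-difference inequality are finite for a.e. $y,z$. *)

(* Defs.v *)
From HB Require Import structures.
From mathcomp Require Import all_boot all_order all_algebra.
From mathcomp Require Import all_classical all_reals all_analysis.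

Set Implicit Arguments.
Unset Strict Implicit.
Unset Printing Implicit Defensive.
Import Order.TTheory GRing.Theory Num.Theory.
Import numFieldNormedType.Exports.

Local Open Scope classical_set_scope.
Local Open Scope ring_scope.

(* The sigma-algebra generated by the entries: on column vectors this is the
   product sigma-algebra, i.e. the Borel sigma-algebra of R^n. *)
Section measurable_matrix.
Context {R : realType} (m n : nat).

Definition mx_entry_sets : set (set 'M[R]_(m, n)) :=
  [set E | exists (ij : 'I_m * 'I_n) (B : set R),
     measurable B /\ E = [set M : 'M[R]_(m, n) | B (M ij.1 ij.2)]].

Definition mx_display : measure_display.
Proof. exact: default_measure_display. Qed.

Let mx_measurable0 : <<s mx_entry_sets >> set0.
Proof. exact: sigma_algebra0. Qed.

Let mx_measurableC A : <<s mx_entry_sets >> A -> <<s mx_entry_sets >> (~` A).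
Proof. exact: sigma_algebraC. Qed.

Let mx_measurable_bigcup (F : (set 'M[R]_(m, n))^nat) :
  (forall i, <<s mx_entry_sets >> (F i)) ->
  <<s mx_entry_sets >> (\bigcup_i (F i)).
Proof. exact: sigma_algebra_bigcup. Qed.

HB.instance Definition _ :=
  @isMeasurable.Build mx_display 'M[R]_(m, n)
    <<s mx_entry_sets >> mx_measurable0 mx_measurableC mx_measurable_bigcup.

End measurable_matrix.

Section lebesgue_step.
Context {R : realType} (n : nat).
Variable mu : {sigma_finite_measure set 'cV[R]_n -> \bar R}.

Definition cons_cV (p : measurableTypeR R * 'cV[R]_n) : 'cV[R]_n.+1 :=
  col_mx (p.1)%:M p.2.

Lemma measurable_cons_cV : measurable_fun [set: _] cons_cV.
Proof.
apply: (@measurability _ _ _ _ _ _ (@mx_entry_sets R n.+1 1)) => //.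
move=> _ [_ [[i j] [B [mB ->]]] <-]; rewrite setTI.
rewrite [X in measurable X](_ : _ =
    [set p : measurableTypeR R * 'cV[R]_n | B (cons_cV p i j)]) //.
rewrite (ord1 j).
case: (@split_ordP 1 n i) => k ->.
  rewrite (_ : [set p | _] = fst @^-1` B); last first.
    apply/seteqP; split=> p /=; rewrite /cons_cV (@col_mxEu _ 1 n 1) (ord1 k).
      by rewrite mxE eqxx mulr1n.
    by rewrite mxE eqxx mulr1n.
  rewrite -[X in measurable X]setTI; exact: measurable_fst.
rewrite (_ : [set p | _] = snd @^-1` [set v : 'cV[R]_n | B (v k ord0)]); last first.
  by apply/seteqP; split=> p /=; rewrite /cons_cV (@col_mxEd _ 1 n 1).
rewrite -[X in measurable X]setTI; apply: measurable_snd => //.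
by apply: sub_sigma_algebra; exists (k, ord0), B.
Qed.

Definition lebesgue_step : set 'cV[R]_n.+1 -> \bar R :=
  pushforward (lebesgue_measure \x mu)%E cons_cV.

Let step0 : lebesgue_step set0 = 0%E.
Proof. by rewrite /lebesgue_step /pushforward preimage_set0 measure0. Qed.

Let step_ge0 A : (0 <= lebesgue_step A)%E.
Proof. exact: (@measure_ge0 _ _ R (lebesgue_measure \x mu)%E). Qed.

Let step_sigma_additive : semi_sigma_additive lebesgue_step.
Proof.
have mc (A : set 'cV[R]_n.+1) : measurable A -> measurable (cons_cV @^-1` A).
  by move=> mA; rewrite -[X in measurable X]setTI; exact: measurable_cons_cV.
move=> F mF tF mUF; rewrite /lebesgue_step /pushforward preimage_bigcup.
apply: (@measure_semi_sigma_additive _ _ R (lebesgue_measure \x mu)%E).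
- by move=> k; exact: mc.
- apply/trivIsetP => /= i j _ _ ij; rewrite -preimage_setI.
  by move/trivIsetP : tF => /(_ _ _ _ _ ij) ->//; rewrite preimage_set0.
- by rewrite -preimage_bigcup; exact: mc.
Qed.

HB.instance Definition _ := isMeasure.Build _ _ _
  lebesgue_step step0 step_ge0 step_sigma_additive.

Let uncons_cV (v : 'cV[R]_n.+1) : measurableTypeR R * 'cV[R]_n :=
  (v (@lshift 1 n ord0) ord0, \col_i v (@rshift 1 n i) ord0).

Let cons_cVK p : uncons_cV (cons_cV p) = p.
Proof.
case: p => a v; congr pair.
  by rewrite /cons_cV (@col_mxEu _ 1 n 1) mxE eqxx mulr1n.
by apply/colP => i; rewrite mxE /cons_cV (@col_mxEd _ 1 n 1).
Qed.

Let measurable_uncons_cV : measurable_fun [set: _] uncons_cV.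
Proof.
have mentry (i : 'I_n.+1) (B : set R) : measurable B ->
    measurable [set v : 'cV[R]_n.+1 | B (v i ord0)].
  by move=> mB; apply: sub_sigma_algebra; exists (i, ord0), B.
apply/measurable_fun_pairP; split.
  by move=> _ B mB; rewrite setTI; exact: mentry.
apply: (@measurability _ _ _ _ _ _ (@mx_entry_sets R n 1)) => //.
move=> _ [_ [[i j] [B [mB ->]]] <-]; rewrite setTI (ord1 j).
rewrite (_ : _ @^-1` _ =
    [set v : 'cV[R]_n.+1 | B (v (@rshift 1 n i) ord0)]); last first.
  by apply/seteqP; split=> v /=; rewrite mxE.
exact: mentry.
Qed.

Let step_sigma_finite : sigma_finite setT lebesgue_step.
Proof.
have /sigma_finiteP[F [TF ndF Foo]] :=
  sigma_finiteT (lebesgue_measure : {sigma_finite_measure set _ -> \bar R}).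
have /sigma_finiteP[G [TG ndG Goo]] := sigma_finiteT mu.
exists (fun k => uncons_cV @^-1` (F k `*` G k)).
  rewrite -preimage_bigcup (_ : \bigcup_k _ = setT) // -subTset => -[x y] _.
  have [i _ Fx] : (\bigcup_i F i) x by rewrite -TF.
  have [j _ Gy] : (\bigcup_i G i) y by rewrite -TG.
  exists (maxn i j) => //; split.
    by move: x Fx; exact/subsetPset/ndF/leq_maxl.
  by move: y Gy; exact/subsetPset/ndG/leq_maxr.
move=> k; have [mF Fk] := Foo k; have [mG Gk] := Goo k; split.
  by rewrite -[X in measurable X]setTI; apply: measurable_uncons_cV => //;
    exact: measurableX.
rewrite /lebesgue_step /pushforward -comp_preimage.
rewrite (_ : uncons_cV \o cons_cV = id); last first.
  by apply/funext => p; exact: cons_cVK.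
by rewrite preimage_id product_measure1E// lte_mul_pinfty// ge0_fin_numE.
Qed.

HB.instance Definition _ := Measure_isSigmaFinite.Build _ _ _
  lebesgue_step step_sigma_finite.

End lebesgue_step.

(* Lebesgue measure on R^n, by transport along R x R^n' = R^(n'.+1). *)
Fixpoint lebesgue_cV (R : realType) (n : nat) :
    {sigma_finite_measure set 'cV[R]_n -> \bar R} :=
  match n with
  | 0 => \d_(0 : 'cV[R]_0)
  | n'.+1 => lebesgue_step (lebesgue_cV R n')
  end.

(* The norm of the library on matrices is the sup norm, hence the need for the
   Euclidean one; both induce the same topology. *)
Definition enorm {R : realType} {n : nat} (y : 'cV[R]_n) : R :=
  Num.sqrt (\sum_i y i ord0 ^+ 2).

Definition quad_form {R : realType} {n : nat} (A : 'M[R]_n) (y : 'cV[R]_n) : R :=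
  (y^T *m A *m y) ord0 ord0.

Definition pos_def {R : realType} {n : nat} : set 'M[R]_n :=
  [set A | A^T = A /\ forall y, y != 0 -> 0 < quad_form A y].

Definition loewner_le {R : realType} {n : nat} (A B : 'M[R]_n) : Prop :=
  forall y, quad_form A y <= quad_form B y.

(* [lam] lists the eigenvalues of [A], with multiplicity. *)
Definition eigenvalues_of {R : realType} {n : nat} (A : 'M[R]_n)
    (lam : 'I_n -> R) : Prop :=
  char_poly A = \prod_i ('X - (lam i)%:P).

Definition sigma1 {R : realType} {n : nat} (zeta : 'I_n -> R) : R :=
  \sum_i zeta i.

Definition sigma2 {R : realType} {n : nat} (zeta : 'I_n -> R) : R :=
  \sum_(i < n) \sum_(j < n | (i < j)%N) zeta i * zeta j.

Definition Gamma2 {R : realType} {n : nat} : set ('I_n -> R) :=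
  [set zeta | 0 < sigma1 zeta /\ 0 < sigma2 zeta].

(* [Gamma2] and [sigma2] are invariant under permutations, so that the order in
   which the eigenvalues are listed is irrelevant. *)
Definition A2 {R : realType} {n : nat} : set 'M[R]_n :=
  [set A | pos_def A /\
     exists lam zeta : 'I_n -> R,
       [/\ eigenvalues_of A lam, Gamma2 zeta, sigma2 zeta = 1 &
           forall i, lam i ^+ 2 = \sum_(j | j != i) zeta j]].

Definition elliptic {R : realType} {n : nat} (Lambda : R) : set 'M[R]_n :=
  [set A | [/\ pos_def A, loewner_le (Lambda^-1)%:M A & loewner_le A Lambda%:M]].

Definition L1_omega {R : realType} {n : nat} (s : R) (u : 'cV[R]_n -> R) : Prop :=
  (\int[lebesgue_cV R n]_y
     (`|u y| / (1 + enorm y `^ (n%:R + 2 * s)))%:E < +oo)%E.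

Definition Gamma {R : realType} (a : R) : R :=
  \int[lebesgue_measure]_(t in `]0, +oo[) (t `^ (a - 1) * expR (- t)).

Definition C_ns {R : realType} (n : nat) (s : R) : R :=
  (4 `^ s * s * Gamma ((n%:R + 2 * s) / 2)) /
  (pi `^ (n%:R / 2) * Gamma (1 - s)).

Definition delta {R : realType} {n : nat} (u : 'cV[R]_n -> R) (x y : 'cV[R]_n) : R :=
  u (x + y) + u (x - y) - 2 * u x.

(* [lim] is total. For continuous [u] in [L1_omega s u] the truncated integrals
   are finite, and where [u] is touched from above by a C^2 function the limit
   exists in [-oo, +oo[, the second differences of [u] being bounded above by
   a multiple of the square of the increment. *)
Definition pv {R : realType} {n : nat} (s : R) (u : 'cV[R]_n -> R)
    (x : 'cV[R]_n) (A : 'M[R]_n) : \bar R :=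
  lim ((\int[lebesgue_cV R n]_(y in [set y | (eps < enorm y)%R])
          ((u (x + A *m y) - u x) / enorm y `^ (n%:R + 2 * s))%:E)%E
       @[eps --> (0:R)^'+]).

Definition Ks {R : realType} {n : nat} (s : R) (u : 'cV[R]_n -> R)
    (x : 'cV[R]_n) : \bar R :=
  ((C_ns n s)%:E * ereal_inf [set pv s u x A | A in A2])%E.

Definition Is {R : realType} {n : nat} (s : R) (u : 'cV[R]_n -> R)
    (x y : 'cV[R]_n) : \bar R :=
  ((1 - s)%:E *
   \int[lebesgue_measure]_r (delta u x (r *: y) / `|r| `^ (1 + 2 * s))%:E)%E.

Definition domain {R : realType} {n : nat} (Omega : set 'cV[R]_n) : Prop :=
  [/\ open Omega, connected Omega & Omega !=set0].

(* [f] is of class C^k on the open set [N]: all its partial derivatives of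
   order at most [k] exist and are continuous on [N]. *)
Fixpoint Ck_on {R : realType} {n : nat} (k : nat) (N : set 'cV[R]_n)
    (f : 'cV[R]_n -> R) : Prop :=
  (forall y, N y -> {for y, continuous f}) /\
  match k with
  | 0 => True
  | k'.+1 => forall i : 'I_n,
      (forall y, N y -> derivable f y (delta_mx i ord0)) /\
      Ck_on k' N (fun y => 'D_(delta_mx i ord0) f y)
  end.

Definition touches_from_above {R : realType} {n : nat} (Omega : set 'cV[R]_n)
    (u : 'cV[R]_n -> R) (x : 'cV[R]_n) (N : set 'cV[R]_n) (psi : 'cV[R]_n -> R) :=
  [/\ open N, N x, N `<=` Omega, Ck_on 2 N psi &
      psi x = u x /\ forall y, N y -> y <> x -> u y < psi y].

Definition touchable_from_above {R : realType} {n : nat} (Omega : set 'cV[R]_n)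
    (u : 'cV[R]_n -> R) (x : 'cV[R]_n) : Prop :=
  exists N psi, touches_from_above Omega u x N psi.

(* [patch u N psi] equals [psi] on [N] and [u] outside of [N]. *)
Definition Ks_ge_viscosity {R : realType} {n : nat} (s : R) (Omega : set 'cV[R]_n)
    (u : 'cV[R]_n -> R) (eta0 : R) : Prop :=
  forall x N psi, Omega x -> touches_from_above Omega u x N psi ->
    (eta0%:E <= Ks s (patch u N psi) x)%E.

(* The values of [Is] are extended reals. When [Ks s u] is positive at [x], the
   three values below are finite for almost every [yz] (polar coordinates), and
   the conventions on sums of infinities play no role. *)
Definition Is_second_difference_le {R : realType} {n : nat} (s : R)
    (Omega : set 'cV[R]_n) (u : 'cV[R]_n -> R) (K : R) : Prop :=
  forall x, Omega x -> touchable_from_above Omega u x ->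
    {ae (lebesgue_cV R n \x lebesgue_cV R n)%E, forall yz : 'cV[R]_n * 'cV[R]_n,
      (Is s u x (yz.1 + yz.2) + Is s u x (yz.1 - yz.2) - 2%:E * Is s u x yz.1
       <= (2 * K * enorm yz.2 `^ (2 * s))%:E)%E}.

Definition is_min {R : realType} (S : set (\bar R)) (m : \bar R) : Prop :=
  S m /\ lbound S m.

(* Main.v *)
(* Write Phi(A) for the integral of delta u(x, A y) / |y|^(n+2s), twice the
   principal value. Averaging I^s u(x, A g) over the pairs (g, g') of the unit
   ball of R^n x R^n, of measure m, turns the line integrals into a constant
   multiple J(A) of Phi(A). For commuting symmetric P, Q with P^2 + Q^2 = 1 the map
   (g, g') -> (P g + Q g', P g - Q g') preserves that average in each component,
   so the second-difference inequality, applied to B P g and B Q g', integrates to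
     J(B) <= J(A) + K m tr(B^2 - A^2)^s   whenever B^2 - A^2 is positive definite
   (P and Q being the square roots of B^-1 A^2 B^-1 and of its complement, and
   B P being A up to an orthogonal factor). The viscosity inequality, transferred
   to u by monotone convergence, bounds J from below on A_2. In terms of traces,
   A_2 is the set tr(A^2)^2 / (n-1) - tr(A^4) = 2. Given A in A_2 there is a small
   t, of order 1 / tr(A^2), such that the square root of t A^2 + d lies in A_2:
   then eta <= t^s J(A) + K m (n d)^s forces J(A) to grow like tr(A^2)^s, while J
   is bounded at the multiple of the identity in A_2. The minimum is thus to be
   sought on the compact set where tr(A^2) <= T, where J is lower semicontinuous
   by the same inequality. *)

Require Import Defs.
From HB Require Import structures.
From mathcomp Require Import all_boot all_order all_algebra.
From mathcomp Require Import all_classical all_reals all_analysis.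
From mathcomp Require Import measurable_realfun ring lra.
From mathcomp Require complex.

Import Order.TTheory GRing.Theory Num.Theory.
Import numFieldNormedType.Exports.

Set Implicit Arguments.
Unset Strict Implicit.
Unset Printing Implicit Defensive.

Local Open Scope classical_set_scope.
Local Open Scope ring_scope.

(** * Lebesgue measure on R^n *)

Section lebesgue_line.
Context {R : realType}.
Local Notation leb := (@lebesgue_measure R).
Implicit Types (f : R -> \bar R) (r a : R).

(** For [n >= 3] the set [A2] is unbounded and its members may degenerate in some direction, so
    nothing prevents a priori a minimizing family from escaping to infinity. The hypothesis that
    should rule this out concerns single pairs of directions, and only almost every pair, whereas
    two matrices have to be compared. The ball of pairs serves both purposes: invertible linear maps
    of [g] and of [g'] carry null sets to null sets, and [g'] stays bounded, so that [|z|^(2s)]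
    becomes a power of a trace. No surface measure enters; Tonelli and the uniqueness of an
    invariant measure suffice. Where [u] is touched from above, the second difference quotient is
    first shown to be integrable. All values are then finite, and [Phi] is homogeneous of degree
    [2s]. Uniformity as [s] tends to 1 is a cancellation: [C_ns] is at most a multiple of [1 - s],
    because [Gamma (1 - s)] is at least a multiple of [1 / (1 - s)], while [Is] carries the factor
    [1 - s]. The lower bound for the averages therefore stays away from 0 on [s >= 1/2]; for smaller
    [s] the constants may depend on [s]. *)

Lemma measurable_affine r a :
  measurable_fun [set: measurableTypeR R]
    ((fun x => r * x + a) : _ -> measurableTypeR R).
Proof. by apply: measurable_funD => //; exact: measurable_funM. Qed.

(** The image of Lebesgue measure under the affine map, multiplied by [r], has the right value on
    half-open intervals, hence is Lebesgue measure by uniqueness. *)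
Lemma ge0_integral_affine r a f : 0 < r ->
  measurable_fun [set: measurableTypeR R] f -> (forall x, 0 <= f x)%E ->
  (\int[leb]_x f (r * x + a)%R = (r^-1)%:E * \int[leb]_x f x)%E.
Proof.
move=> r0 mf f0.
have rge0 : 0 <= r by exact: ltW.
pose phi : measurableTypeR R -> measurableTypeR R := fun x => r * x + a.
have mphi : measurable_fun setT phi by exact: measurable_affine.
pose mu := mscale (NngNum rge0) (pushforward leb phi).
have H (A : set R) : measurable A -> leb A = mu mphi A.
  move=> mA; apply: lebesgue_measure_unique => // _ [[c d]] _ <-.
  rewrite /mu/= /mscale/= /pushforward.
  rewrite (_ : phi @^-1` _ = `](c - a) / r, (d - a) / r]%classic); last first.
    apply/seteqP; split => x /=; rewrite !in_itv/= /phi;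
      by rewrite ltr_pdivrMr // ler_pdivlMr // ltrBlDr lerBrDr mulrC.
  rewrite !lebesgue_measure_itv/= !lte_fin.
  rewrite ltr_pM2r ?invr_gt0// ltrD2r; case: ifPn => _; last by rewrite mule0.
  by rewrite -!EFinB -EFinM; congr EFin; field; rewrite gt_eqF.
have -> : (\int[leb]_x f x = \int[mu mphi]_x f x)%E.
  by apply: (@eq_measure_integral _ _ _ _ (mu mphi)) => A mA _; exact: H.
rewrite ge0_integral_mscale//= ge0_integral_pushforward//= preimage_setT.
by rewrite muleA -EFinM mulVf ?gt_eqF// mul1e.
Qed.

Lemma ge0_integral_opp f :
  measurable_fun [set: measurableTypeR R] f -> (forall x, 0 <= f x)%E ->
  (\int[leb]_x f (- x)%R = \int[leb]_x f x)%E.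
Proof.
move=> mf f0.
pose phi : measurableTypeR R -> measurableTypeR R := -%R.
have mphi : measurable_fun setT phi by exact: oppr_measurable.
have -> : (\int[leb]_x f x = \int[pushforward leb phi]_x f x)%E.
  by apply: eq_measure_integral => A mA _; exact/esym/lebesgue_measureN.
by rewrite ge0_integral_pushforward//= preimage_setT.
Qed.

Lemma ge0_integral_shift a f :
  measurable_fun [set: measurableTypeR R] f -> (forall x, 0 <= f x)%E ->
  (\int[leb]_x f (x + a)%R = \int[leb]_x f x)%E.
Proof.
move=> mf f0; have := @ge0_integral_affine 1 a f ltr01 mf f0.
rewrite invr1 mul1e => <-.
by apply: eq_integral => x _; rewrite mul1r.
Qed.

Lemma ge0_integral_scale r f : r != 0 ->
  measurable_fun [set: measurableTypeR R] f -> (forall x, 0 <= f x)%E ->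
  (\int[leb]_x f (r * x)%R = (`|r|^-1)%:E * \int[leb]_x f x)%E.
Proof.
move=> r0 mf f0.
have pos (q : R) : 0 < q ->
    (\int[leb]_x f (q * x)%R = (q^-1)%:E * \int[leb]_x f x)%E.
  move=> q0; rewrite -(@ge0_integral_affine q 0 f q0 mf f0).
  by apply: eq_integral => x _; rewrite addr0.
case: (ltgtP r 0) r0 => // r0 _; last by rewrite gtr0_norm// pos.
rewrite ltr0_norm// -pos ?oppr_gt0//.
rewrite -[RHS]ge0_integral_opp//.
- by apply: eq_integral => x _; rewrite mulrNN.
- by apply: (measurableT_comp mf); exact: mulrl_measurable.
Qed.

End lebesgue_line.

(** * Measurability of vector-valued maps *)

Section measurable_vectors.
Context {R : realType}.
Local Notation mvec n := 'cV[R]_n.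

Lemma measurable_fun_cV d (T : measurableType d) (n : nat) (f : T -> mvec n) :
  (forall i, measurable_fun [set: T] (fun t => f t i ord0)) ->
  measurable_fun [set: T] f.
Proof.
move=> mf; apply: (@measurability _ _ _ _ _ _ (@mx_entry_sets R n 1)) => //.
move=> _ [_ [[i j] [B [mB ->]]] <-]; rewrite (ord1 j).
exact: (mf i measurableT B mB).
Qed.

Lemma measurable_cV_entry (n : nat) (i : 'I_n) :
  measurable_fun [set: mvec n] (fun v => v i ord0).
Proof.
by move=> _ B mB; rewrite setTI; apply: sub_sigma_algebra; exists (i, ord0), B.
Qed.

Lemma measurable_fun_cV_add d (T : measurableType d) (n : nat)
    (f g : T -> mvec n) :
  measurable_fun [set: T] f -> measurable_fun [set: T] g ->
  measurable_fun [set: T] (fun t => f t + g t).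
Proof.
move=> mf mg; apply: measurable_fun_cV => i; under eq_fun do rewrite mxE.
apply: measurable_funD.
  exact: (measurableT_comp (measurable_cV_entry i) mf).
exact: (measurableT_comp (measurable_cV_entry i) mg).
Qed.

Lemma measurable_fun_cV_scale d (T : measurableType d) (n : nat)
    (f : T -> R) (g : T -> mvec n) :
  measurable_fun [set: T] f -> measurable_fun [set: T] g ->
  measurable_fun [set: T] (fun t => f t *: g t).
Proof.
move=> mf mg; apply: measurable_fun_cV => i; under eq_fun do rewrite mxE.
apply: measurable_funM => //.
exact: (measurableT_comp (measurable_cV_entry i) mg).
Qed.

Lemma measurable_cV_shift (n : nat) (w : mvec n) :
  measurable_fun [set: mvec n] (fun v => v + w).
Proof.
apply: measurable_fun_cV => i; under eq_fun do rewrite mxE.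
by apply: measurable_funD => //; exact: measurable_cV_entry.
Qed.

Lemma measurable_cV_mulmx (m n : nat) (A : 'M[R]_(m, n)) :
  measurable_fun [set: mvec n] (fun v => A *m v).
Proof.
apply: measurable_fun_cV => i; under eq_fun do rewrite mxE.
apply: measurable_sum => j; apply: measurable_funM => //.
exact: measurable_cV_entry.
Qed.

Lemma measurable_cV_scaler (n : nat) (r : R) :
  measurable_fun [set: mvec n] (fun v => r *: v).
Proof.
under eq_fun do rewrite -mul_scalar_mx; exact: measurable_cV_mulmx.
Qed.

Lemma measurable_enorm (n : nat) : measurable_fun [set: mvec n] (@enorm R n).
Proof.
rewrite /enorm; apply: (measurableT_comp (continuous_measurable_fun _)).
  exact: sqrt_continuous.
by apply: measurable_sum => j; apply: measurable_funX; exact: measurable_cV_entry.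
Qed.

End measurable_vectors.

(** * Lebesgue measure on R^n: translations, dilations, cubes *)

Section lebesgue_vectors.
Context {R : realType}.
Local Notation mvec n := 'cV[R]_n.
Local Notation leb := (@lebesgue_measure R).
Local Notation lam := (lebesgue_cV R).

(** Tonelli in the first coordinate; the invariance properties below follow from it by induction on
    the dimension. *)
Lemma ge0_integral_cons (n : nat) (f : mvec n.+1 -> \bar R) :
  measurable_fun [set: mvec n.+1] f -> (forall x, 0 <= f x)%E ->
  (\int[lam n.+1]_v f v = \int[leb]_a \int[lam n]_v f (cons_cV (a, v)))%E.
Proof.
move=> mf f0.
have -> : (\int[lam n.+1]_v f v =
    \int[pushforward (leb \x lam n)%E (@cons_cV R n)]_v f v)%E.
  by apply: eq_measure_integral; first exact: measurable_cons_cV.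
rewrite ge0_integral_pushforward//=; last exact: measurable_cons_cV.
rewrite preimage_setT fubini_tonelli1//.
by apply: (measurableT_comp mf); exact: measurable_cons_cV.
Qed.


Lemma cons_cVD (n : nat) a v (w : mvec n.+1) :
  cons_cV (a, v) + w =
  cons_cV (a + w (@lshift 1 n ord0) ord0, v + \col_i w (@rshift 1 n i) ord0).
Proof.
apply/colP => i; rewrite mxE /cons_cV/=.
case: (@split_ordP 1 n i) => k ->.
  by rewrite !(@col_mxEu _ 1 n 1) (ord1 k) !mxE !mulr1n.
by rewrite !(@col_mxEd _ 1 n 1) !mxE.
Qed.

Lemma cons_cVZ (n : nat) r a (v : mvec n) :
  r *: cons_cV (a, v) = cons_cV (r * a, r *: v).
Proof. by rewrite /cons_cV/= (@scale_col_mx _ 1 n 1) scale_scalar_mx. Qed.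

Lemma measurable_cons_cV_int (n : nat) (f : mvec n.+1 -> \bar R) :
  measurable_fun [set: mvec n.+1] f -> (forall x, 0 <= f x)%E ->
  measurable_fun [set: measurableTypeR R]
    (fun a => \int[lam n]_v f (cons_cV (a, v)))%E.
Proof.
move=> mf f0.
apply: (@measurable_fun_fubini_tonelli_F _ _ _ _ _ (lam n) (f \o @cons_cV R n)).
  by apply: (measurableT_comp mf); exact: measurable_cons_cV.
by move=> x; exact: f0.
Qed.

Lemma measurable_cons_cVr (n : nat) (f : mvec n.+1 -> \bar R) a :
  measurable_fun [set: mvec n.+1] f ->
  measurable_fun [set: mvec n] (fun v => f (cons_cV (a, v))).
Proof.
move=> mf; apply: (measurableT_comp mf).
by apply: (measurableT_comp (@measurable_cons_cV R n)); exact: measurable_pair1.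
Qed.

Lemma ge0_integral_cV_shift (n : nat) w (f : mvec n -> \bar R) :
  measurable_fun [set: mvec n] f -> (forall x, 0 <= f x)%E ->
  (\int[lam n]_v f (v + w)%R = \int[lam n]_v f v)%E.
Proof.
elim: n w f => [|n IH] w f mf f0.
  by apply: eq_integral => x _; rewrite (flatmx0 (x + w)) (flatmx0 x).
rewrite !ge0_integral_cons//; last first.
  by apply: (measurableT_comp mf); exact: measurable_cV_shift.
rewrite -[RHS](ge0_integral_shift (w (@lshift 1 n ord0) ord0)); last 2 first.
- exact: measurable_cons_cV_int.
- by move=> x; exact: integral_ge0.
apply: eq_integral => a _; rewrite -[RHS](IH (\col_i w (@rshift 1 n i) ord0))//.
  by apply: eq_integral => v _; rewrite cons_cVD.
exact: measurable_cons_cVr.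
Qed.

Lemma ge0_integral_cV_scale (n : nat) (r : R) (f : mvec n -> \bar R) : r != 0 ->
  measurable_fun [set: mvec n] f -> (forall x, 0 <= f x)%E ->
  (\int[lam n]_v f (r *: v)%R = (`|r| ^- n)%:E * \int[lam n]_v f v)%E.
Proof.
move=> r0; elim: n f => [|n IH] f mf f0.
  rewrite expr0 invr1 mul1e.
  by apply: eq_integral => x _; rewrite (flatmx0 (r *: x)) (flatmx0 x).
rewrite !ge0_integral_cons//; last first.
  by apply: (measurableT_comp mf); exact: measurable_cV_scaler.
have := @ge0_integral_scale R r _ r0 (measurable_cons_cV_int mf f0).
move/(_ (fun a => integral_ge0 _ (fun v _ => f0 (cons_cV (a, v))))) => E.
transitivity ((`|r| ^- n)%:E *
    \int[leb]_a \int[lam n]_v f (cons_cV ((r * a)%R, v)))%E.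
  rewrite -ge0_integralZl//; last 2 first.
  - apply: (measurableT_comp (measurable_cons_cV_int mf f0)).
    exact: mulrl_measurable.
  - by move=> a _; exact: integral_ge0.
  apply: eq_integral => a _; rewrite -IH//; last exact: measurable_cons_cVr.
  by apply: eq_integral => v _; rewrite cons_cVZ.
by rewrite E muleA -EFinM exprS invfM mulrC.
Qed.

(** Sup-norm balls are products of intervals, so the recursive definition of the measure gives their
    mass exactly; they serve as reference sets of finite positive mass. *)
Definition cube (n : nat) (rho : R) : set (mvec n) :=
  [set v | forall i, `|v i ord0| <= rho].
Arguments cube : clear implicits.

Lemma measurable_cube (n : nat) rho : measurable (cube n rho).
Proof.
rewrite (_ : cube n rho = \bigcap_(i in [set: 'I_n])
    [set v : mvec n | `|v i ord0| <= rho]); last first.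
  by apply/seteqP; split => v /= H; [move=> i _; exact: H|move=> i; exact: (H i)].
apply: fin_bigcap_measurable; first exact: finite_finset.
move=> i _; rewrite -[X in measurable X]setTI.
apply: (@measurable_fun_ler _ _ _ _ (fun v : mvec n => `|v i ord0|) (cst rho)) => //.
by apply: measurableT_comp => //; exact: measurable_cV_entry.
Qed.

Lemma lebesgue_cube (n : nat) (rho : R) : 0 <= rho ->
  lam n (cube n rho) = ((2 * rho) ^+ n)%:E.
Proof.
move=> rho0; elim: n => [|n IH].
  by rewrite expr0 /= diracE mem_set// => -[].
rewrite -[LHS]/((leb \x lam n)%E (cons_cV (n:=n) @^-1` cube n.+1 rho)).
rewrite (_ : _ @^-1` _ = `[- rho, rho]%classic `*` cube n rho); last first.
  apply/seteqP; split => -[a v] /=.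
    move=> H; split.
      have := H (@lshift 1 n ord0); rewrite /cons_cV (@col_mxEu _ 1 n 1) mxE mulr1n.
      by rewrite ler_norml in_itv.
    by move=> i; have := H (@rshift 1 n i); rewrite /cons_cV (@col_mxEd _ 1 n 1).
  move=> [Ha Hv] i; rewrite /cons_cV/=.
  case: (@split_ordP 1 n i) => k ->; last by rewrite (@col_mxEd _ 1 n 1).
  rewrite (@col_mxEu _ 1 n 1) (ord1 k) mxE mulr1n ler_norml.
  by move: Ha; rewrite in_itv.
rewrite product_measure1E//; last exact: measurable_cube.
have lebI : leb `[- rho, rho]%classic = (2 * rho)%:E.
  rewrite lebesgue_measure_itv/= lte_fin -EFinB opprK.
  case: ltP => H; first by rewrite -mulr2n mulr_natl.
  have -> : rho = 0 by lra.
  by rewrite mulr0.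
by rewrite IH exprS EFinM; congr (_ * _)%E.
Qed.

End lebesgue_vectors.
Arguments cube {R} n rho.

(** * Uniqueness of an invariant measure *)

Section haar.
Local Open Scope ereal_scope.
Context {R : realType} d (T : measurableType d).
Variable nu : {sigma_finite_measure set T -> \bar R}.
Variables (add : T -> T -> T) (opp : T -> T).
Hypothesis addC : commutative add.
Hypothesis addNK : forall x y, add (add x (opp y)) y = x.
Hypothesis measurable_add : measurable_fun [set: T * T] (fun p => add p.1 p.2).
Hypothesis measurable_opp : measurable_fun [set: T] opp.
Hypothesis nu_shift : forall a (f : T -> \bar R),
  measurable_fun [set: T] f -> (forall x, 0 <= f x) ->
  \int[nu]_x f (add x a) = \int[nu]_x f x.
Hypothesis nu_opp : forall f : T -> \bar R,
  measurable_fun [set: T] f -> (forall x, 0 <= f x) ->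
  \int[nu]_x f (opp x) = \int[nu]_x f x.

Let measurable_add_fun d' (T' : measurableType d') (f g : T' -> T) :
  measurable_fun [set: T'] f -> measurable_fun [set: T'] g ->
  measurable_fun [set: T'] (fun t => add (f t) (g t)).
Proof.
move=> mf mg.
have mfg : measurable_fun [set: T'] (fun t => (f t, g t)).
  by apply/measurable_fun_pairP; split.
exact: (measurableT_comp measurable_add mfg).
Qed.

(* Tonelli and the invariance of [nu] give the uniqueness of the Haar measure
   in the form needed here: [M] scales all integrals by the same factor. *)
Lemma haar_unique (M N : T -> T) (f g : T -> \bar R) :
  measurable_fun [set: T] M ->
  (forall x y, M (add x (N y)) = add (M x) (opp y)) ->
  measurable_fun [set: T] f -> (forall x, 0 <= f x) ->
  measurable_fun [set: T] g -> (forall x, 0 <= g x) ->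
  (\int[nu]_x f (M x)) * (\int[nu]_x g x) =
  (\int[nu]_x g (M x)) * (\int[nu]_x f x).
Proof.
move=> mM MN mf f0 mg g0.
have mfM : measurable_fun [set: T] (fun x => f (M x)) by exact: measurableT_comp.
have mgM : measurable_fun [set: T] (fun x => g (M x)) by exact: measurableT_comp.
have intg0 : 0 <= \int[nu]_x g x by exact: integral_ge0.
have intf0 : 0 <= \int[nu]_x f x by exact: integral_ge0.
have maddr x : measurable_fun [set: T] (fun y => add y x).
  exact: measurable_add_fun.
rewrite -ge0_integralZr//.
transitivity (\int[nu]_x \int[nu]_y (f (M x) * g (add y (M x)))).
  apply: eq_integral => x _.
  rewrite ge0_integralZl// ?nu_shift//.
  exact: (measurableT_comp mg).
rewrite (@fubini_tonelli _ _ _ _ _ nu nu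
    (fun p => f (M p.1) * g (add p.2 (M p.1)))); last 2 first.
- apply: emeasurable_funM.
    exact: (measurableT_comp mfM measurable_fst).
  apply: (measurableT_comp mg).
  apply: measurable_add_fun; first exact: measurable_snd.
  exact: (measurableT_comp mM measurable_fst).
- by move=> p; exact: mule_ge0.
(* Translating [x] by [N y] replaces [M x] by [M x - y], which moves the dependence on [y] from [g]
   to [f]. *)
transitivity (\int[nu]_y \int[nu]_x (f (add (M x) (opp y)) * g (M x))).
  apply: eq_integral => y _ /=.
  rewrite -(nu_shift (N y) (f := fun x => f (M x) * g (add y (M x)))).
  - apply: eq_integral => x _; rewrite MN (addC y) addNK//.
  - apply: emeasurable_funM => //.
    apply: (measurableT_comp mg).
    exact: measurable_add_fun.
  - by move=> x; exact: mule_ge0.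
rewrite -(@fubini_tonelli _ _ _ _ _ nu nu
    (fun p => f (add (M p.1) (opp p.2)) * g (M p.1))); last 2 first.
- apply: emeasurable_funM; last exact: (measurableT_comp mgM measurable_fst).
  apply: (measurableT_comp mf).
  apply: measurable_add_fun.
    exact: (measurableT_comp mM measurable_fst).
  exact: (measurableT_comp measurable_opp measurable_snd).
- by move=> p; exact: mule_ge0.
rewrite -ge0_integralZr//.
apply: eq_integral => x _ /=.
have maddl : measurable_fun [set: T] (fun y => f (add (M x) y)).
  by apply: (measurableT_comp mf); exact: measurable_add_fun.
rewrite ge0_integralZr//; last exact: (measurableT_comp maddl).
rewrite muleC (nu_opp (f := fun y => f (add (M x) y)))//.
by under eq_integral do rewrite addC; rewrite nu_shift.
Qed.

End haar.

(* The instance of the library for [m1 \x m2] is shadowed by the one for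
   subprobabilities. *)
Section product_sigma_finite.
Local Open Scope ereal_scope.
Context d1 d2 (T1 : measurableType d1) (T2 : measurableType d2) (R : realType).
Variables (m1 : {sigma_finite_measure set T1 -> \bar R})
  (m2 : {sigma_finite_measure set T2 -> \bar R}).

Definition product_measure : set (T1 * T2) -> \bar R := (m1 \x m2)%E.

HB.instance Definition _ := Measure.on product_measure.

Let product_measure_sigma_finite : sigma_finite setT product_measure.
Proof.
have /sigma_finiteP[F [TF ndF Foo]] := sigma_finiteT m1.
have /sigma_finiteP[G [TG ndG Goo]] := sigma_finiteT m2.
exists (fun k => F k `*` G k).
  apply/esym; rewrite -subTset => -[x y] _.
  have [i _ Fx] : (\bigcup_i F i) x by rewrite -TF.
  have [j _ Gy] : (\bigcup_i G i) y by rewrite -TG.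
  exists (maxn i j) => //; split.
    by move: x Fx; exact/subsetPset/ndF/leq_maxl.
  by move: y Gy; exact/subsetPset/ndG/leq_maxr.
move=> k; have [mF Fk] := Foo k; have [mG Gk] := Goo k.
split; first exact: measurableX.
rewrite /product_measure product_measure1E//.
by rewrite lte_mul_pinfty// ge0_fin_numE.
Qed.

HB.instance Definition _ := Measure_isSigmaFinite.Build _ _ _
  product_measure product_measure_sigma_finite.

End product_sigma_finite.

(** * Linear changes of variables and isometries of pairs *)

Section lebesgue_invariance.
Context {R : realType} (n : nat).
Local Notation vec := 'cV[R]_n.
Local Notation lam := (lebesgue_cV R n).
Local Notation lam2 := (lam \x lam)%E.

Lemma ge0_integral_cV_opp (f : vec -> \bar R) :
  measurable_fun [set: vec] f -> (forall x, 0 <= f x)%E ->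
  (\int[lam]_v f (- v)%R = \int[lam]_v f v)%E.
Proof.
move=> mf f0; have N10 : -1 != 0 :> R by rewrite oppr_eq0 oner_eq0.
have := ge0_integral_cV_scale N10 mf f0.
rewrite normrN1 expr1n invr1 mul1e => <-.
by apply: eq_integral => v _; rewrite scaleN1r.
Qed.

Lemma measurable_cV_opp : measurable_fun [set: vec] (-%R : vec -> vec).
Proof.
rewrite (_ : -%R = (fun v : vec => -1 *: v)); first exact: measurable_cV_scaler.
by apply/funext => v; rewrite scaleN1r.
Qed.

Lemma integral_cV_opp (f : vec -> \bar R) :
  measurable_fun [set: vec] f ->
  (\int[lam]_v f (- v)%R = \int[lam]_v f v)%E.
Proof.
move=> mf; rewrite [LHS]integralE [RHS]integralE.
have := ge0_integral_cV_opp (measurable_funepos mf) (funepos_ge0 f).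
have := ge0_integral_cV_opp (measurable_funeneg mf) (funeneg_ge0 f).
by move=> Hn Hp; congr (_ - _)%E; [rewrite -Hp|rewrite -Hn];
  apply: eq_integral => v _; rewrite ?funeposE ?funenegE.
Qed.

(** Uniqueness of the invariant measure, tested against the indicator [g] of a cube. The factor,
    which is the inverse of [|det A|], need not be identified: only its being finite and positive
    matters. *)
Lemma ge0_integral_cV_mulmx (A : 'M[R]_n) : A \in unitmx ->
  exists2 c : R, 0 < c & forall f : vec -> \bar R,
    measurable_fun [set: vec] f -> (forall x, 0 <= f x)%E ->
    (\int[lam]_v f (A *m v) = c%:E * \int[lam]_v f v)%E.
Proof.
move=> Au; pose g (v : vec) : \bar R := (\1_(cube n 1) v)%:E.
have mg : measurable_fun [set: vec] g.
  by apply/measurable_EFinP; apply: measurable_indic; exact: measurable_cube.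
have g0 x : (0 <= g x)%E by rewrite lee_fin.
have intg : (\int[lam]_v g v = (2 ^+ n)%:E)%E.
  have mc := @measurable_cube R n 1.
  rewrite integral_indic// setIT.
  by have := @lebesgue_cube R n 1 ler01; rewrite mulr1.
have haar (f h : vec -> \bar R) :
    measurable_fun [set: vec] f -> (forall x, 0 <= f x)%E ->
    measurable_fun [set: vec] h -> (forall x, 0 <= h x)%E ->
    ((\int[lam]_x f (A *m x)) * (\int[lam]_x h x) =
     (\int[lam]_x h (A *m x)) * (\int[lam]_x f x))%E.
  move=> mf f0 mh h0.
  apply: (@haar_unique _ _ _ lam (fun x y => x + y) (fun x => - x) _ _ _ _ _ _
    (fun x => A *m x) (fun y => invmx A *m (- y))) => //.
  - exact: addrC.
  - by move=> x y; rewrite subrK.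
  - by apply: measurable_fun_cV_add.
  - exact: measurable_cV_opp.
  - by move=> a k mk k0; exact: ge0_integral_cV_shift.
  - exact: ge0_integral_cV_opp.
  - exact: measurable_cV_mulmx.
  - by move=> x y; rewrite mulmxDr mulmxA mulmxV// mul1mx.
have pow0 : (0 < 2 ^+ n :> R) by rewrite exprn_gt0.
pose X := (\int[lam]_v g (A *m v))%E.
have X0 : (0 <= X)%E by exact: integral_ge0.
have key (f : vec -> \bar R) : measurable_fun [set: vec] f ->
    (forall x, 0 <= f x)%E ->
    ((\int[lam]_x f (A *m x)) * (2 ^+ n)%:E = X * \int[lam]_x f x)%E.
  by move=> mf f0; rewrite -intg; exact: haar.
(* For this function the identity reads [2^n * 2^n = X * Y], which excludes both [X = 0] and
   [X = +oo]. *)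
have := key (fun v => g (invmx A *m v)).
set Y := (\int[lam]_x g (invmx A *m x))%E.
have Y0 : (0 <= Y)%E by exact: integral_ge0.
have -> : (\int[lam]_x g (invmx A *m (A *m x)) = (2 ^+ n)%:E)%E.
  by rewrite -intg; apply: eq_integral => v _; rewrite mulmxA mulVmx// mul1mx.
move=> /(_ (measurableT_comp mg (measurable_cV_mulmx _)) (fun=> g0 _)).
rewrite -EFinM => XY.
have pow20 : (0 < 2 ^+ n * 2 ^+ n :> R) by rewrite mulr_gt0.
have Xfin : X \is a fin_num.
  rewrite ge0_fin_numE// ltey; apply/eqP => Xoo.
  move: XY; rewrite Xoo; case: (eqVneq Y 0%E) => [->|Y1].
    by rewrite mule0 => -[] H; rewrite H ltxx in pow20.
  by rewrite gt0_mulye// lt0e Y1.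
exists (fine X / 2 ^+ n).
  rewrite divr_gt0// fine_gt0// ltey_eq Xfin andbT lt0e X0 andbT.
  by apply/eqP => X00; move: XY; rewrite X00 mul0e => -[] H; rewrite H ltxx in pow20.
move=> f mf f0; have := key f mf f0; rewrite EFinM fineK// => H.
rewrite (muleC X) -muleA -H muleC -muleA -EFinM.
by rewrite divff ?mule1// gt_eqF.
Qed.

Lemma ge0_integral_pair_shift (a : vec * vec) (f : vec * vec -> \bar R) :
  measurable_fun [set: vec * vec] f -> (forall x, 0 <= f x)%E ->
  (\int[lam2]_w f (w.1 + a.1, w.2 + a.2)%R = \int[lam2]_w f w)%E.
Proof.
move=> mf f0.
have mfa : measurable_fun [set: vec * vec] (fun w => f (w.1 + a.1, w.2 + a.2)).
  apply: (measurableT_comp mf); apply/measurable_fun_pairP; split.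
    exact: (measurableT_comp (measurable_cV_shift a.1) measurable_fst).
  exact: (measurableT_comp (measurable_cV_shift a.2) measurable_snd).
rewrite !fubini_tonelli1// -[RHS](ge0_integral_cV_shift a.1); last 2 first.
- exact: measurable_fun_fubini_tonelli_F.
- by move=> x; exact: integral_ge0.
apply: eq_integral => x _; rewrite /fubini_F/=.
rewrite (ge0_integral_cV_shift a.2 (f := fun y => f (x + a.1, y)))//.
by apply: (measurableT_comp mf); exact: measurable_pair1.
Qed.

Lemma ge0_integral_pair_opp (f : vec * vec -> \bar R) :
  measurable_fun [set: vec * vec] f -> (forall x, 0 <= f x)%E ->
  (\int[lam2]_w f (- w.1, - w.2)%R = \int[lam2]_w f w)%E.
Proof.
move=> mf f0.
have mfa : measurable_fun [set: vec * vec] (fun w => f (- w.1, - w.2)).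
  apply: (measurableT_comp mf); apply/measurable_fun_pairP; split.
    exact: (measurableT_comp measurable_cV_opp measurable_fst).
  exact: (measurableT_comp measurable_cV_opp measurable_snd).
rewrite !fubini_tonelli1// -[RHS]ge0_integral_cV_opp; last 2 first.
- exact: measurable_fun_fubini_tonelli_F.
- by move=> x; exact: integral_ge0.
apply: eq_integral => x _; rewrite /fubini_F/=.
rewrite (ge0_integral_cV_opp (f := fun y => f (- x, y)))//.
by apply: (measurableT_comp mf); exact: measurable_pair1.
Qed.

Definition pair_ball : set (vec * vec) :=
  [set w | enorm w.1 ^+ 2 + enorm w.2 ^+ 2 <= 1].

Lemma measurable_pair_ball : measurable pair_ball.
Proof.
rewrite -[X in measurable X]setTI.
apply: (@measurable_fun_ler _ _ _ _
  (fun w : vec * vec => enorm w.1 ^+ 2 + enorm w.2 ^+ 2) (cst 1)) => //.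
apply: measurable_funD; apply: measurable_funX.
  exact: (measurableT_comp (@measurable_enorm _ _) measurable_fst).
exact: (measurableT_comp (@measurable_enorm _ _) measurable_snd).
Qed.

Lemma enorm_sqr (v : vec) : enorm v ^+ 2 = \sum_i v i ord0 ^+ 2.
Proof. by rewrite sqr_sqrtr// sumr_ge0// => i _; rewrite sqr_ge0. Qed.

Lemma enorm_ge0 (v : vec) : 0 <= enorm v.
Proof. exact: sqrtr_ge0. Qed.

Lemma entry_le_enorm (v : vec) i : `|v i ord0| <= enorm v.
Proof.
rewrite -ler_sqr ?nnegrE ?enorm_ge0// enorm_sqr real_normK ?num_real//.
by rewrite (bigD1 i)//= lerDl sumr_ge0// => j _; rewrite sqr_ge0.
Qed.

Lemma enorm_cube (v : vec) rho : 0 <= rho -> cube n rho v ->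
  enorm v ^+ 2 <= n%:R * rho ^+ 2.
Proof.
move=> rho0 H; rewrite enorm_sqr.
apply: (@le_trans _ _ (\sum_(i < n) rho ^+ 2)); last first.
  by rewrite sumr_const card_ord mulr_natl.
apply: ler_sum => i _; rewrite -[v i ord0 ^+ 2]real_normK ?num_real//.
by rewrite ler_sqr ?nnegrE//; exact: H.
Qed.

Lemma lebesgue_cube_pair rho : 0 <= rho ->
  lam2 (cube n rho `*` cube n rho) = ((2 * rho) ^+ n * (2 * rho) ^+ n)%:E.
Proof.
move=> rho0; rewrite product_measure1E; [|exact: measurable_cube..].
by rewrite EFinM; congr (_ * _)%E; exact: lebesgue_cube.
Qed.

Lemma pair_ball_lty : (lam2 pair_ball < +oo)%E.
Proof.
apply: (@le_lt_trans _ _ (lam2 (cube n 1 `*` cube n 1))%E).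
  apply: le_measure; rewrite ?inE.
  - exact: measurable_pair_ball.
  - by apply: measurableX; exact: measurable_cube.
  - move=> [v w]; rewrite /pair_ball/= => H.
    have sq (x : vec) : enorm x ^+ 2 <= 1 -> enorm x <= 1.
      by rewrite -[X in _ <= X](expr1n _ 2) ler_sqr ?nnegrE ?enorm_ge0//.
    by split => i; apply: (le_trans (entry_le_enorm _ _)); apply: sq;
      apply: le_trans H; rewrite ?lerDl ?lerDr sqr_ge0.
by rewrite lebesgue_cube_pair// ltry.
Qed.

Lemma pair_ball_gt0 : (0 < lam2 pair_ball)%E.
Proof.
(* Two vectors of this cube have squared norms adding up to at most [2 n rho^2], which is at most 1
   because [rho (1 + 2 n) = 1] and [rho <= 1]. *)
pose rho : R := (1 + 2 * n%:R)^-1.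
have den : 0 < 1 + 2 * n%:R :> R by rewrite ltr_wpDr// mulr_ge0.
have rho0 : 0 < rho by rewrite invr_gt0.
have rho1 : rho * (1 + 2 * n%:R) = 1 by rewrite mulVf// gt_eqF.
have nr : 0 <= n%:R :> R by [].
apply: (@lt_le_trans _ _ (lam2 (cube n rho `*` cube n rho))%E).
  rewrite lebesgue_cube_pair ?ltW// lte_fin.
  by rewrite mulr_gt0// exprn_gt0// mulr_gt0.
apply: le_measure; rewrite ?inE.
- by apply: measurableX; exact: measurable_cube.
- exact: measurable_pair_ball.
- move=> [v w] [/= /(enorm_cube (ltW rho0)) Hv /(enorm_cube (ltW rho0)) Hw].
  apply: (le_trans (lerD Hv Hw)).
  have : rho <= 1.
    by rewrite invf_le1// lerDl mulr_ge0.
  by move=> r1; nra.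
Qed.

Definition ball_mass : R := fine (lam2 pair_ball).

Lemma ball_massE : lam2 pair_ball = ball_mass%:E.
Proof. by rewrite fineK// ge0_fin_numE// pair_ball_lty. Qed.

Lemma ball_mass_gt0 : 0 < ball_mass.
Proof. by rewrite fine_gt0// pair_ball_gt0 pair_ball_lty. Qed.

Section isometry.
Variables M Minv : vec * vec -> vec * vec.
Hypothesis measurable_M : measurable_fun [set: vec * vec] M.
Hypothesis MD : forall x y : vec * vec, M (x.1 + y.1, x.2 + y.2) =
  ((M x).1 + (M y).1, (M x).2 + (M y).2).
Hypothesis MK : cancel Minv M.
Hypothesis norm_M : forall w,
  enorm (M w).1 ^+ 2 + enorm (M w).2 ^+ 2 = enorm w.1 ^+ 2 + enorm w.2 ^+ 2.

(** An additive surjection scales all integrals by one factor; testing it on the indicator of the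
    ball, which an isometry leaves unchanged, shows that the factor is 1. *)
Lemma ge0_integral_pair_isometry (f : vec * vec -> \bar R) :
  measurable_fun [set: vec * vec] f -> (forall x, 0 <= f x)%E ->
  (\int[lam2]_(w in pair_ball) f (M w) = \int[lam2]_(w in pair_ball) f w)%E.
Proof.
move=> mf f0.
pose g w : \bar R := (\1_pair_ball w)%:E.
have mB := measurable_pair_ball.
have mg : measurable_fun [set: vec * vec] g.
  by apply/measurable_EFinP; exact: measurable_indic.
have g0 x : (0 <= g x)%E by rewrite lee_fin.
have gM w : g (M w) = g w.
  rewrite /g !indicE; congr ((nat_of_bool _)%:R%:E).
  by apply/idP/idP; rewrite !inE /pair_ball/= norm_M.
have intg : (\int[lam2]_w g w = ball_mass%:E)%E.
  rewrite integral_indic// setIT; exact: ball_massE.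
pose h w := (f w * g w)%E.
have mh : measurable_fun [set: vec * vec] h by exact: emeasurable_funM.
have h0 w : (0 <= h w)%E by exact: mule_ge0.
have E (k : vec * vec -> \bar R) :
    (\int[lam2]_(w in pair_ball) k w = \int[lam2]_w (k w * g w))%E.
  rewrite integral_mkcond; apply: eq_integral => w _; rewrite epatch_indic.
  by rewrite /g.
rewrite !E -/h.
have -> : (\int[lam2]_w (f (M w) * g w) = \int[lam2]_w h (M w))%E.
  by apply: eq_integral => w _; rewrite /h gM.
have := @haar_unique _ _ (vec * vec)%type
  (product_measure lam lam)
  (fun x y => (x.1 + y.1, x.2 + y.2))
  (fun x => (- x.1, - x.2)) _ _ _ _ _ _ M (fun y => Minv (- y.1, - y.2)) h g
  measurable_M _ mh h0 mg g0.
have -> : (\int[lam2]_w g (M w) = \int[lam2]_w g w)%E.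
  by apply: eq_integral => w _; rewrite gM.
rewrite intg => H.
suff : ((\int[lam2]_w h (M w)) * ball_mass%:E =
    (\int[lam2]_w h w) * ball_mass%:E)%E.
  move/(congr1 (fun x => x * (ball_mass^-1)%:E)%E).
  by rewrite -!muleA -EFinM mulfV ?mule1// gt_eqF// ball_mass_gt0.
rewrite [RHS]muleC; apply: H.
- by move=> x y /=; rewrite addrC [X in (_, X)]addrC.
- by move=> [x1 x2] y /=; rewrite !subrK.
- apply/measurable_fun_pairP; split.
    apply: (@measurable_fun_cV_add _ _ _ _ (fun p => p.1.1) (fun p => p.2.1)).
      exact: (measurableT_comp measurable_fst measurable_fst).
    exact: (measurableT_comp measurable_fst measurable_snd).
  apply: (@measurable_fun_cV_add _ _ _ _ (fun p => p.1.2) (fun p => p.2.2)).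
    exact: (measurableT_comp measurable_snd measurable_fst).
  exact: (measurableT_comp measurable_snd measurable_snd).
- apply/measurable_fun_pairP; split.
    exact: (measurableT_comp measurable_cV_opp measurable_fst).
  exact: (measurableT_comp measurable_cV_opp measurable_snd).
- by move=> a k mk k0; exact: ge0_integral_pair_shift.
- exact: ge0_integral_pair_opp.
- by move=> x y; rewrite MD MK.
Qed.

Lemma integral_pair_isometry (f : vec * vec -> \bar R) :
  measurable_fun [set: vec * vec] f ->
  (\int[lam2]_(w in pair_ball) f (M w) = \int[lam2]_(w in pair_ball) f w)%E.
Proof.
move=> mf; rewrite [LHS]integralE [RHS]integralE.
have := ge0_integral_pair_isometry (measurable_funepos mf) (funepos_ge0 f).
have := ge0_integral_pair_isometry (measurable_funeneg mf) (funeneg_ge0 f).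
by move=> Hn Hp; congr (_ - _)%E; [rewrite -Hp|rewrite -Hn];
  apply: eq_integral => v _; rewrite ?funeposE ?funenegE.
Qed.

End isometry.

End lebesgue_invariance.

(** * Averages over the ball of pairs *)

Section kernel_identity.
Context {R : realType} (n : nat) (s : R).
Hypothesis s0 : 0 < s.
Local Notation vec := 'cV[R]_n.
Local Notation leb := (@lebesgue_measure R).
Local Notation lam := (lebesgue_cV R n).
Local Notation lam2 := (lam \x lam)%E.
Local Notation W := (@pair_ball R n).

Lemma enormZ (r : R) (v : vec) : enorm (r *: v) = `|r| * enorm v.
Proof.
rewrite /enorm -sqrtr_sqr -sqrtrM ?sqr_ge0//; congr Num.sqrt.
by rewrite mulr_sumr; apply: eq_bigr => i _; rewrite mxE exprMn.
Qed.

Lemma enorm_eq0 (v : vec) : (enorm v == 0) = (v == 0).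
Proof.
apply/idP/idP => [/eqP v0|/eqP ->]; last first.
  by rewrite -(scale0r 0) enormZ normr0 mul0r.
apply/eqP/colP => i; rewrite mxE; apply/eqP.
by rewrite -normr_le0 -v0 entry_le_enorm.
Qed.

Lemma enorm_gt0 (v : vec) : (0 < enorm v) = (v != 0).
Proof. by rewrite lt_def enorm_ge0 andbT enorm_eq0. Qed.

(** The section of the ball of pairs above a first component of norm [rho]. *)
Definition slice_set (rho : R) : set vec := [set v | rho ^+ 2 + enorm v ^+ 2 <= 1].

Definition slice (rho : R) : \bar R := lam (slice_set rho).

Definition line_weight (r : R) : R := (`|r| `^ (1 + 2 * s))^-1.

(** The total weight that a point [y] of norm 1 receives from the directions [g = y / r]: the kernel
    along the line, the Jacobian [|r|^-n] of [y = r g], and the mass of the section above [g]. *)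
Definition kernel_const : \bar R :=
  (\int[leb]_r ((line_weight r * `|r| ^- n)%:E * slice (`|r|^-1)))%E.

Lemma slice_ge0 rho : (0 <= slice rho)%E.
Proof. exact: measure_ge0. Qed.

Lemma measurable_slice_set rho : measurable (slice_set rho).
Proof.
rewrite -[X in measurable X]setTI.
apply: (@measurable_fun_ler _ _ _ _
  (fun v : vec => rho ^+ 2 + enorm v ^+ 2) (cst 1)) => //.
by apply: measurable_funD => //; apply: measurable_funX; exact: measurable_enorm.
Qed.

Lemma measurable_slice : measurable_fun [set: measurableTypeR R] slice.
Proof.
pose D : set (measurableTypeR R * vec) :=
  [set p | p.1 ^+ 2 + enorm p.2 ^+ 2 <= 1].
have mD : measurable D.
  rewrite -[X in measurable X]setTI.
  apply: (@measurable_fun_ler _ _ _ _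
    (fun p : measurableTypeR R * vec => p.1 ^+ 2 + enorm p.2 ^+ 2) (cst 1)) => //.
  apply: measurable_funD; apply: measurable_funX; first exact: measurable_fst.
  exact: (measurableT_comp (@measurable_enorm _ _) measurable_snd).
have := @measurable_fun_xsection _ _ _ _ R lam D mD.
apply: eq_measurable_fun => rho _; rewrite /slice/=; congr (lam _).
by apply/seteqP; split => v; rewrite /xsection/= inE.
Qed.

Lemma measurable_line_weight :
  measurable_fun [set: measurableTypeR R] line_weight.
Proof.
rewrite /line_weight; under eq_fun do rewrite -powRN.
by apply: (measurableT_comp (measurable_powR _)).
Qed.

Lemma line_weight_ge0 r : 0 <= line_weight r.
Proof. by rewrite invr_ge0 powR_ge0. Qed.

(** A consequence of the conventions for powers and inverses of 0; the origin of a line contributes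
    nothing. *)
Lemma line_weight0 : line_weight 0 = 0.
Proof. by rewrite /line_weight normr0 powR0 ?invr0// gt_eqF// addr_gt0// mulr_gt0. Qed.

(** The integrand ignores the second component, which by Tonelli contributes the mass of its
    section. *)
Lemma integral_ball_slice (h : vec -> \bar R) :
  measurable_fun [set: vec] h -> (forall x, 0 <= h x)%E ->
  (\int[lam2]_(w in W) h w.1 = \int[lam]_v (h v * slice (enorm v)))%E.
Proof.
move=> mh h0; have mB := @measurable_pair_ball R n.
rewrite integral_mkcond fubini_tonelli1; last 2 first.
- apply/(measurable_restrictT _ _).1 => //.
  by apply: measurable_funTS; exact: (measurableT_comp mh measurable_fst).
- by move=> w; exact: erestrict_ge0.
apply: eq_integral => v _; rewrite /fubini_F /slice.
have mS := measurable_slice_set (enorm v).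
rewrite (_ : lam _ = \int[lam]_w (\1_(slice_set (enorm v)) w)%:E)%E; last first.
  by rewrite integral_indic// setIT.
rewrite -ge0_integralZl//; last first.
  by apply/measurable_EFinP; exact: measurable_indic.
apply: eq_integral => w _; rewrite epatch_indic/= !indicE.
by congr (_ * (nat_of_bool _)%:R%:E)%E.
Qed.


Let radial_ge0 r rho : (0 <= (line_weight r * `|r| ^- n)%:E * slice rho)%E.
Proof.
by rewrite mule_ge0 ?slice_ge0// lee_fin mulr_ge0 ?line_weight_ge0.
Qed.

Lemma kernel_const_ge0 : (0 <= kernel_const)%E.
Proof. by apply: integral_ge0 => r _; exact: radial_ge0. Qed.

Lemma line_weightM (rho r : R) : 0 < rho ->
  line_weight (rho * r) = (rho `^ (1 + 2 * s))^-1 * line_weight r.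
Proof.
by move=> rho0; rewrite /line_weight normrM powRM// invfM gtr0_norm.
Qed.

(** Substitute [rho r] for [r]: the weight gives [rho^-(1+2s)], the Jacobian factor [rho^-n] and the
    differential [rho]. *)
Lemma integral_kernel_radial (rho : R) : 0 < rho ->
  (\int[leb]_r ((line_weight r * `|r| ^- n)%:E * slice (`|r|^-1 * rho)) =
   kernel_const * ((rho `^ (n%:R + 2 * s))^-1)%:E)%E.
Proof.
move=> rho0.
pose F (r : R) := ((line_weight r * `|r| ^- n)%:E * slice (`|r|^-1 * rho))%E.
have mnorm_inv : measurable_fun [set: measurableTypeR R] (fun r : R => `|r|^-1).
  rewrite (_ : (fun r : R => `|r|^-1) = (fun r => `|r| `^ (-1))).
    by apply: (measurableT_comp (measurable_powR _)).
  by apply/funext => r; rewrite powR_inv1.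
have mweight : measurable_fun [set: measurableTypeR R]
    (fun r => (line_weight r * `|r| ^- n)%:E).
  apply/measurable_EFinP; apply: measurable_funM.
    exact: measurable_line_weight.
  by under eq_fun do rewrite -exprVn; exact: measurable_funX.
have mF : measurable_fun [set: measurableTypeR R] F.
  apply: emeasurable_funM => //.
  apply: (measurableT_comp measurable_slice).
  exact: measurable_funM.
have F0 r : (0 <= F r)%E.
  exact: radial_ge0.
have := ge0_integral_scale (lt0r_neq0 rho0) mF F0.
rewrite gtr0_norm// => /(congr1 (fun x => rho%:E * x)%E).
rewrite muleA -EFinM mulfV ?gt_eqF// mul1e => <-.
have K0 := kernel_const_ge0.
have rhop : 0 < rho `^ (n%:R + 2 * s) by exact: powR_gt0.
rewrite /kernel_const -ge0_integralZr//; last 2 first.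
- apply: emeasurable_funM => //.
  exact: (measurableT_comp measurable_slice).
- by rewrite lee_fin invr_ge0 powR_ge0.
rewrite -ge0_integralZl//; last 2 first.
- by apply: (measurableT_comp mF); exact: mulrl_measurable.
- by rewrite lee_fin ltW.
apply: eq_integral => r _; rewrite /F line_weightM// normrM gtr0_norm//.
have -> : (rho * `|r|)^-1 * rho = `|r|^-1.
  by rewrite invfM mulrAC mulVf ?mul1r// gt_eqF.
rewrite muleA -EFinM muleAC -EFinM; congr (_%:E * _)%E.
have rho_neq0 : rho != 0 by rewrite gt_eqF.
have -> : rho `^ (1 + 2 * s) = rho * rho `^ (2 * s).
  by rewrite powRD ?rho_neq0 ?implybT// powRr1 ?ltW.
have -> : rho `^ (n%:R + 2 * s) = rho ^+ n * rho `^ (2 * s).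
  by rewrite powRD ?rho_neq0 ?implybT// powR_mulrn ?ltW.
by rewrite exprMn !invfM mulrACA !mulrA divff// mul1r; ring.
Qed.

Lemma measurable_line_integrand (h : vec -> \bar R) :
  measurable_fun [set: vec] h ->
  measurable_fun [set: vec * measurableTypeR R]
    (fun p => h (p.2 *: p.1) * (line_weight p.2)%:E)%E.
Proof.
move=> mh; apply: emeasurable_funM; last first.
  apply/measurable_EFinP.
  exact: (measurableT_comp measurable_line_weight measurable_snd).
apply: (measurableT_comp mh); apply: measurable_fun_cV_scale.
  exact: measurable_snd.
exact: measurable_fst.
Qed.

Lemma measurable_line_integral (h : vec -> \bar R) :
  measurable_fun [set: vec] h -> (forall x, 0 <= h x)%E ->
  measurable_fun [set: vec]
    (fun v => \int[leb]_r (h (r *: v)%R * (line_weight r)%:E))%E.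
Proof.
move=> mh h0; apply: (@measurable_fun_fubini_tonelli_F _ _ _ _ _ leb
    (fun p : vec * measurableTypeR R => h (p.2 *: p.1) * (line_weight p.2)%:E)%E).
  exact: measurable_line_integrand.
by move=> p; rewrite mule_ge0// lee_fin line_weight_ge0.
Qed.

(* The substitution [y = r g] for fixed [r] turns an average over the directions
   [g], weighted along each line, into a radial weight; this replaces polar
   coordinates. *)
Lemma integral_ball_line (h : vec -> \bar R) :
  measurable_fun [set: vec] h -> (forall x, 0 <= h x)%E -> h 0 = 0%E ->
  (\int[lam2]_(w in W) \int[leb]_r (h (r *: w.1)%R * (line_weight r)%:E) =
   kernel_const * \int[lam]_y (h y * ((enorm y `^ (n%:R + 2 * s))^-1)%:E))%E.
Proof.
move=> mh h0 h00.
have mweight : measurable_fun [set: measurableTypeR R]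
    (fun r => (line_weight r)%:E).
  by apply/measurable_EFinP; exact: measurable_line_weight.
have weight0 r : (0 <= (line_weight r)%:E)%E by rewrite lee_fin line_weight_ge0.
have mhr := measurable_line_integrand mh.
have mslice : measurable_fun [set: vec] (fun v => slice (enorm v)).
  by apply: (measurableT_comp measurable_slice); exact: measurable_enorm.
rewrite (@integral_ball_slice
  (fun v => \int[leb]_r (h (r *: v)%R * (line_weight r)%:E))%E); last 2 first.
- exact: measurable_line_integral.
- by move=> v; apply: integral_ge0 => r _; exact: mule_ge0.
transitivity (\int[lam]_v \int[leb]_r
    (h (r *: v)%R * (line_weight r)%:E * slice (enorm v)))%E.
  apply: eq_integral => v _; rewrite ge0_integralZr//.
  - exact: (measurableT_comp mhr (measurable_pair1 v)).
  - by move=> r _; exact: mule_ge0.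
pose G (p : vec * measurableTypeR R) :=
  (h (p.2 *: p.1)%R * (line_weight p.2)%:E * slice (enorm p.1))%E.
have mG : measurable_fun [set: vec * measurableTypeR R] G.
  by apply: emeasurable_funM => //; exact: (measurableT_comp mslice measurable_fst).
have G0 p : (0 <= G p)%E by rewrite !mule_ge0// slice_ge0.
rewrite (@fubini_tonelli _ _ _ _ _ lam leb G)//.
pose H (p : measurableTypeR R * vec) :=
  (h p.2 * ((line_weight p.1 * `|p.1| ^- n)%:E * slice (`|p.1|^-1 * enorm p.2)))%E.
transitivity (\int[leb]_r \int[lam]_v H (r, v))%E.
  apply: eq_integral => r _.
  (* The dilation by [r] is not invertible here, but both integrands vanish with the weight. *)
  have [->|r0] := eqVneq r 0.
    rewrite /G/H/= line_weight0 mul0r.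
    rewrite [LHS]integral0_eq; last by move=> v _; rewrite mule0 mul0e.
    by rewrite [RHS]integral0_eq// => v _; rewrite mul0e mule0.
  have nr0 : 0 < `|r| by rewrite normr_gt0.
  pose F (v : vec) := (h v * (line_weight r)%:E * slice (`|r|^-1 * enorm v))%E.
  have mF : measurable_fun [set: vec] F.
    apply: emeasurable_funM; first exact: emeasurable_funM.
    apply: (measurableT_comp measurable_slice).
    by apply: measurable_funM => //; exact: measurable_enorm.
  have F0 v : (0 <= F v)%E by rewrite !mule_ge0// slice_ge0.
  transitivity (\int[lam]_v F (r *: v)%R)%E.
    apply: eq_integral => v _; rewrite /G/F/= enormZ mulrA mulVf ?mul1r//.
    by rewrite gt_eqF.
  rewrite ge0_integral_cV_scale// -ge0_integralZl//.
  apply: eq_integral => v _; rewrite /F/H/=.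
  by rewrite EFinM !muleA; congr (_ * _)%E; rewrite -muleA muleC.
have mH : measurable_fun [set: measurableTypeR R * vec] H.
  apply: emeasurable_funM; first exact: (measurableT_comp mh measurable_snd).
  apply: emeasurable_funM.
    apply/measurable_EFinP; apply: measurable_funM.
      exact: (measurableT_comp measurable_line_weight measurable_fst).
    under eq_fun do rewrite -exprVn -powR_inv1//.
    apply: measurable_funX; apply: (measurableT_comp (measurable_powR _)).
    by apply: measurableT_comp => //; exact: measurable_fst.
  apply: (measurableT_comp measurable_slice); apply: measurable_funM.
    under eq_fun do rewrite -powR_inv1//.
    apply: (measurableT_comp (measurable_powR _)).
    by apply: measurableT_comp => //; exact: measurable_fst.
  exact: (measurableT_comp (@measurable_enorm _ _) measurable_snd).
have H0 p : (0 <= H p)%E by rewrite mule_ge0//; exact: radial_ge0.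
rewrite (@fubini_tonelli _ _ _ _ _ leb lam H)//.
have K0 := kernel_const_ge0.
have mpow : measurable_fun [set: vec]
    (fun y => ((enorm y `^ (n%:R + 2 * s))^-1)%:E).
  apply/measurable_EFinP; under eq_fun do rewrite -powRN.
  by apply: (measurableT_comp (measurable_powR _)); exact: measurable_enorm.
rewrite -ge0_integralZl//; last 2 first.
- exact: emeasurable_funM.
- by move=> y _; rewrite mule_ge0// lee_fin invr_ge0 powR_ge0.
apply: eq_integral => y _; rewrite /H/=.
(* The radial integral is known only for a positive radius; at the origin [h 0 = 0] annihilates both
   sides. *)
have [->|y0] := eqVneq y 0.
  rewrite h00 mul0e mule0 integral0_eq// => r _; exact: mul0e.
rewrite ge0_integralZl//; last first.
  apply: emeasurable_funM.
    apply/measurable_EFinP; apply: measurable_funM.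
      exact: measurable_line_weight.
    under eq_fun do rewrite -exprVn -powR_inv1//.
    by apply: measurable_funX; apply: (measurableT_comp (measurable_powR _)).
  apply: (measurableT_comp measurable_slice); apply: measurable_funM => //.
  under eq_fun do rewrite -powR_inv1//.
  by apply: (measurableT_comp (measurable_powR _)).
by rewrite integral_kernel_radial ?enorm_gt0// muleCA.
Qed.

End kernel_identity.
Arguments slice_set {R} n rho _ : rename.

(** * Integrals of powers, the Gamma function and [C_ns] *)

Section power_integrals.
Context {R : realType}.
Local Notation leb := (@lebesgue_measure R).
Implicit Types (f : R -> \bar R) (a b c d : R).

Lemma measurable_powR_EFin b (D : set R) :
  measurable_fun D (fun x : R => (x `^ b)%:E).
Proof.
by apply: measurable_funTS; apply/measurable_EFinP; exact: measurable_powR.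
Qed.

Lemma integral_powR b c d : b != 0 -> 0 < c -> c < d ->
  (\int[leb]_(x in `[c, d]) (x `^ (b - 1))%:E = ((d `^ b - c `^ b) / b)%:E)%E.
Proof.
move=> b0 c0 cd.
have derF (x : R) : 0 < x -> is_derive x 1 (fun x : R => b^-1 * x `^ b) (x `^ (b - 1)).
  move=> x0; have H := is_derive1_powR b x0.
  rewrite -[X in is_derive _ _ _ X](mulKf b0); exact: (is_deriveZ b^-1).
have contF (x : R) : 0 < x -> {for x, continuous (fun x : R => b^-1 * x `^ b)}.
  move=> x0; apply: differentiable_continuous; apply/derivable1_diffP.
  by have [] := derF x x0.
have contf (x : R) : 0 < x -> {for x, continuous (fun x : R => x `^ (b - 1))}.
  move=> x0; apply: differentiable_continuous; apply/derivable1_diffP.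
  by have [] := is_derive1_powR (b - 1) x0.
rewrite (@continuous_FTC2 _ _ (fun x => b^-1 * x `^ b)) //.
- by rewrite -EFinB -mulrBr mulrC.
- apply: continuous_in_subspaceT => x; rewrite inE/= in_itv/= => /andP[cx _].
  by apply: contf; exact: lt_le_trans cx.
- split.
  + move=> x; rewrite in_itv/= => /andP[cx _].
    by have [] := derF x (lt_trans c0 cx).
  + apply: cvg_at_right_filter; exact: contF.
  + by apply: cvg_at_left_filter; apply: contF; exact: lt_trans cd.
- move=> x; rewrite in_itv/= => /andP[cx _].
  by rewrite derive1E; have [_ ->] := derF x (lt_trans c0 cx).
Qed.

Lemma integral_powR_near0 b : 0 < b ->
  (\int[leb]_(x in `]0%R, 1%R]) (x `^ (b - 1))%:E <= (b^-1)%:E)%E.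
Proof.
move=> b0.
(* The index [k.+2] keeps the interval nondegenerate already for [k = 0], as the formula for power
   integrals requires. *)
pose F (k : nat) : set R := `[k.+2%:R^-1, 1]%classic.
have FU : `]0, 1]%classic = \bigcup_k F k.
  apply/seteqP; split => x /=.
    rewrite in_itv/= => /andP[x0 x1].
    have [k xk] := ltr_add_invr x0.
    exists k => //; rewrite /F/= in_itv/= x1 andbT.
    apply: ltW; apply: le_lt_trans xk; rewrite add0r.
    by rewrite lef_pV2 ?posrE// ler_nat.
  move=> [k _]; rewrite /F/= !in_itv/= => /andP[kx ->].
  by rewrite andbT; apply: lt_le_trans kx.
have nF : nondecreasing_seq F.
  move=> i j ij; rewrite subsetEset /F => x /=; rewrite !in_itv/= => /andP[ix ->].
  by rewrite andbT; apply: le_trans ix; rewrite lef_pV2 ?posrE// ler_nat !ltnS.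
rewrite FU.
have H : ((\int[leb]_(x in F k) (x `^ (b - 1))%:E) @[k --> \oo] -->
    (\int[leb]_(x in \bigcup_k F k) (x `^ (b - 1))%:E))%E.
  apply: ge0_nondecreasing_set_cvg_integral => //.
  - by move=> i; exact: measurable_itv.
  - by move=> i; exact: measurable_powR_EFin.
  - by move=> i x _; rewrite lee_fin powR_ge0.
rewrite -(cvg_lim _ H)//; apply: lime_le.
  by apply/cvg_ex; eexists; exact: H.
apply: nearW => k; rewrite integral_powR//; last 2 first.
- by rewrite gt_eqF.
- by rewrite invf_lt1// ltr1n.
by rewrite lee_fin powR1 ler_pdivrMr// mulVf ?gt_eqF// lerBlDr lerDl powR_ge0.
Qed.

Lemma integral_powR_nearoo a : 0 < a ->
  (\int[leb]_(x in `[1%R, +oo[) (x `^ (- a - 1))%:E <= (a^-1)%:E)%E.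
Proof.
move=> a0.
pose F (k : nat) : set R := `[1, k.+2%:R]%classic.
have FU : `[1, +oo[%classic = \bigcup_k F k.
  apply/seteqP; split => x /=.
    rewrite in_itv/= andbT => x1.
    have xk := archi_boundP (le_trans ler01 x1).
    exists (Num.bound x) => //; rewrite /F/= in_itv/= x1/=.
    by apply: ltW; apply: lt_le_trans xk _; rewrite ler_nat; exact: leqW.
  by move=> [k _]; rewrite /F/= !in_itv/= andbT => /andP[->].
have nF : nondecreasing_seq F.
  move=> i j ij; rewrite subsetEset /F => x /=; rewrite !in_itv/= => /andP[-> ix].
  by apply: (le_trans ix); rewrite ler_nat !ltnS.
rewrite FU.
have H : ((\int[leb]_(x in F k) (x `^ (- a - 1))%:E) @[k --> \oo] -->
    (\int[leb]_(x in \bigcup_k F k) (x `^ (- a - 1))%:E))%E.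
  apply: ge0_nondecreasing_set_cvg_integral => //.
  - by move=> i; exact: measurable_itv.
  - by move=> i; exact: measurable_powR_EFin.
  - by move=> i x _; rewrite lee_fin powR_ge0.
rewrite -(cvg_lim _ H)//; apply: lime_le.
  by apply/cvg_ex; eexists; exact: H.
apply: nearW => k; rewrite integral_powR//; last 2 first.
- by rewrite oppr_eq0 gt_eqF.
- by rewrite ltr1n.
rewrite lee_fin powR1 invrN mulrN -mulNr opprB ler_pdivrMr// mulVf ?gt_eqF//.
Qed.

(** Cut at 1: the part near 0 costs [C / b], the part near infinity [C / a]. It serves for [Gamma]
    and, through its even version, for the kernels on a line. *)
Lemma integral_halfline_le f C a b : 0 < a -> 0 < b -> 0 <= C ->
  measurable_fun [set: measurableTypeR R] f -> (forall x, 0 <= f x)%E ->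
  (forall x, 0 < x <= 1 -> (f x <= (C * x `^ (b - 1))%:E)%E) ->
  (forall x, 1 <= x -> (f x <= (C * x `^ (- a - 1))%:E)%E) ->
  (\int[leb]_(x in `]0%R, +oo[) f x <= (C * (b^-1 + a^-1))%:E)%E.
Proof.
move=> a0 b0 C0 mf f0 f1 f2.
have mC (p : R) (D : set R) : measurable_fun D (fun x : R => (C * x `^ p)%:E).
  apply: measurable_funTS; apply/measurable_EFinP.
  by apply: measurable_funM => //; exact: measurable_powR.
have Z (p : R) (D : set R) : measurable D ->
    (\int[leb]_(x in D) (C * x `^ p)%:E =
     C%:E * \int[leb]_(x in D) (x `^ p)%:E)%E.
  move=> mD; rewrite -ge0_integralZl//.
  - exact: measurable_powR_EFin.
  - by move=> x _; rewrite lee_fin powR_ge0.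
rewrite (_ : `]0, +oo[%classic = `]0, 1]%classic `|` `]1, +oo[%classic); last first.
  by rewrite -itv_bndbnd_setU// bnd_simp.
rewrite ge0_integral_setU//=; last 2 first.
- exact: measurable_funTS.
- rewrite disj_set2E; apply/eqP/seteqP; split => // x [] /=.
  by rewrite !in_itv/= andbT => /andP[_ x1] /(le_lt_trans x1); rewrite ltxx.
rewrite mulrDr EFinD; apply: leeD.
  apply: (@le_trans _ _ (\int[leb]_(x in `]0%R, 1%R]) (C * x `^ (b - 1))%:E)%E).
    apply: ge0_le_integral => //.
    + exact: measurable_funTS.
    + exact: mC.
  rewrite Z// EFinM lee_pmul//; last exact: integral_powR_near0.
  by apply: integral_ge0 => x _; rewrite lee_fin powR_ge0.
apply: (@le_trans _ _ (\int[leb]_(x in `[1%R, +oo[) (C * x `^ (- a - 1))%:E)%E).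
  apply: (@le_trans _ _ (\int[leb]_(x in `[1%R, +oo[) f x)%E).
    apply: ge0_subset_integral => //; first exact: measurable_funTS.
    by apply: subset_itvr; rewrite bnd_simp.
  apply: ge0_le_integral => //.
  + exact: measurable_funTS.
  + exact: mC.
  + by move=> x; rewrite /= in_itv/= andbT; exact: f2.
rewrite Z// EFinM lee_pmul//; last exact: integral_powR_nearoo.
by apply: integral_ge0 => x _; rewrite lee_fin powR_ge0.
Qed.

Lemma integral_line_lty f C a b : 0 < a -> 0 < b -> 0 <= C ->
  measurable_fun [set: measurableTypeR R] f -> (forall x, 0 <= f x)%E ->
  (forall x, f (- x) = f x) ->
  (forall x, 0 < x <= 1 -> (f x <= (C * x `^ (b - 1))%:E)%E) ->
  (forall x, 1 <= x -> (f x <= (C * x `^ (- a - 1))%:E)%E) ->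
  (\int[leb]_x f x < +oo)%E.
Proof.
move=> a0 b0 C0 mf f0 feven f1 f2.
have H := integral_halfline_le a0 b0 C0 mf f0 f1 f2.
have mfT (D : set R) : measurable_fun D f by exact: measurable_funTS.
rewrite (_ : [set: _] = `]-oo, 0]%classic `|` `]0, +oo[%classic); last first.
  by rewrite -itv_bndbnd_setU// set_itvNyy.
rewrite ge0_integral_setU//=; last 2 first.
- exact: mfT.
- rewrite disj_set2E; apply/eqP/seteqP; split => // x [] /=.
  by rewrite !in_itv/= andbT => x0 /(le_lt_trans x0); rewrite ltxx.
have -> : (\int[leb]_(x in `]-oo, 0%R]) f x = \int[leb]_(x in `]0%R, +oo[) f x)%E.
  rewrite integral_itv_obnd_cbnd// ge0_integration_by_substitution0//.
  by apply: eq_integral => x _; rewrite feven.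
by apply: lte_add_pinfty; apply: (le_lt_trans H); rewrite ltry.
Qed.


(** One term of the exponential series, [x^(N+2) / (N+2)! <= exp x]. The exponent is written
    [- 1 - 1] to match the decay [- a - 1] of [integral_halfline_le] with [a = 1]. *)
Lemma expRN_le_powR (N : nat) (x : R) : 1 <= x ->
  x `^ N%:R * expR (- x) <= N.+2`!%:R * x `^ (- 1 - 1).
Proof.
move=> x1; have x0 : 0 < x by exact: lt_le_trans x1.
have fact0 : 0 < N.+2`!%:R :> R by rewrite ltr0n fact_gt0.
have := expR_ge1Dxn N.+1 (ltW x0).
have -> : x `^ (- 1 - 1) = x ^- 2.
  by rewrite -opprD powRN -[1 + 1]/(2%:R) powR_mulrn ?ltW.
rewrite powR_mulrn; last exact: ltW.
rewrite expRN => H.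
have xp : 0 < x ^+ N.+2 by exact: exprn_gt0.
rewrite ler_pdivrMr ?expR_gt0//.
have -> : x ^+ N = x ^+ N.+2 / x ^+ 2.
  by rewrite -addn2 exprD mulfK// expf_neq0// gt_eqF.
rewrite [leRHS]mulrAC ler_pM2r ?invr_gt0 ?exprn_gt0//.
rewrite mulrC -ler_pdivrMr//.
by apply: le_trans H; rewrite lerDr.
Qed.

Let gamma_integrand (a t : R) := (t `^ (a - 1) * expR (- t))%:E.

Let measurable_gamma_integrand (a : R) (D : set R) :
  measurable_fun D (gamma_integrand a).
Proof.
apply: measurable_funTS; apply/measurable_EFinP; apply: measurable_funM.
  exact: measurable_powR.
by apply: (measurableT_comp (@measurable_expR R)).
Qed.

Lemma Gamma_integral_le (N : nat) (a : R) : 0 < a <= N.+1%:R ->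
  (\int[leb]_(t in `]0%R, +oo[) gamma_integrand a t <=
     (N.+2`!%:R * (a^-1 + 1))%:E)%E.
Proof.
move=> /andP[a0 aN].
have fact1 : 1 <= N.+2`!%:R :> R by rewrite ler1n fact_gt0.
have := @integral_halfline_le (gamma_integrand a) N.+2`!%:R 1 a ltr01 a0.
rewrite invr1; apply.
- exact: le_trans fact1.
- exact: measurable_gamma_integrand.
- by move=> x; rewrite lee_fin mulr_ge0 ?powR_ge0 ?expR_ge0.
- move=> x /andP[x0 x1]; rewrite lee_fin mulrC ler_wpM2r ?powR_ge0//.
  by apply: le_trans fact1; rewrite expR_le1 oppr_le0 ltW.
- move=> x x1; rewrite lee_fin; apply: le_trans (expRN_le_powR N x1).
  by rewrite ler_wpM2r ?expR_ge0// ler_powR// lerBlDr natr1.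
Qed.

Lemma Gamma_ge0 (a : R) : 0 <= Gamma a.
Proof. by apply: Rintegral_ge0 => t _; rewrite mulr_ge0 ?powR_ge0 ?expR_ge0. Qed.

Lemma Gamma_le (N : nat) (a : R) : 0 < a <= N.+1%:R ->
  Gamma a <= N.+2`!%:R * (a^-1 + 1).
Proof.
move=> aN; have H := Gamma_integral_le aN.
rewrite -lee_fin; apply: le_trans H.
rewrite /Gamma /Rintegral fineK//.
rewrite ge0_fin_numE.
  by apply: le_lt_trans (Gamma_integral_le aN) _; rewrite ltry.
by apply: integral_ge0 => t _; rewrite lee_fin mulr_ge0 ?powR_ge0 ?expR_ge0.
Qed.

(** Keep only the integral over [[e, 1]] with [e^a = 1/2]: there [exp (- t) >= exp (- 1)], and the
    power integrates to [(1 - 1/2) / a]. This gives the blow-up rate of [Gamma (1 - s)] as [s] tends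
    to 1. *)
Lemma Gamma_ge (a : R) : 0 < a <= 1 -> expR (- 1) / (2 * a) <= Gamma a.
Proof.
move=> /andP[a0 a1].
pose e : R := (2^-1) `^ (a^-1).
have ea : e `^ a = 2^-1 by rewrite /e -powRrM mulVf ?gt_eqF// powRr1// invr_ge0.
have e0 : 0 < e by rewrite powR_gt0// invr_gt0.
have e1 : e < 1.
  have <- : 1 `^ (a^-1) = 1 :> R by rewrite powR1.
  apply: gt0_ltr_powR; rewrite ?invr_gt0 ?nnegrE ?invr_ge0//.
  by rewrite invf_lt1// ltr1n.
have H := @Gamma_integral_le 0 a; rewrite a0 a1 in H; have {}H := H isT.
rewrite -lee_fin /Gamma /Rintegral fineK; last first.
  rewrite ge0_fin_numE; first by apply: le_lt_trans H _; rewrite ltry.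
  by apply: integral_ge0 => t _; rewrite lee_fin mulr_ge0 ?powR_ge0 ?expR_ge0.
apply: (@le_trans _ _ (\int[leb]_(t in `[e, 1%R]) gamma_integrand a t)%E).
  apply: (@le_trans _ _
      (\int[leb]_(t in `[e, 1%R]) ((expR (- 1))%:E * (t `^ (a - 1))%:E))%E).
    rewrite ge0_integralZl//; last 2 first.
    - exact: measurable_powR_EFin.
    - by move=> x _; rewrite lee_fin powR_ge0.
    rewrite integral_powR ?gt_eqF// powR1 ea -EFinM lee_fin.
    have -> : 1 - 2^-1 = 2^-1 :> R by lra.
    by rewrite invfM.
  apply: ge0_le_integral => //.
  - by move=> x _; rewrite mule_ge0// lee_fin ?expR_ge0 ?powR_ge0.
  - by apply: emeasurable_funM => //; exact: measurable_powR_EFin.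
  - exact: measurable_gamma_integrand.
  - move=> x; rewrite /= in_itv/= => /andP[_ x1].
    by rewrite -EFinM lee_fin mulrC ler_wpM2l ?powR_ge0// ler_expR lerN2.
apply: ge0_subset_integral => //.
- exact: measurable_gamma_integrand.
- by move=> x _; rewrite lee_fin mulr_ge0 ?powR_ge0 ?expR_ge0.
- by move=> x /=; rewrite !in_itv/= => /andP[ex _]; rewrite (lt_le_trans e0).
Qed.

Lemma C_ns_ge0 (n : nat) (s : R) : 0 <= s -> 0 <= C_ns n s.
Proof.
by move=> s0; rewrite /C_ns divr_ge0// !mulr_ge0 ?powR_ge0 ?Gamma_ge0.
Qed.

(** The factor [1 - s] comes from [Gamma (1 - s)] in the denominator. It later cancels the factor
    [1 - s] of [Is], which is what keeps the ellipticity constant bounded. *)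
Lemma C_ns_le (n : nat) : exists2 M : R, 0 < M &
  forall s, 2^-1 <= s < 1 -> C_ns n s <= M * (1 - s).
Proof.
pose D : R := pi `^ (n%:R / 2) * (expR (- 1) / 2).
have D0 : 0 < D.
  by rewrite mulr_gt0 ?powR_gt0 ?pi_gt0// divr_gt0 ?expR_gt0.
(* Bounds the numerator: [4^s s <= 4], and the argument of [Gamma] lies between [1/2] and [n + 1],
   so that its inverse plus 1 is at most 3. *)
pose G : R := 4 * (n.+2`!%:R * 3).
have G0 : 0 < G by rewrite !mulr_gt0// ltr0n fact_gt0.
exists (G / D); first by rewrite divr_gt0.
move=> s /andP[s2 s1].
have s1' : 0 < 1 - s <= 1 by lra.
have n0 : 0 <= n%:R :> R by [].
have num : 4 `^ s * s * Gamma ((n%:R + 2 * s) / 2) <= G.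
  have p4 : 4 `^ s <= 4 :> R.
    by rewrite -[leRHS]powRr1// ler_powR ?ler1n//; exact: ltW.
  have s_ge0 : 0 <= s by lra.
  have p4s : 4 `^ s * s <= 4.
    by rewrite -[leRHS]mulr1 ler_pM ?powR_ge0//; lra.
  apply: ler_pM => //; [by rewrite mulr_ge0 ?powR_ge0|exact: Gamma_ge0|].
  have a0 : 0 < (n%:R + 2 * s) / 2 by rewrite divr_gt0//; lra.
  apply: (@le_trans _ _ (n.+2`!%:R * (((n%:R + 2 * s) / 2)^-1 + 1))).
    by apply: Gamma_le; rewrite a0/= -[n.+1%:R]natr1; lra.
  rewrite ler_wpM2l//.
  have : ((n%:R + 2 * s) / 2)^-1 <= 2.
    by rewrite invf_ple ?posrE//; lra.
  by move=> ?; lra.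
have den : D / (1 - s) <= pi `^ (n%:R / 2) * Gamma (1 - s).
  rewrite /D -mulrA ler_wpM2l ?powR_ge0//.
  by apply: le_trans (Gamma_ge s1'); rewrite invfM mulrA.
have den0 : 0 < D / (1 - s) by rewrite divr_gt0//; lra.
rewrite /C_ns ler_pdivrMr; last exact: lt_le_trans den.
apply: (le_trans num).
apply: (@le_trans _ _ (G / D * (1 - s) * (D / (1 - s)))).
  rewrite mulrACA divfK ?gt_eqF// divff ?mulr1//.
  by rewrite gt_eqF//; lra.
by rewrite ler_wpM2l// mulr_ge0 ?divr_ge0 ?ltW//; lra.
Qed.

End power_integrals.

(** * Bounds on the averaging constant *)

Section kernel_bounds.
Context {R : realType} (n : nat).
Local Notation vec := 'cV[R]_n.
Local Notation leb := (@lebesgue_measure R).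
Local Notation lam := (lebesgue_cV R n).
Local Notation lam2 := (lam \x lam)%E.
Local Notation W := (@pair_ball R n).

Lemma slice_le (rho : R) : (slice n rho <= (2 ^+ n)%:E)%E.
Proof.
rewrite -[2]mulr1; have := @lebesgue_cube R n 1 ler01 => <-.
apply: le_measure; rewrite ?inE; [exact: measurable_slice_set|exact: measurable_cube|].
move=> v /= H i; apply: (le_trans (entry_le_enorm _ _)).
rewrite -ler_sqr ?nnegrE ?enorm_ge0// expr1n; apply: le_trans H.
by rewrite lerDr sqr_ge0.
Qed.

Lemma slice_eq0 (rho : R) : 1 < rho -> slice n rho = 0%E.
Proof.
move=> rho1; rewrite /slice (_ : slice_set n rho = set0) ?measure0//.
apply/seteqP; split => // v /= H.
have : rho ^+ 2 <= 1 by apply: le_trans H; rewrite lerDl sqr_ge0.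
by rewrite leNgt exprn_egt1.
Qed.

Lemma slice_ge (rho : R) : 0 <= rho <= 2^-1 ->
  (((2 * (1 + 2 * n%:R)^-1) ^+ n)%:E <= slice n rho)%E.
Proof.
move=> /andP[rho0 rho1].
(* Chosen so that [n q <= 1/2] and [q <= 1], whence [1/4 + n q^2 <= 1]. *)
set q : R := (1 + 2 * n%:R)^-1.
have nr : 0 <= n%:R :> R by [].
have q0 : 0 <= q by rewrite invr_ge0; lra.
have qE : q * (1 + 2 * n%:R) = 1 by rewrite mulVf//; apply: lt0r_neq0; lra.
have := @lebesgue_cube R n q q0 => <-.
apply: le_measure; rewrite ?inE; [exact: measurable_cube|exact: measurable_slice_set|].
move=> v /(enorm_cube q0) H.
apply: (@le_trans _ _ (2^-1 ^+ 2 + n%:R * q ^+ 2)).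
  by rewrite lerD// ler_sqr// nnegrE.
have q1 : q <= 1 by nra.
have nq0 : 0 <= n%:R * q by rewrite mulr_ge0.
have -> : n%:R * q ^+ 2 = (n%:R * q) * q by ring.
by nra.
Qed.

Lemma norm_powN_le1 (x : R) : 1 <= x -> `|x| ^- n <= 1.
Proof.
move=> x1; rewrite ger0_norm ?(le_trans ler01)//.
by rewrite invf_le1 ?exprn_ege1// exprn_gt0// (lt_le_trans ltr01).
Qed.

Lemma line_weightE (s x : R) : 0 < x -> line_weight s x = x `^ (- (2 * s) - 1).
Proof.
by move=> x0; rewrite /line_weight gtr0_norm// -powRN opprD addrC.
Qed.

Lemma measurable_radial (s : R) : measurable_fun [set: measurableTypeR R]
  (fun r : R => ((line_weight s r * `|r| ^- n)%:E * slice n (`|r|^-1))%E).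
Proof.
have mnorm_inv : measurable_fun [set: measurableTypeR R] (fun r : R => `|r|^-1).
  rewrite (_ : (fun r : R => `|r|^-1) = (fun r => `|r| `^ (-1))).
    by apply: (measurableT_comp (measurable_powR _)).
  by apply/funext => r; rewrite powR_inv1.
apply: emeasurable_funM; last exact: (measurableT_comp (measurable_slice n)).
apply/measurable_EFinP; apply: measurable_funM.
  exact: measurable_line_weight.
by under eq_fun do rewrite -exprVn; exact: measurable_funX.
Qed.

Lemma radial_ge0 (s r : R) : (0 <= (line_weight s r * `|r| ^- n)%:E * slice n (`|r|^-1))%E.
Proof.
by rewrite mule_ge0 ?slice_ge0// lee_fin mulr_ge0 ?line_weight_ge0.
Qed.

(** For [|r| < 1] the section above a vector of norm [1 / |r| > 1] is empty, so the singularity at 0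
    is never seen; at infinity the line weight is integrable. *)
Lemma kernel_const_lty (s : R) : 0 < s -> (kernel_const n s < +oo)%E.
Proof.
move=> s0; have s20 : 0 < 2 * s by rewrite mulr_gt0.
apply: (@integral_line_lty _ _ (2 ^+ n) (2 * s) 1) => //.
- exact: measurable_radial.
- exact: radial_ge0.
- by move=> x; rewrite /line_weight normrN.
- move=> x /andP[x0]; rewrite le_eqVlt => /predU1P[->|x1].
    rewrite /line_weight normr1 powR1 !invr1 mul1r expr1n invr1 mul1e mulr1.
    exact: slice_le.
  rewrite slice_eq0 ?mule0 ?lee_fin ?mulr_ge0 ?powR_ge0//.
  by rewrite gtr0_norm// invf_gt1.
- move=> x x1; have x0 : 0 < x by exact: lt_le_trans x1.
  rewrite [(2 ^+ n) * _]mulrC [leRHS]EFinM lee_pmul ?slice_ge0 ?slice_le//.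
    by rewrite lee_fin mulr_ge0 ?line_weight_ge0.
  rewrite lee_fin line_weightE// -[leRHS]mulr1 ler_wpM2l ?powR_ge0//.
  exact: norm_powN_le1.
Qed.

(** Keep only [2 <= r <= 3], where the sections contain a fixed cube and the weight is smallest at
    [r = 3], [s = 1]. The bound is uniform in [s], as needed near 1. *)
Lemma kernel_const_ge : exists2 c0 : R, 0 < c0 &
  forall s : R, 0 < s <= 1 -> (c0%:E <= kernel_const n s)%E.
Proof.
pose k : R := (2 * (1 + 2 * n%:R)^-1) ^+ n.
have k0 : 0 < k.
  by rewrite exprn_gt0// mulr_gt0// invr_gt0 ltr_wpDr// mulr_ge0.
exists (3 `^ (- (2 * 1) - 1) * 3 ^- n * k).
  by rewrite !mulr_gt0 ?powR_gt0// invr_gt0 exprn_gt0.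
move=> s /andP[s0 s1].
apply: (@le_trans _ _ (\int[leb]_(r in `[2%R, 3%R])
    ((line_weight s r * `|r| ^- n)%:E * slice n (`|r|^-1)))%E); last first.
  apply: ge0_subset_integral => //; first exact: measurable_radial.
  by move=> r _; exact: radial_ge0.
apply: (@le_trans _ _ (\int[leb]_(r in `[2%R, 3%R])
    (3 `^ (- (2 * 1) - 1) * 3 ^- n * k)%:E)%E).
  rewrite integral_cst//= lebesgue_measure_itv/= lte_fin ifT ?ltr_nat//.
  by rewrite -EFinB -EFinM lee_fin ler_peMr//; [rewrite !mulr_ge0 ?powR_ge0 ?ltW|lra].
apply: ge0_le_integral => //.
- by move=> r _; rewrite lee_fin !mulr_ge0 ?powR_ge0 ?ltW.
- by apply: measurable_funTS; exact: measurable_radial.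
- move=> r; rewrite /= in_itv/= => /andP[r2 r3].
  have r0 : 0 < r by lra.
  rewrite EFinM lee_pmul//.
  + by rewrite lee_fin ltW.
  + rewrite lee_fin line_weightE// gtr0_norm// ler_pM ?powR_ge0//.
      apply: (@le_trans _ _ (3 `^ (- (2 * s) - 1))).
        by rewrite ler_powR ?ler1n// lerB// lerN2 ler_wpM2l.
      have -> : - (2 * s) - 1 = - (2 * s + 1) by ring.
      rewrite !powRN lef_pV2 ?posrE ?powR_gt0//.
      by rewrite ge0_ler_powR ?nnegrE//; lra.
    by rewrite lef_pV2 ?posrE ?exprn_gt0// lerXn2r// nnegrE; lra.
  + apply: slice_ge; rewrite invr_ge0 normr_ge0/=.
    by rewrite gtr0_norm// lef_pV2 ?posrE.
Qed.

Lemma kernel_const_gt0 (s : R) : 0 < s <= 1 -> (0 < kernel_const n s)%E.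
Proof.
move=> hs; have [c0 c00 H] := kernel_const_ge.
by apply: lt_le_trans (H s hs); rewrite lte_fin.
Qed.

Lemma kernel_const_fin (s : R) : 0 < s -> kernel_const n s \is a fin_num.
Proof. by move=> s0; rewrite ge0_fin_numE ?kernel_const_ge0// kernel_const_lty. Qed.

(** The averaging identity read backwards: the line integrals are bounded on a ball of finite mass,
    and the constant in front of the integral over R^n is positive. *)
Lemma integral_min_sqr_lty (s : R) : 0 < s < 1 ->
  (\int[lam]_y (Num.min (enorm y ^+ 2) 1 / enorm y `^ (n%:R + 2 * s))%:E < +oo)%E.
Proof.
move=> /andP[s0 s1].
pose h (y : vec) : \bar R := (Num.min (enorm y ^+ 2) 1)%:E.
have mh : measurable_fun [set: vec] h.
  apply/measurable_EFinP; apply: measurable_minr => //.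
  by apply: measurable_funX; exact: measurable_enorm.
have h0 y : (0 <= h y)%E by rewrite lee_fin le_min sqr_ge0/=.
have h00 : h 0 = 0%E.
  have e0 : enorm (0 : vec) = 0 by apply/eqP; rewrite enorm_eq0.
  by rewrite /h e0 expr0n/= min_l.
have := integral_ball_line s0 mh h0 h00.
under [X in (_ * X)%E]eq_integral do rewrite -EFinM.
rewrite -/(h _).
set I := (\int[lam]_y _)%E => E.
pose L := (\int[leb]_r (Num.min (`|r| ^+ 2) 1 * line_weight s r)%:E)%E.
have mL : measurable_fun [set: measurableTypeR R]
    (fun r : R => (Num.min (`|r| ^+ 2) 1 * line_weight s r)%:E).
  apply/measurable_EFinP; apply: measurable_funM.
    by apply: measurable_minr => //; exact: measurable_funX.
  exact: measurable_line_weight.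
have L0 r : (0 <= (Num.min (`|r| ^+ 2) 1 * line_weight s r)%:E)%E.
  by rewrite lee_fin mulr_ge0 ?line_weight_ge0// le_min sqr_ge0/=.
have Loo : (L < +oo)%E.
  have a0 : 0 < 2 * s by rewrite mulr_gt0.
  have b0 : 0 < 2 - 2 * s by lra.
  apply: (integral_line_lty a0 b0 ler01 mL L0).
  - by move=> x; rewrite /line_weight normrN.
  - move=> x /andP[x0 x1]; rewrite lee_fin mul1r line_weightE// gtr0_norm//.
    have -> : 2 - 2 * s - 1 = 2%:R + (- (2 * s) - 1) by ring.
    rewrite [leRHS]powRD ?(gt_eqF x0) ?implybT// powR_mulrn; last exact: ltW.
    by rewrite ler_wpM2r ?powR_ge0// ge_min lexx.
  - move=> x x1; have x0 : 0 < x by exact: lt_le_trans x1.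
    by rewrite lee_fin line_weightE// ler_wpM2r ?powR_ge0// ge_min lexx orbT.
have mB := @measurable_pair_ball R n.
have : (kernel_const n s * I < +oo)%E.
  rewrite -E.
  apply: (@le_lt_trans _ _ (\int[lam2]_(w in W) L)%E).
    apply: ge0_le_integral => //.
    - by move=> w _; apply: integral_ge0 => r _; rewrite mule_ge0// lee_fin line_weight_ge0.
    - apply: measurable_funTS.
      exact: (measurableT_comp (measurable_line_integral s mh h0) measurable_fst).
    - move=> w; rewrite /W /pair_ball/= => Ww; apply: ge0_le_integral => //.
      + by move=> r _; rewrite mule_ge0// lee_fin line_weight_ge0.
      + exact: (measurableT_comp (measurable_line_integrand s mh) (measurable_pair1 w.1)).
      + move=> r _; rewrite -EFinM lee_fin ler_wpM2r ?line_weight_ge0//.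
        rewrite enormZ exprMn.
        have : enorm w.1 ^+ 2 <= 1 by apply: le_trans Ww; rewrite lerDl sqr_ge0.
        move=> w1; rewrite le_min ge_min ge_min lexx orbT andbT ler_piMr ?sqr_ge0//.
  rewrite integral_cst//=; apply: lte_mul_pinfty => //.
  - exact: integral_ge0.
  - by rewrite ge0_fin_numE//; exact: integral_ge0.
  - exact: pair_ball_lty.
have s01 : 0 < s <= 1 by rewrite s0 ltW.
rewrite ltNge leye_eq => H; rewrite ltNge leye_eq; apply: contra H => /eqP ->.
by rewrite gt0_muley// kernel_const_gt0.
Qed.

End kernel_bounds.

(** * Principal values and second differences *)

Section borel_vectors.
Context {R : realType} (n : nat).
Local Notation vec := 'cV[R]_n.

Lemma ball_cVP (x y : vec) (e : R) : 0 < e ->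
  ball x e y <-> forall i, `|x i ord0 - y i ord0| < e.
Proof.
move=> e0; split=> [[_ H] i|H]; first exact: (H i ord0).
by split=> // i j; rewrite (ord1 j); exact: H.
Qed.

Lemma measurable_ball_cV (x : vec) (e : R) : 0 < e -> measurable (ball x e : set vec).
Proof.
move=> e0.
rewrite (_ : ball x e = \bigcap_(i in [set: 'I_n])
    [set v : vec | `|x i ord0 - v i ord0| < e]); last first.
  apply/seteqP; split => v /=.
    by move=> /(ball_cVP _ _ e0) H i _; exact: H.
  by move=> H; apply/(ball_cVP _ _ e0) => i; exact: H.
apply: fin_bigcap_measurable; first exact: finite_finset.
move=> i _; rewrite -[X in measurable X]setTI.
apply: (@measurable_fun_ltr _ _ _ _
  (fun v : vec => `|x i ord0 - v i ord0|) (cst e)) => //.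
apply: measurableT_comp => //; apply: measurable_funB => //.
exact: measurable_cV_entry.
Qed.

(** An open set is a countable union of balls with rational centres and radii [1 / (k + 1)], and
    sup-norm balls are finite intersections of conditions on entries. *)
Lemma open_measurable_cV (U : set vec) : open U -> measurable U.
Proof.
move=> oU.
pose Q (p : 'cV[rat]_n * nat) : vec := \col_i ratr (p.1 i ord0).
pose F (p : 'cV[rat]_n * nat) : set vec :=
  if `[< ball (Q p) (p.2.+1%:R^-1) `<=` U >] then ball (Q p) (p.2.+1%:R^-1) else set0.
rewrite (_ : U = \bigcup_p F p); last first.
  apply/seteqP; split => x; last first.
    by move=> [p _]; rewrite /F; case: asboolP => // H; exact: H.
  move=> Ux; have /nbhs_ballP[e/= e0 eU] : nbhs x U by exact: open_nbhs_nbhs.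
  have e20 : 0 < e / 2 by rewrite divr_gt0.
  have [k ke] := ltr_add_invr e20; rewrite add0r in ke.
  have k0 : 0 < k.+1%:R^-1 :> R by [].
  have /choice[q qP] : forall i, exists q : rat, `|ratr q - x i ord0| < k.+1%:R^-1.
    move=> i; have [|q] := @rat_in_itvoo R (x i ord0 - k.+1%:R^-1)
      (x i ord0 + k.+1%:R^-1); 
      first by rewrite ltrD2l (lt_trans _ k0)// oppr_lt0.
    by rewrite in_itv/= -ltr_distlC distrC => Hq; exists q.
  exists (\col_i q i, k) => //.
  have H : ball (Q (\col_i q i, k)) (k.+1%:R^-1) `<=` U.
    move=> y /(ball_cVP _ _ k0) Hy; apply: eU; apply/(ball_cVP _ _ e0) => i.
    have := Hy i; have := qP i; rewrite !mxE => H1 H2.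
    have -> : x i ord0 - y i ord0 =
        - (ratr (q i) - x i ord0) + (ratr (q i) - y i ord0) by ring.
    apply: (le_lt_trans (ler_normD _ _)); rewrite normrN (splitr e).
    by rewrite ltrD// ?(lt_trans H1)// (lt_trans H2).
  rewrite /F asboolT//; apply/(ball_cVP _ _ k0) => i; rewrite !mxE; exact: qP.
apply: countable_bigcupT_measurable => // p; rewrite /F.
by case: ifP => // _; apply: measurable_ball_cV.
Qed.

Lemma continuous_at_measurable_cV (N : set vec) (f : vec -> R) : open N ->
  (forall y, N y -> {for y, continuous f}) -> measurable_fun N f.
Proof.
move=> oN cf mN; apply: (measurability _ (RGenOInfty.measurableE R)) => //.
move=> _ [_ [a ->] <-]; apply: open_measurable_cV.
rewrite openE => y [Ny]; rewrite /= in_itv/= andbT => ay.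
apply: filterI; first exact: open_nbhs_nbhs.
have H : nbhs (f y) `]a, +oo[%classic.
  by apply: open_nbhs_nbhs; split; [exact: interval_open|rewrite /= in_itv/= andbT].
exact: (cf y Ny _ H).
Qed.

Lemma continuous_measurable_cV (f : vec -> R) :
  continuous f -> measurable_fun [set: vec] f.
Proof.
by move=> cf; apply: continuous_at_measurable_cV => [|y _];
  [exact: openT|exact: cf].
Qed.

End borel_vectors.

(** * Second differences of C^2 functions *)

Section second_differences.
Context {R : realType} (n : nat).
Local Notation vec := 'cV[R]_n.
Local Notation unitv i := (delta_mx i ord0 : vec).

Lemma is_derive_line (f : vec -> R) (p e : vec) (t : R) :
  derivable f (p + t *: e) e ->
  is_derive t 1 (fun t => f (p + t *: e)) ('D_e f (p + t *: e)).
Proof.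
move=> H.
have E : (fun h : R => h^-1 *: (f (p + (h *: 1 + t) *: e) - f (p + t *: e))) =
         (fun h : R => h^-1 *: (f (h *: e + (p + t *: e)) - f (p + t *: e))).
  apply/funext => h; congr (_ *: (f _ - _)).
  by rewrite scalerDl addrCA /GRing.scale/= mulr1.
split; first by rewrite /derivable E.
by rewrite /derive E.
Qed.

Lemma line_lipschitz (f : vec -> R) (p e : vec) (M t1 t2 : R) : t1 <= t2 ->
  (forall t, t1 <= t <= t2 -> derivable f (p + t *: e) e /\
     `|'D_e f (p + t *: e)| <= M) ->
  `|f (p + t2 *: e) - f (p + t1 *: e)| <= M * (t2 - t1).
Proof.
move=> t12 H.
have D t : t \in `[t1, t2] ->
    is_derive t 1 (fun t => f (p + t *: e)) ('D_e f (p + t *: e)).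
  by rewrite in_itv/= => /H[Ht _]; exact: is_derive_line.
pose g (t : R) : R := f (p + t *: e).
pose dg (t : R) : R := 'D_e f (p + t *: e).
have Dg t : t \in `]t1, t2[ -> is_derive t 1 g (dg t).
  by move=> Ht; apply: D; exact: subset_itv_oo_cc.
have Cg : {within `[t1, t2], continuous g}.
  apply: continuous_in_subspaceT => t; rewrite inE/= => Ht.
  apply: differentiable_continuous; apply/derivable1_diffP.
  by have [] := D t Ht.
have [c c12] := MVT_segment t12 Dg Cg.
rewrite -/(g t2) -/(g t1) => ->.
rewrite normrM (ger0_norm (_ : 0 <= t2 - t1)) ?subr_ge0//.
by rewrite ler_wpM2r ?subr_ge0//; apply: (H c _).2; move: c12; rewrite in_itv.
Qed.

(** Go from [a] to [b] by changing one coordinate at a time and apply the mean value theorem on each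
    segment; the path never leaves the box. Only partial derivatives are used. *)
Lemma cube_lipschitz (f : vec -> R) (x : vec) (r M d : R) : 0 <= M ->
  (forall y : vec, (forall i, `|x i ord0 - y i ord0| <= r) -> forall i,
     derivable f y (unitv i) /\ `|'D_(unitv i) f y| <= M) ->
  forall a b : vec, (forall i, `|x i ord0 - a i ord0| <= r) ->
  (forall i, `|x i ord0 - b i ord0| <= r) ->
  (forall i, `|b i ord0 - a i ord0| <= d) ->
  `|f b - f a| <= n%:R * (M * d).
Proof.
move=> M0 H a b Ba Bb Hd.
pose p (k : nat) : vec := \col_i (if (i < k)%N then b i ord0 else a i ord0).
have step (k : 'I_n) : `|f (p k.+1) - f (p k)| <= M * d.
  pose q : vec := \col_i (if (i < k)%N then b i ord0 else
                          if i == k then 0 else a i ord0).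
  have pk : p k = q + a k ord0 *: unitv k.
    apply/colP => i; rewrite !mxE eqxx andbT.
    by case: (eqVneq i k) => [->|ik]; rewrite ?ltnn ?mulr1 ?add0r// mulr0 addr0.
  have pk1 : p k.+1 = q + b k ord0 *: unitv k.
    apply/colP => i; rewrite !mxE eqxx andbT ltnS leq_eqVlt.
    case: (eqVneq i k) => [->|ik]; first by rewrite eqxx ltnn/= mulr1 add0r.
    by rewrite (negbTE (_ : nat_of_ord i != k))// mulr0 addr0.
  have inB t : Num.min (a k ord0) (b k ord0) <= t <= Num.max (a k ord0) (b k ord0) ->
      forall i, `|x i ord0 - (q + t *: unitv k) i ord0| <= r.
    move=> Ht i; rewrite !mxE eqxx andbT.
    case: (eqVneq i k) Ht => [<-{k pk pk1 q}|ik] Ht; last first.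
      by rewrite mulr0 addr0; case: ifP.
    rewrite ltnn mulr1 add0r; move: Ht (Ba i) (Bb i); rewrite !ler_norml.
    by rewrite minElt maxElt; case: ltP => ab /andP[? ?] /andP[? ?] /andP[? ?];
      apply/andP; split; lra.
  rewrite pk pk1.
  case: (leP (a k ord0) (b k ord0)) => ab.
    apply: (le_trans (@line_lipschitz f q _ M _ _ ab _)).
      by move=> t Ht; apply: H; apply: inB; rewrite min_l// max_r.
    by rewrite ler_wpM2l// (le_trans _ (Hd k))// ler_norm.
  rewrite distrC; apply: (le_trans (@line_lipschitz f q _ M _ _ (ltW ab) _)).
    by move=> t Ht; apply: H; apply: inB; rewrite min_r ?max_l// ltW.
  by rewrite ler_wpM2l// (le_trans _ (Hd k))// distrC ler_norm.
have -> : f b - f a = \sum_(k < n) (f (p k.+1) - f (p k)).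
  rewrite -(big_mkord xpredT (fun k => f (p k.+1) - f (p k))) telescope_sumr//.
  congr (f _ - f _); apply/colP => i; rewrite mxE ?ltn0//.
  by rewrite ltn_ord.
apply: (le_trans (ler_norm_sum _ _ _)).
apply: (le_trans (ler_sum _ (fun k _ => step k))).
by rewrite sumr_const card_ord mulr_natl.
Qed.

Lemma is_derive_of_line (f : vec -> R) (p e : vec) (df : R) :
  is_derive (0 : R) 1 (fun t => f (p + t *: e)) df -> is_derive p e f df.
Proof.
move=> [H1 H2].
have E : (fun h : R => h^-1 *: (f (p + (h *: 1 + 0) *: e) - f (p + 0 *: e))) =
         (fun h : R => h^-1 *: (f (h *: e + p) - f p)).
  apply/funext => h; congr (_ *: (f _ - f _)); last by rewrite scale0r addr0.
  by rewrite addr0 /GRing.scale/= mulr1 addrC.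
split; first by move: H1; rewrite /derivable E.
by move: H2; rewrite /derive E.
Qed.

Lemma is_derive_delta (psi : vec -> R) (x z e : vec) :
  derivable psi (x + z) e -> derivable psi (x - z) e ->
  is_derive z e (delta psi x) ('D_e psi (x + z) - 'D_e psi (x - z)).
Proof.
move=> Dp Dm; apply: is_derive_of_line.
have Hp : is_derive (0 : R) 1 (fun t => psi (x + z + t *: e)) ('D_e psi (x + z)).
  have e0 : x + z + (0 : R) *: e = x + z by rewrite scale0r addr0.
  by rewrite -[X in 'D_e psi X]e0; apply: is_derive_line; rewrite e0.
have Hm : is_derive (0 : R) 1 (fun t => psi (x - z + t *: e)) ('D_e psi (x - z)).
  have e0 : x - z + (0 : R) *: e = x - z by rewrite scale0r addr0.
  by rewrite -[X in 'D_e psi X]e0; apply: is_derive_line; rewrite e0.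
have HN : is_derive (0 : R) 1 (fun t : R => - t) (- 1) by exact: is_deriveN.
have Hm' : is_derive (0 : R) 1 (fun t => psi (x - z + (- t) *: e))
    ('D_e psi (x - z) * - 1).
  apply: (@is_derive1_comp _ (fun t => psi (x - z + t *: e)) (fun t : R => - t)).
  by rewrite oppr0.
have := is_deriveB (is_deriveD Hp Hm') (is_derive_cst (2 * psi x) (0 : R) 1).
rewrite mulrN1 subr0.
rewrite (_ : _ - _ = (fun t => delta psi x (z + t *: e)))//.
apply/funext => t; rewrite /delta/=; congr (psi _ + psi _ - _).
  by rewrite addrA.
by rewrite opprD scaleNr addrA.
Qed.

(** Two mean value estimates replace Taylor's formula. The function [delta psi x] vanishes at 0, and
    its partial derivatives at [z] are differences of those of [psi] at [x + z] and [x - z], hence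
    of order [d] by the bound on second derivatives. *)
Lemma C2_second_difference (N : set vec) (psi : vec -> R) (x : vec) :
  open N -> N x -> Ck_on 2 N psi ->
  exists r C : R, [/\ 0 < r, 0 <= C, ball x r `<=` N,
    forall y, ball x r (x + y) -> `|psi (x + y)| <= C &
    forall (y : vec) (d : R), d < r -> (forall i, `|y i ord0| <= d) ->
      `|delta psi x y| <= C * d ^+ 2].
Proof.
move=> oN Nx [c0 H1].
pose D2 (ij : 'I_n * 'I_n) y : R := 'D_(unitv ij.2) ('D_(unitv ij.1) psi) y.
pose M : R := 1 + \sum_ij `|D2 ij x|.
have M0 : 0 <= M by rewrite addr_ge0// sumr_ge0.
have D1c i y : N y -> derivable psi y (unitv i).
  by move=> Ny; apply: (H1 i).1.
have D2c i j y : N y -> derivable ('D_(unitv i) psi) y (unitv j).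
  by move=> Ny; apply: ((H1 i).2.2 j).1.
have nearM : \forall y \near x, [/\ N y, `|psi y| <= 1 + `|psi x| &
    forall ij, `|D2 ij y| <= M].
  have bound (g : vec -> R) : {for x, continuous g} ->
      \forall y \near x, `|g y| <= 1 + `|g x|.
    move=> /cvgr_dist_lt /(_ 1 ltr01); apply: filterS => y Hy.
    rewrite -lerBlDr (le_trans (lerB_dist _ _))//.
    by rewrite distrC ltW.
  have nearD2 : \forall y \near x, forall ij, `|D2 ij y| <= M.
    suff near1 ij : \forall y \near x, `|D2 ij y| <= M 
      by exact: (@filter_forall _ _ (fun ij y => `|D2 ij y| <= M) (nbhs x) _ near1).
    have H := ((H1 ij.1).2.2 ij.2).2.1.
    have := bound _ (H x Nx); apply: filterS => y Hy; apply: (le_trans Hy).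
    by rewrite lerD2l (bigD1 ij)//= lerDl sumr_ge0.
  near=> y; split; near: y; [exact: open_nbhs_nbhs|exact: bound (c0 x Nx)|exact: nearD2].
have /nbhs_ballP[r/= r0 rH] := nearM.
pose C : R := 1 + `|psi x| + n%:R * (n%:R * (M * 2)).
have C0 : 0 <= C by rewrite !addr_ge0// !mulr_ge0.
exists r, C; split => //.
- by move=> y /rH[].
- by move=> y /rH[_ Hy _]; apply: (le_trans Hy); rewrite lerDl !mulr_ge0.
move=> y d dr yd.
have inB (z : vec) : (forall i, `|z i ord0| <= d) -> ball x r (x + z).
  move=> zd; apply/(ball_cVP _ _ r0) => i; rewrite mxE opprD addrA subrr add0r.
  by rewrite normrN (le_lt_trans (zd i)).
have inBN (z : vec) : (forall i, `|z i ord0| <= d) -> ball x r (x - z).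
  by move=> zd; apply: inB => i; rewrite mxE normrN.
have key (z : vec) : (forall i, `|0 - z i ord0| <= d) -> forall i,
    derivable (delta psi x) z (unitv i) /\
    `|'D_(unitv i) (delta psi x) z| <= n%:R * (M * (2 * d)).
  move=> zd' i.
  have zd j : `|z j ord0| <= d by have := zd' j; rewrite sub0r normrN.
  have [Np _ _] := rH _ (inB _ zd); have [Nm _ _] := rH _ (inBN _ zd).
  have [? ->] := is_derive_delta (D1c i _ Np) (D1c i _ Nm).
  split=> //.
  apply: (@cube_lipschitz ('D_(unitv i) psi) x d M (2 * d) M0).
  - move=> w Hw j.
    have [Nw _ /(_ (i, j)) Mw] : [/\ N w, `|psi w| <= 1 + `|psi x| &
        forall ij, `|D2 ij w| <= M].
      apply: rH; apply/(ball_cVP _ _ r0) => k; exact: le_lt_trans (Hw k) dr.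
    by split; [exact: D2c|exact: Mw].
  - by move=> j; rewrite !mxE opprD opprK addrA subrr add0r.
  - by move=> j; rewrite !mxE opprD addrA subrr add0r normrN.
  - move=> j; rewrite !mxE; have -> : x j ord0 + z j ord0 - (x j ord0 - z j ord0) =
        2 * z j ord0 by ring.
    by rewrite normrM ger0_norm// ler_wpM2l.
(* In dimension 0 there is no coordinate from which [0 <= d] could be deduced; there [y = 0]. *)
have [n0|n0] := eqVneq n 0%N.
  have y0 : y = 0 by apply/colP => i; have := ltn_ord i; rewrite {2}n0 ltn0.
  rewrite /delta y0 subr0 addr0 -mulr2n mulr_natl subrr normr0.
  by rewrite mulr_ge0// sqr_ge0.
have d0 : 0 <= d.
  have i0 : 'I_n by exists 0%N; rewrite lt0n.
  exact: le_trans (yd i0).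
have D00 : delta psi x 0 = 0.
  by rewrite /delta subr0 addr0 -mulr2n mulr_natl subrr.
have := @cube_lipschitz (delta psi x) 0 d (n%:R * (M * (2 * d))) d _ _ 0 y.
rewrite D00 subr0 => H.
apply: (@le_trans _ _ (n%:R * (n%:R * (M * (2 * d)) * d))).
  apply: H.
  - by rewrite !mulr_ge0.
  - by move=> z zd; apply: key => i; have := zd i; rewrite mxE.
  - by move=> i; rewrite subrr normr0.
  - by move=> i; rewrite mxE sub0r normrN.
  - by move=> i; rewrite mxE subr0.
have -> : n%:R * (n%:R * (M * (2 * d)) * d) = n%:R * (n%:R * (M * 2)) * d ^+ 2.
  by ring.
by rewrite ler_wpM2r ?sqr_ge0// lerDr addr_ge0.
Unshelve. all: by end_near. Qed.

End second_differences.

Section mulmx_norm.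
Context {R : realType} (n : nat).
Local Notation vec := 'cV[R]_n.

Lemma trace_gram (A : 'M[R]_n) : \tr (A *m A^T) = \sum_i \sum_j A i j ^+ 2.
Proof.
apply: eq_bigr => i _; rewrite mxE; apply: eq_bigr => j _.
by rewrite mxE expr2.
Qed.

Lemma trace_gram_ge0 (A : 'M[R]_n) : 0 <= \tr (A *m A^T).
Proof.
rewrite trace_gram; apply: sumr_ge0 => i _; apply: sumr_ge0 => j _.
exact: sqr_ge0.
Qed.

(** Lagrange's identity: the double sum of squares below is twice the difference of the two
    sides. *)
Lemma cauchy_schwarz (a b : 'I_n -> R) :
  (\sum_i a i * b i) ^+ 2 <= (\sum_i a i ^+ 2) * (\sum_i b i ^+ 2).
Proof.
have : 0 <= \sum_i \sum_j (a i * b j - a j * b i) ^+ 2.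
  by apply: sumr_ge0 => i _; apply: sumr_ge0 => j _; exact: sqr_ge0.
have -> : \sum_i \sum_j (a i * b j - a j * b i) ^+ 2 =
    2 * ((\sum_i a i ^+ 2) * (\sum_i b i ^+ 2)) - 2 * (\sum_i a i * b i) ^+ 2.
  have E1 : \sum_i \sum_j a i ^+ 2 * b j ^+ 2 =
      (\sum_i a i ^+ 2) * (\sum_i b i ^+ 2) by rewrite big_distrlr.
  have E2 : \sum_i \sum_j a j ^+ 2 * b i ^+ 2 =
      (\sum_i a i ^+ 2) * (\sum_i b i ^+ 2) by rewrite exchange_big.
  have E3 : \sum_i \sum_j (a i * b i) * (a j * b j) = (\sum_i a i * b i) ^+ 2.
    by rewrite expr2 big_distrlr.
  rewrite -E3 mulrDl mul1r -{1}E1 -E2 mulr_sumr -sumrN -!big_split/=.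
  apply: eq_bigr => i _; rewrite mulr_sumr -sumrN -!big_split/=.
  by apply: eq_bigr => j _; ring.
by move=> H; lra.
Qed.

Lemma enorm_mulmx (A : 'M[R]_n) (y : vec) :
  enorm (A *m y) ^+ 2 <= \tr (A *m A^T) * enorm y ^+ 2.
Proof.
rewrite !enorm_sqr trace_gram mulr_suml; apply: ler_sum => i _.
by rewrite mxE; exact: (cauchy_schwarz (fun j => A i j) (fun j => y j ord0)).
Qed.

(** A crude bound for the operator norm: the square root of the trace is less than 1 plus the trace,
    and the summand 1 makes the bound positive. *)
Definition mx_bound (A : 'M[R]_n) : R := 1 + \tr (A *m A^T).

Lemma mx_bound_gt0 A : 0 < mx_bound A.
Proof. by rewrite ltr_pwDl ?trace_gram_ge0. Qed.

Lemma enorm_mulmx_le (A : 'M[R]_n) (y : vec) :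
  enorm (A *m y) <= mx_bound A * enorm y.
Proof.
have t0 := trace_gram_ge0 A; have b0 := mx_bound_gt0 A.
rewrite -ler_sqr ?nnegrE ?enorm_ge0 ?mulr_ge0 ?enorm_ge0 ?(ltW b0)//.
apply: (le_trans (enorm_mulmx A y)); rewrite exprMn ler_wpM2r ?sqr_ge0//.
by rewrite /mx_bound; nra.
Qed.

Lemma mulmx_eq0 (A : 'M[R]_n) (y : vec) : A \in unitmx -> (A *m y == 0) = (y == 0).
Proof.
move=> Au; apply/eqP/eqP => [H|->]; last by rewrite mulmx0.
by rewrite -(mul1mx y) -(mulVmx Au) -mulmxA H mulmx0.
Qed.

End mulmx_norm.

(** * Singular integrals under linear maps, and principal values *)

Section singular_integral.
Context {R : realType} (n : nat) (s : R).
Hypothesis s01 : 0 < s < 1.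
Local Notation vec := 'cV[R]_n.
Local Notation lam := (lebesgue_cV R n).
Local Notation p := (n%:R + 2 * s).

Let p0 : 0 < p.
Proof. by have := s01; have : 0 <= n%:R :> R by []; lra. Qed.

Lemma measurable_kernel : measurable_fun [set: vec] (fun y => (enorm y `^ p)^-1).
Proof.
under eq_fun do rewrite -powRN.
by apply: (measurableT_comp (measurable_powR _)); exact: measurable_enorm.
Qed.

Lemma kernel_mulmx_le (A : 'M[R]_n) (y : vec) : A \in unitmx ->
  (enorm y `^ p)^-1 <= mx_bound A `^ p * (enorm (A *m y) `^ p)^-1.
Proof.
move=> Au; have [->|y0] := eqVneq y 0.
  (* At the origin the kernel takes the value 0, the inverse of 0. *)
  have -> : enorm (0 : vec) = 0 by apply/eqP; rewrite enorm_eq0.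
  by rewrite powR0 ?gt_eqF// invr0 mulr_ge0 ?powR_ge0// invr_ge0 powR_ge0.
have y1 : 0 < enorm y by rewrite enorm_gt0.
have Ay1 : 0 < enorm (A *m y) by rewrite enorm_gt0 mulmx_eq0.
rewrite ler_pdivlMr ?powR_gt0// mulrC ler_pdivrMr ?powR_gt0//.
rewrite -powRM ?enorm_ge0//; last by rewrite ltW// mx_bound_gt0.
apply: ge0_ler_powR; rewrite ?nnegrE ?mulr_ge0 ?enorm_ge0// ?(ltW (mx_bound_gt0 _))//.
  exact: ltW.
exact: enorm_mulmx_le.
Qed.

(** The kernels at [y] and at [A y] are comparable, and the linear substitution multiplies integrals
    by a finite factor. Integrability for one invertible matrix thus gives it for all. *)
Lemma integrable_kernel_mulmx (h : vec -> R) (A : 'M[R]_n) : A \in unitmx ->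
  measurable_fun [set: vec] h ->
  lam.-integrable setT (fun y => (h y / enorm y `^ p)%:E) ->
  lam.-integrable setT (fun y => (h (A *m y) / enorm y `^ p)%:E).
Proof.
move=> Au mh /integrableP[mg goo].
have mhA : measurable_fun [set: vec] (fun y => h (A *m y)).
  by apply: (measurableT_comp mh); exact: measurable_cV_mulmx.
apply/integrableP; split.
  by apply/measurable_EFinP; apply: measurable_funM => //; exact: measurable_kernel.
have [c c0 HA] := ge0_integral_cV_mulmx Au.
pose g y : \bar R := `|(h y / enorm y `^ p)%:E|%E.
have mg' : measurable_fun [set: vec] g by exact: measurableT_comp.
have mgA : measurable_fun [set: vec] (fun y : vec => g (A *m y)).
  by apply: (measurableT_comp mg'); exact: measurable_cV_mulmx.
have gA0 (y : vec) : setT y -> (0 <= g (A *m y)%R)%E by move=> _; exact: abse_ge0.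
apply: (@le_lt_trans _ _ (\int[lam]_y ((mx_bound A `^ p)%:E * g (A *m y)))%E).
  apply: ge0_le_integral; first exact: measurableT.
  - by move=> y _; exact: abse_ge0.
  - apply: measurableT_comp => //; apply/measurable_EFinP.
    by apply: measurable_funM => //; exact: measurable_kernel.
  - by apply: emeasurable_funM mgA; exact: measurable_cst.
  - move=> y _; rewrite /g -EFinM lee_fin !normrM mulrCA ler_wpM2l//.
    by rewrite !ger0_norm ?invr_ge0 ?powR_ge0// kernel_mulmx_le.
rewrite (ge0_integralZl_EFin _ measurableT gA0 mgA (powR_ge0 _ _)).
rewrite HA//; last by move=> y; exact: abse_ge0.
rewrite lte_mul_pinfty// ?lee_fin ?powR_ge0//.
by rewrite lte_mul_pinfty// lee_fin ltW.
Qed.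

Definition dquot (v : vec -> R) (x : vec) (A : 'M[R]_n) (y : vec) : \bar R :=
  (delta v x (A *m y) / enorm y `^ p)%:E.

Definition trunc (v : vec -> R) (x : vec) (eps : R) (y : vec) : R :=
  (v (x + y) - v x) * \1_[set y | eps < enorm y] y.

(** Finiteness of the truncated integrals of a principal value, without which they could not be
    symmetrized. *)
Definition tail_integrable (v : vec -> R) (x : vec) := forall eps, 0 < eps ->
  lam.-integrable setT (fun y => (trunc v x eps y / enorm y `^ p)%:E).

Lemma measurable_outside (eps : R) : measurable [set y : vec | eps < enorm y].
Proof.
rewrite -[X in measurable X]setTI.
apply: (@measurable_fun_ltr _ _ _ _ (cst eps) (@enorm R n)) => //.
exact: measurable_enorm.
Qed.

Lemma measurable_translate (v : vec -> R) (x : vec) :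
  measurable_fun [set: vec] v -> measurable_fun [set: vec] (fun y => v (x + y)).
Proof.
move=> mv; apply: (measurableT_comp mv).
exact: (@measurable_fun_cV_add _ _ _ _ (fun=> x) id).
Qed.

Lemma measurable_delta (v : vec -> R) (x : vec) :
  measurable_fun [set: vec] v -> measurable_fun [set: vec] (delta v x).
Proof.
move=> mv; apply: measurable_funB => //; apply: measurable_funD.
  exact: measurable_translate.
exact: (measurableT_comp (measurable_translate x mv) (@measurable_cV_opp R n)).
Qed.

Lemma delta0 (v : vec -> R) (x : vec) : delta v x 0 = 0.
Proof. by rewrite /delta subr0 addr0 -mulr2n mulr_natl subrr. Qed.

Variables (v : vec -> R) (x : vec).
Hypothesis mv : measurable_fun [set: vec] v.
Hypothesis tail_v : tail_integrable v x.
Hypothesis idq : lam.-integrable setT (fun y => (delta v x y / enorm y `^ p)%:E).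

Lemma integrable_dquot (A : 'M[R]_n) : A \in unitmx ->
  lam.-integrable setT (dquot v x A).
Proof.
by move=> Au; apply: integrable_kernel_mulmx => //; exact: measurable_delta.
Qed.

(** Average the integrand over [y] and [- y]: first differences combine into a second difference,
    with the factor [1/2]. *)
Lemma integral_trunc (A : 'M[R]_n) (eps : R) : A \in unitmx -> 0 < eps ->
  (\int[lam]_(y in [set y | (eps < enorm y)%R])
      ((v (x + A *m y)%R - v x) / enorm y `^ p)%:E =
   \int[lam]_y ((2^-1)%:E * (dquot v x A y * (\1_[set y | eps < enorm y] y)%:E)))%E.
Proof.
move=> Au eps0; have mE := measurable_outside eps.
pose f (y : vec) : \bar R :=
  ((v (x + A *m y) - v x) * \1_[set y | eps < enorm y] y / enorm y `^ p)%:E.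
have mvA : measurable_fun [set: vec] (fun y => v (x + A *m y)).
  exact: (measurableT_comp (measurable_translate x mv) (measurable_cV_mulmx A)).
have mf : measurable_fun [set: vec] f.
  apply/measurable_EFinP; apply: measurable_funM; last exact: measurable_kernel.
  by apply: measurable_funM; [exact: measurable_funB|exact: measurable_indic].
have intf : lam.-integrable setT f.
  have K0 := mx_bound_gt0 (invmx A).
  have mtr (e : R) : measurable_fun [set: vec] (trunc v x e).
    apply: measurable_funM; last by apply: measurable_indic; exact: measurable_outside.
    by apply: measurable_funB => //; exact: measurable_translate.
  (* From [|y| > eps] follows [|A y| > eps / mx_bound (invmx A)], so truncating [A y] at that
     smaller radius gives a majorant. *)
  have := integrable_kernel_mulmx Au (mtr _) (tail_v (divr_gt0 eps0 K0)).
  apply: le_integrable => // y _; rewrite /f /trunc lee_fin !normrM.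
  rewrite ler_wpM2r// ler_wpM2l// !ger0_norm// !indicE.
  case: (boolP (y \in [set y | eps < enorm y])) => // /[!inE]/= ey.
  rewrite mem_set//= ltr_pdivrMr// (lt_le_trans ey)// mulrC.
  have := enorm_mulmx_le (invmx A) (A *m y).
  by rewrite mulmxA mulVmx// mul1mx.
have -> : (\int[lam]_(y in [set y | (eps < enorm y)%R])
      ((v (x + A *m y)%R - v x) / enorm y `^ p)%:E = \int[lam]_y f y)%E.
  rewrite integral_mkcond; apply: eq_integral => y _; rewrite epatch_indic/= /f.
  by rewrite -EFinM mulrAC.
have fN : lam.-integrable setT (fun y => f (- y)).
  have /integrableP[_ foo] := intf; apply/integrableP; split.
    exact: (measurableT_comp mf (@measurable_cV_opp R n)).
  rewrite (integral_cV_opp (f := fun y => `|f y|%E))//.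
  exact: measurableT_comp.
have E2 : (\int[lam]_y f y = (2^-1)%:E * \int[lam]_y (f y + f (- y)%R))%E.
  rewrite integralD// integral_cV_opp//.
  rewrite -(fineK (integrable_fin_num measurableT intf)) -EFinD -EFinM.
  by congr EFin; move: (fine _) => a; lra.
rewrite E2 -integralZl//; last exact: integrableD.
apply: eq_integral => y _; congr (_ * _)%E; rewrite /f /dquot -EFinD -EFinM.
have eN : enorm (- y) = enorm y by rewrite -scaleN1r enormZ normrN1 mul1r.
have -> : \1_[set y | eps < enorm y] (- y) = \1_[set y : vec | eps < enorm y] y :> R.
  rewrite !indicE; congr (nat_of_bool _)%:R.
  by apply/idP/idP; rewrite !inE/= eN.
by rewrite eN mulmxN /delta; congr EFin; ring.
Qed.

(** Dominated convergence, with the integrable second difference quotient as majorant. The total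
    operator [lim] is thereby applied to a family that does converge, to a finite value. *)
Lemma pv_half (A : 'M[R]_n) : A \in unitmx ->
  pv s v x A = ((2^-1)%:E * \int[lam]_y dquot v x A y)%E.
Proof.
move=> Au; have idA := integrable_dquot Au.
have ifin := integrable_fin_num measurableT idA.
have [mdA _] := integrableP _ _ _ idA.
pose f (eps : R) (y : vec) : \bar R :=
  ((2^-1)%:E * (dquot v x A y * (\1_[set y | eps < enorm y] y)%:E))%E.
have mf eps : measurable_fun [set: vec] (f eps).
  apply: emeasurable_funM => //; apply: emeasurable_funM => //.
  by apply/measurable_EFinP; apply: measurable_indic; exact: measurable_outside.
have fle eps y : (`|f eps y| <= `|dquot v x A y|)%E.
  rewrite /f /dquot -!EFinM lee_fin normrM ger0_norm// normrM.
  rewrite (ger0_norm (_ : 0 <= \1_[set y | eps < enorm y] y))//.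
  set D := `|_|; have D0 : 0 <= D by exact: normr_ge0.
  by rewrite indicE; case: (_ \in _) => /=; lra.
have ff eps : lam.-integrable setT (f eps).
  by apply: le_integrable idA => // y _; rewrite fle.
have ffin eps := integrable_fin_num measurableT (ff eps).
pose F eps := fine (\int[lam]_y f eps y)%E.
have FE eps : 0 < eps -> (\int[lam]_(y in [set y | (eps < enorm y)%R])
      ((v (x + A *m y)%R - v x) / enorm y `^ p)%:E = (F eps)%:E)%E.
  by move=> eps0; rewrite integral_trunc// /F fineK.
pose l : \bar R := ((2^-1)%:E * \int[lam]_y dquot v x A y)%E.
have lfin : l \is a fin_num by rewrite fin_numM.
have Fl : F eps @[eps --> (0:R)^'+] --> fine l.
  apply/cvg_at_rightP => u [u0 ul].
  apply: fine_cvg; rewrite fineK// /l -integralZl//.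
  pose g y := ((2^-1)%:E * dquot v x A y)%E.
  have mfu k : measurable_fun setT (f (u k)) by [].
  have mg : measurable_fun setT g by exact: emeasurable_funM.
  have fug : {ae lam, forall y, setT y -> (fun k => f (u k) y) @ \oo --> g y}.
    apply: aeW => y _; rewrite /f /g.
    have [->|y0] := eqVneq y 0.
      rewrite /dquot mulmx0 delta0 mul0r.
      under eq_fun do rewrite mul0e mule0.
      by rewrite mule0; exact: cvg_cst.
    apply: cvg_near_cst.
    have ey : 0 < enorm y by rewrite enorm_gt0.
    move/cvgr_lt : (ul) => /(_ _ ey).
    by apply: filterS => k uk; rewrite indicE mem_set// mule1.
  have idn := integrable_abse idA.
  have fub : {ae lam, forall y k, setT y -> (`|f (u k) y| <= `|dquot v x A y|)%E}.
    by apply: aeW => y k _.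
  by have [_ _] := dominated_convergence measurableT mfu mg fug idn fub.
rewrite /pv -/l -(fineK lfin).
apply/cvg_lim => //.
have : (F eps)%:E @[eps --> (0:R)^'+] --> (fine l)%:E by apply: cvg_EFin => //; exact: nearW.
apply: cvg_trans; apply: near_eq_cvg.
near=> eps; rewrite FE//; near: eps; exact: nbhs_right_gt.
Unshelve. all: by end_near. Qed.

End singular_integral.

(** * Test functions touching from above *)

Section tails.
Context {R : realType} (n : nat) (s : R).
Hypothesis s01 : 0 < s < 1.
Local Notation vec := 'cV[R]_n.
Local Notation lam := (lebesgue_cV R n).
Local Notation p := (n%:R + 2 * s).

Let p0 : 0 < p.
Proof. by have := s01; have : 0 <= n%:R :> R by []; lra. Qed.

Lemma integrable_min_sqr : lam.-integrable setT
  (fun y : vec => (Num.min (enorm y ^+ 2) 1 / enorm y `^ p)%:E).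
Proof.
apply/integrableP; split.
  apply/measurable_EFinP; apply: measurable_funM; last exact: measurable_kernel.
  apply: measurable_minr => //.
  by apply: measurable_funX; exact: measurable_enorm.
apply: le_lt_trans (integral_min_sqr_lty n s01).
rewrite le_eqVlt; apply/orP; left; apply/eqP; apply: eq_integral => y _.
rewrite abse_EFin ger0_norm// mulr_ge0 ?invr_ge0 ?powR_ge0//.
by rewrite le_min sqr_ge0/=.
Qed.

(** Away from the origin [|x| <= (|x| / eps) |y|]; the factor 2 leaves room for
    [(a + b)^2 <= 2 a^2 + 2 b^2], used instead of the triangle inequality. *)
Lemma enormD_le (x y : vec) (eps : R) : 0 < eps -> eps < enorm y ->
  enorm (x + y) <= 2 * (enorm x / eps + 1) * enorm y.
Proof.
move=> eps0 epsy; have y0 : 0 < enorm y by exact: lt_trans epsy.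
have q0 : 0 <= enorm x / eps by rewrite divr_ge0 ?enorm_ge0// ltW.
have qE : enorm x / eps * eps = enorm x by rewrite divfK// gt_eqF.
have xle : enorm x <= enorm x / eps * enorm y.
  by rewrite -{1}qE ler_wpM2l// ltW.
rewrite -ler_sqr ?nnegrE ?enorm_ge0//; last first.
  by rewrite !mulr_ge0 ?enorm_ge0// addr_ge0.
have H : enorm (x + y) ^+ 2 <= 2 * enorm x ^+ 2 + 2 * enorm y ^+ 2.
  rewrite !enorm_sqr !mulr_sumr -big_split/=; apply: ler_sum => i _.
  rewrite mxE -subr_ge0.
  have -> : 2 * x i ord0 ^+ 2 + 2 * y i ord0 ^+ 2 - (x i ord0 + y i ord0) ^+ 2 =
    (x i ord0 - y i ord0) ^+ 2 by ring.
  exact: sqr_ge0.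
apply: (le_trans H).
have x2 : enorm x ^+ 2 <= (enorm x / eps * enorm y) ^+ 2.
  by rewrite ler_sqr// nnegrE ?enorm_ge0// mulr_ge0 ?enorm_ge0.
set a := enorm x / eps in q0 x2 *; set b := enorm y in y0 x2 *.
have ab0 : 0 <= a * b by rewrite mulr_ge0// ltW.
have -> : (2 * (a + 1) * b) ^+ 2 = 4 * (a * b) ^+ 2 + 8 * (a * b) * b + 4 * b ^+ 2.
  by ring.
have : 0 <= (a * b) * b by rewrite mulr_ge0 ?(ltW y0).
have : 0 <= b ^+ 2 by exact: sqr_ge0.
have : 0 <= (a * b) ^+ 2 by exact: sqr_ge0.
by lra.
Qed.

(** Compares the kernel off a ball with the weight of [L1_omega] recentred at [- x]; the two
    summands of the constant pay for the two summands of [1 + |x + y|^p]. *)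
Lemma kernel_shift_le (x y : vec) (eps : R) : 0 < eps -> eps < enorm y ->
  (enorm y `^ p)^-1 <= (eps `^ (- p) + (2 * (enorm x / eps + 1)) `^ p) *
    (1 + enorm (x + y) `^ p)^-1.
Proof.
move=> eps0 epsy; have y0 : 0 < enorm y by exact: lt_trans epsy.
have q0 : 0 <= 2 * (enorm x / eps + 1).
  by rewrite mulr_ge0// addr_ge0// divr_ge0 ?enorm_ge0// ltW.
have den : 0 < 1 + enorm (x + y) `^ p by rewrite ltr_pwDl ?powR_ge0.
rewrite ler_pdivlMr// [leLHS]mulrC ler_pdivrMr ?powR_gt0// [leRHS]mulrDl lerD//.
  rewrite powRN mulrC ler_pdivlMr ?powR_gt0// mul1r.
  by apply: ge0_ler_powR; rewrite ?nnegrE ?ltW.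
rewrite -powRM ?enorm_ge0//.
apply: ge0_ler_powR; [exact: ltW|by rewrite nnegrE enorm_ge0| |exact: enormD_le].
by rewrite nnegrE; apply: mulr_ge0 => //; exact: enorm_ge0.
Qed.

Lemma tail_integrable_L1 (u v : vec -> R) (x : vec) (B : R) :
  measurable_fun [set: vec] u -> measurable_fun [set: vec] v -> L1_omega s u ->
  (forall y, `|v y| <= `|u y| + B) -> tail_integrable s v x.
Proof.
move=> mu mv Lu vB eps eps0.
have B0 (y : vec) : 0 <= `|u y| + B by exact: le_trans (vB y).
pose c : R := eps `^ (- p) + (2 * (enorm x / eps + 1)) `^ p.
pose w (y : vec) : \bar R := (`|u y| / (1 + enorm y `^ p))%:E.
have mw : measurable_fun [set: vec] w.
  apply/measurable_EFinP; apply: measurable_funM; first exact: measurableT_comp.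
  have E : (fun y : vec => (1 + enorm y `^ p)^-1) =
      (fun y => (1 + enorm y `^ p) `^ (-1)).
    by apply/funext => y; rewrite powR_inv1// addr_ge0// powR_ge0.
  rewrite E; apply: (measurableT_comp (measurable_powR _)).
  apply: measurable_funD => //.
  by apply: (measurableT_comp (measurable_powR _)); exact: measurable_enorm.
have w0 y : (0 <= w y)%E.
  by rewrite lee_fin mulr_ge0// invr_ge0 addr_ge0// powR_ge0.
have iw : lam.-integrable setT (fun y => w (x + y)).
  apply/integrableP; split.
    by apply: (measurableT_comp mw); exact: (@measurable_fun_cV_add _ _ _ _ (fun=> x) id).
  under eq_integral do rewrite gee0_abs//.
  under eq_integral do rewrite addrC.
  by rewrite ge0_integral_cV_shift.
(* The least value of [min (|y|^2, 1)] off the ball of radius [eps]; dividing by it dominates the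
   constant terms by the integrable function [k]. *)
pose q : R := Num.min (eps ^+ 2) 1.
have q0 : 0 < q by rewrite lt_min exprn_gt0/=.
pose k (y : vec) : \bar R := (Num.min (enorm y ^+ 2) 1 / enorm y `^ p)%:E.
have ik : lam.-integrable setT (fun y => ((`|B| + `|v x|) / q)%:E * k y)%E.
  by apply: integrableZl => //; exact: integrable_min_sqr.
have icw : lam.-integrable setT (fun y => c%:E * w (x + y)%R)%E.
  exact: integrableZl.
apply: le_integrable (integrableD measurableT icw ik) => //.
  apply/measurable_EFinP; apply: measurable_funM; last exact: measurable_kernel.
  apply: measurable_funM; last by apply: measurable_indic; exact: measurable_outside.
  by apply: measurable_funB => //; exact: measurable_translate.
move=> y _; rewrite /trunc /k /w -!EFinM -EFinD !abse_EFin lee_fin.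
set X := c * _; set Y := (_ / q) * _.
have c0 : 0 <= c by rewrite addr_ge0 ?powR_ge0.
have X0 : 0 <= X.
  by rewrite mulr_ge0// mulr_ge0// invr_ge0 addr_ge0// powR_ge0.
have m0 : 0 <= Num.min (enorm y ^+ 2) 1 by rewrite le_min sqr_ge0/=.
have bv0 : 0 <= (`|B| + `|v x|) / q by rewrite divr_ge0 ?addr_ge0// ltW.
have Y0 : 0 <= Y by rewrite mulr_ge0// mulr_ge0// invr_ge0 powR_ge0.
rewrite [leRHS]ger0_norm ?addr_ge0// indicE.
case: (boolP (y \in _)) => [/[!inE]/= ey|_]; last first.
  by rewrite mulr0 mul0r normr0 addr_ge0.
rewrite mulr1 normrM (ger0_norm (_ : 0 <= (enorm y `^ p)^-1)) ?invr_ge0 ?powR_ge0//.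
have H1 : `|v (x + y) - v x| <= `|u (x + y)| + (`|B| + `|v x|).
  apply: (le_trans (ler_normB _ _)); rewrite addrA lerD2r.
  by apply: (le_trans (vB _)); rewrite lerD2l ler_norm.
apply: (@le_trans _ _ ((`|u (x + y)| + (`|B| + `|v x|)) / enorm y `^ p)).
  by rewrite ler_wpM2r ?invr_ge0 ?powR_ge0.
rewrite mulrDl lerD//.
  rewrite /X mulrCA ler_wpM2l//; exact: kernel_shift_le.
rewrite /Y -mulrA ler_wpM2l ?addr_ge0// mulrA ler_peMl ?invr_ge0 ?powR_ge0//.
rewrite mulrC ler_pdivlMr// mul1r le_min !ge_min lexx orbT andbT.
by rewrite ler_sqr ?nnegrE ?enorm_ge0 ?(ltW eps0)// (ltW ey).
Qed.

(** On the cube the quadratic bound compensates the singularity; off it the second difference is a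
    sum of first differences of [w] at [y] and [- y], integrable by the tail hypothesis. *)
Lemma integrable_dq_of_near (v w : vec -> R) (x : vec) (rho C : R) :
  measurable_fun [set: vec] v -> 0 < rho <= 1 -> tail_integrable s w x ->
  measurable_fun [set: vec] w -> 0 <= C ->
  (forall y : vec, (forall i, `|y i ord0| < rho) ->
     `|delta v x y| <= C * Num.min (enorm y ^+ 2) 1) ->
  (forall y : vec, ~ (forall i, `|y i ord0| < rho) -> delta v x y = delta w x y) ->
  lam.-integrable setT (fun y => (delta v x y / enorm y `^ p)%:E).
Proof.
move=> mv /andP[rho0 rho1] tw mw C0 near far.
(* Off the cube the norm is only known to be at least [rho], while [trunc] cuts at a strict
   inequality; half the radius leaves room. *)
have rho20 : 0 < rho / 2 by rewrite divr_gt0.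
pose t (y : vec) : \bar R := (trunc w x (rho / 2) y / enorm y `^ p)%:E.
have it : lam.-integrable setT t by exact: tw.
have mt : measurable_fun [set: vec] t by have /integrableP[] := it.
have itN : lam.-integrable setT (fun y => t (- y)).
  have /integrableP[_ too] := it; apply/integrableP; split.
    exact: (measurableT_comp mt (@measurable_cV_opp R n)).
  rewrite (integral_cV_opp (f := fun y => `|t y|%E))//.
  exact: measurableT_comp.
have it2 := integrableD measurableT (integrable_abse it) (integrable_abse itN).
have ik : lam.-integrable setT
    (fun y => C%:E * (Num.min (enorm y ^+ 2) 1 / enorm y `^ p)%:E)%E.
  by apply: integrableZl => //; exact: integrable_min_sqr.
apply: le_integrable (integrableD measurableT ik it2) => //.
  apply/measurable_EFinP; apply: measurable_funM; last exact: measurable_kernel.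
  exact: measurable_delta.
move=> y _; rewrite /t/= lee_fin.
have i0 : 0 <= (enorm y `^ p)^-1 by rewrite invr_ge0 powR_ge0.
have m0 : 0 <= Num.min (enorm y ^+ 2) 1 by rewrite le_min sqr_ge0/=.
have eN : enorm (- y) = enorm y by rewrite -scaleN1r enormZ normrN1 mul1r.
rewrite [leRHS]ger0_norm; last by rewrite !addr_ge0// mulr_ge0// mulr_ge0.
rewrite eN !normrM (ger0_norm i0) mulrA -!mulrDl ler_wpM2r//.
have [yn|yf] := pselect (forall i, `|y i ord0| < rho).
  by apply: (le_trans (near y yn)); rewrite lerDl addr_ge0.
have ey : rho / 2 < enorm y.
  move/existsNP : yf => [i /negP]; rewrite -leNgt => yi.
  by apply: lt_le_trans (entry_le_enorm y i); apply: lt_le_trans yi; lra.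
rewrite !indicE !mem_set/= ?eN// normr1 !mulr1 far//.
apply: ler_wpDl; first exact: mulr_ge0.
apply: le_trans (ler_normD _ _); rewrite /delta.
by rewrite le_eqVlt; apply/orP; left; apply/eqP; congr `|_|; ring.
Qed.

End tails.

(** * From test functions to [u] itself *)

Section touched_from_above.
Context {R : realType} (n : nat) (s : R).
Hypothesis s01 : 0 < s < 1.
Local Notation vec := 'cV[R]_n.
Local Notation lam := (lebesgue_cV R n).
Local Notation p := (n%:R + 2 * s).

Lemma Ck_onS k (N N' : set vec) (f : vec -> R) :
  N' `<=` N -> Ck_on k N f -> Ck_on k N' f.
Proof.
move=> NN'; elim: k f => [|k IH] f [cf H].
  by split=> // y /NN' /cf.
split=> [y /NN' /cf//|i]; have [dH CH] := H i; split; last exact: IH.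
by move=> y /NN' /dH.
Qed.

Lemma ball_cV_centerP (x y : vec) (rho : R) : 0 < rho ->
  ball x rho (x + y) <-> forall i, `|y i ord0| < rho.
Proof.
move=> rho0; rewrite ball_cVP//; split=> H i; have := H i;
  by rewrite mxE opprD addrA subrr add0r normrN.
Qed.

Lemma measurable_patch (u psi : vec -> R) (B : set vec) :
  measurable_fun [set: vec] u -> open B -> measurable_fun B psi ->
  measurable_fun [set: vec] (patch u B psi).
Proof.
move=> mu oB mpsi; have mB := open_measurable_cV oB.
rewrite -(setUv B); apply/measurable_funU => //; first exact: measurableC.
split.
- apply: eq_measurable_fun mpsi => y; rewrite inE => By.
  by rewrite /patch mem_set.
- apply: (@eq_measurable_fun _ _ _ _ _ u); last exact: measurable_funTS.
  by move=> y; rewrite inE /= => By; rewrite /patch memNset.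
Qed.

(** Since 0 times any extended real is 0, a positive lower bound for the product forces [C > 0].
    Positivity of [C_ns] is obtained in this way from the viscosity inequality. *)
Lemma mul_inf_ge (C e : R) (S : set (\bar R)) : 0 <= C -> 0 < e ->
  (e%:E <= C%:E * ereal_inf S)%E ->
  0 < C /\ forall m, S m -> ((e / C)%:E <= m)%E.
Proof.
move=> C0 e0 H.
have C1 : 0 < C.
  rewrite lt_def C0 andbT; apply/eqP => C00; move: H.
  by rewrite C00 mul0e lee_fin leNgt e0.
split=> // m Sm; apply: (@le_trans _ _ (ereal_inf S)); last exact: ereal_inf_lbound.
by rewrite mulrC EFinM lee_pdivrMl.
Qed.

Variables (Omega : set vec) (u : vec -> R) (x : vec) (N : set vec) (psi : vec -> R).
Hypothesis cu : continuous u.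
Hypothesis Lu : L1_omega s u.
Hypothesis touch : touches_from_above Omega u x N psi.

Let mu : measurable_fun [set: vec] u.
Proof. exact: continuous_measurable_cV. Qed.

(* The test function [psi] is only used on balls around [x] shrinking to [x]:
   the patched functions then decrease to [u]. *)
Lemma patched_sequence : exists v : nat -> vec -> R,
  [/\ forall k, exists B, v k = patch u B psi /\ touches_from_above Omega u x B psi,
      forall k, measurable_fun [set: vec] (v k),
      forall k, tail_integrable s (v k) x,
      forall k, lam.-integrable setT (fun y => (delta (v k) x y / enorm y `^ p)%:E) &
      [/\ forall k, v k x = u x,
          forall i j y, (i <= j)%N -> v j y <= v i y &
          forall y, y != x -> \forall k \near \oo, v k y = u y]].
Proof.
have [oN Nx NO C2 [psix psiu]] := touch.
have [r [C [r0 C0 rN psiB D2]]] := C2_second_difference oN Nx C2.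
pose rho (k : nat) : R := Num.min r 1 / k.+1%:R.
have m0 : 0 < Num.min r 1 by rewrite lt_min r0/=.
have rho0 k : 0 < rho k by rewrite divr_gt0.
have rhoS i j : (i <= j)%N -> rho j <= rho i.
  by move=> ij; rewrite ler_wpM2l ?(ltW m0)// lef_pV2 ?posrE// ler_nat ltnS.
have rhom k : rho k <= Num.min r 1.
  by rewrite /rho ler_pdivrMr// ler_peMr ?(ltW m0)// ler1n.
have rhor k : rho k <= r by apply: (le_trans (rhom k)); rewrite ge_min lexx.
have rho1 k : rho k <= 1 by apply: (le_trans (rhom k)); rewrite ge_min lexx orbT.
have bN k : ball x (rho k) `<=` N.
  by apply: subset_trans rN; exact: le_ball.
pose v (k : nat) := patch u (ball x (rho k)) psi.
have xball k : ball x (rho k) x by exact: ballxx.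
have vx k : v k x = u x by rewrite /v /patch mem_set.
have vle i j y : (i <= j)%N -> v j y <= v i y.
  move=> ij; rewrite /v /patch.
  case: ifPn => [/[!inE] yj|yj].
    by rewrite mem_set//; apply: le_ball yj; exact: rhoS.
  case: ifPn => // /[!inE] yi.
  have [->|yx] := pselect (y = x); first by rewrite psix.
  by apply: ltW; exact: (psiu _ (bN _ _ yi) yx).
have mv k : measurable_fun [set: vec] (v k).
  apply: measurable_patch => //; first exact: ball_open.
  apply: continuous_at_measurable_cV; first exact: ball_open.
  by move=> y /bN Ny; have [+ _] := C2; exact.
have vB k y : `|v k y| <= `|u y| + C.
  rewrite /v /patch; case: ifPn => [/[!inE] yk|_]; last by rewrite lerDl.
  apply: (@le_trans _ _ C); last by rewrite lerDr.
  rewrite -(subrK x y) addrC; apply: psiB.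
  by rewrite addrC subrK; apply: le_ball yk.
exists v; split => //.
- move=> k; exists (ball x (rho k)); split=> //; split => //.
  + exact: ball_open.
  + exact: subset_trans (bN k) NO.
  + exact: Ck_onS C2.
  + by split=> // y /bN Ny yx; exact: psiu.
- by move=> k; exact: (@tail_integrable_L1 _ _ _ s01 u (v k) x C mu (mv k) Lu (vB k)).
- move=> k.
  have tu : tail_integrable s u x.
    apply: (@tail_integrable_L1 _ _ _ s01 u u x 0 mu mu Lu).
    by move=> y; rewrite addr0.
  apply: (integrable_dq_of_near s01 (mv k) (w := u) (rho := rho k) (C := C)) => //.
  + by rewrite rho0 rho1.
  + move=> y yk.
    (* The sup norm of [y]: smaller than [rho k] by assumption and at most the Euclidean norm, so a
       bound in [d^2] implies the required one. *)
    pose d := \big[Num.max/0]_i `|y i ord0|.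
    have yd i : `|y i ord0| <= d by exact: le_bigmax.
    have d0 : 0 <= d by exact: bigmax_ge_id.
    have drho : d < rho k by apply: bigmax_lt.
    have dy : d <= enorm y.
      by apply: bigmax_le; [exact: enorm_ge0|move=> i _; exact: entry_le_enorm].
    have -> : delta (v k) x y = delta psi x y.
      have yb : ball x (rho k) (x + y) by apply/ball_cV_centerP.
      have yNb : ball x (rho k) (x - y).
        by apply/ball_cV_centerP => // i; rewrite mxE normrN.
      by rewrite /delta vx /v /patch !mem_set// psix.
    apply: (le_trans (D2 y d (lt_le_trans drho (rhor k)) yd)).
    rewrite ler_wpM2l// le_min ler_sqr ?nnegrE ?enorm_ge0// dy/=.
    by rewrite -(expr1n _ 2) ler_sqr ?nnegrE// (le_trans (ltW drho)).
  + move=> y yk.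
    have yb : ~ ball x (rho k) (x + y) by move/ball_cV_centerP => /(_ (rho0 k)).
    have yNb : ~ ball x (rho k) (x - y).
      move/ball_cV_centerP => /(_ (rho0 k)) H; apply: yk => i.
      by have := H i; rewrite mxE normrN.
    by rewrite /delta vx /v /patch !memNset.
- split=> // y yx.
  have [i yi] : exists i, y i ord0 != x i ord0.
    apply: contrapT => H; move/eqP: yx; apply; apply/colP => i.
    by apply/eqP/negPn/negP => yi; apply: H; exists i.
  have e0 : 0 < `|x i ord0 - y i ord0| by rewrite normr_gt0 subr_eq0 eq_sym.
  have [k ke] := ltr_add_invr e0; rewrite add0r in ke.
  exists k => // j /= kj; rewrite /v /patch memNset//.
  move=> /(ball_cVP _ _ (rho0 j)) /(_ i); apply/negP; rewrite -leNgt.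
  apply: le_trans (ltW ke); apply: (@le_trans _ _ (1 / j.+1%:R)).
    by rewrite ler_wpM2r// ge_min lexx orbT.
  by rewrite mul1r lef_pV2 ?posrE// ler_nat ltnS.
Qed.

Variable eta0 : R.
Hypothesis eta00 : 0 < eta0.
Hypothesis Ox : Omega x.
Hypothesis visc : Ks_ge_viscosity s Omega u eta0.

(** The quotients [G k] of the differences between the first patched function and the later ones are
    nonnegative and increase to [Gu], with integrals bounded by the viscosity inequality. Monotone
    convergence then yields both the integrability of the quotient of [u] and the lower bound. *)
Lemma touched_integral (A : 'M[R]_n) : A2 A -> A \in unitmx ->
  [/\ 0 < C_ns n s, lam.-integrable setT (dquot s u x A) &
      ((2 * (eta0 / C_ns n s))%:E <= \int[lam]_y dquot s u x A y)%E].
Proof.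
move=> A2A Au.
have [v [vpatch mv tv iv [vx vle vu]]] := patched_sequence.
have s0 : 0 <= s by case/andP : s01 => /ltW.
have C0 : 0 <= C_ns n s by exact: C_ns_ge0.
have K k : 0 < C_ns n s /\ ((eta0 / C_ns n s)%:E <= pv s (v k) x A)%E.
  have [B [-> tB]] := vpatch k.
  have [C1 H] := mul_inf_ge C0 eta00 (visc Ox tB).
  by split=> //; apply: H; exists A.
have C1 : 0 < C_ns n s by have [] := K 0%N.
set eta := eta0 / C_ns n s in K *.
have ivA k := integrable_dquot s01 (mv k) (iv k) Au.
have Hk k : ((2 * eta)%:E <= \int[lam]_y dquot s (v k) x A y)%E.
  have [_] := K k; rewrite (pv_half s01 (mv k) (tv k) (iv k) Au).
  have fin := integrable_fin_num measurableT (ivA k).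
  by rewrite -(fineK fin) -EFinM !lee_fin => H; lra.
pose G k y : \bar R := ((delta (v 0%N) x (A *m y) - delta (v k) x (A *m y)) / enorm y `^ p)%:E.
pose Gu y : \bar R := ((delta (v 0%N) x (A *m y) - delta u x (A *m y)) / enorm y `^ p)%:E.
have mdA (w : vec -> R) : measurable_fun [set: vec] w ->
    measurable_fun [set: vec] (fun y => delta w x (A *m y)).
  move=> mw; apply: (measurableT_comp (measurable_delta x mw)).
  exact: measurable_cV_mulmx.
have mquot (g : vec -> R) : measurable_fun [set: vec] g ->
    measurable_fun [set: vec] (fun y => (g y / enorm y `^ p)%:E).
  move=> mg; apply/measurable_EFinP; apply: measurable_funM => //.
  exact: measurable_kernel.
have mG k : measurable_fun [set: vec] (G k).
  by apply: mquot; apply: measurable_funB; exact: mdA.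
have mGu : measurable_fun [set: vec] Gu.
  by apply: mquot; apply: measurable_funB; exact: mdA.
have i0 (y : vec) : 0 <= (enorm y `^ p)^-1 by rewrite invr_ge0 powR_ge0.
have dle i j y : (i <= j)%N -> delta (v j) x y <= delta (v i) x y.
  by move=> ij; rewrite /delta !vx lerB// lerD// vle.
have G0 k y : (0 <= G k y)%E by rewrite lee_fin mulr_ge0// subr_ge0 dle.
have Gnd y : {homo (fun k => G k y) : i j / (i <= j)%N >-> (i <= j)%E}.
  by move=> i j ij; rewrite lee_fin ler_wpM2r// lerB// dle.
have GE k : (\int[lam]_y G k y = \int[lam]_y dquot s (v 0%N) x A y -
    \int[lam]_y dquot s (v k) x A y)%E.
  rewrite -integralB//; apply: eq_integral => y _.
  by rewrite /G /dquot -EFinB -mulrBl.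
set I0 := (\int[lam]_y dquot s (v 0%N) x A y)%E in GE *.
have I0fin : I0 \is a fin_num by exact: integrable_fin_num.
have Gle k : (\int[lam]_y G k y <= I0 - (2 * eta)%:E)%E.
  by rewrite GE leeB.
have limG y : limn (fun k => G k y) = Gu y.
  apply/cvg_lim => //; apply: cvg_near_cst.
  (* The patched functions eventually agree with [u] at each point other than [x]; where [A y = 0]
     all second differences vanish anyway. *)
  have [z0|z0] := eqVneq (A *m y) 0.
    by apply: nearW => k; rewrite /G /Gu z0 !delta0.
  have xDz : x + A *m y != x by rewrite -subr_eq0 addrAC subrr add0r.
  have xBz : x - A *m y != x by rewrite -subr_eq0 addrAC subrr add0r oppr_eq0.
  near=> k; rewrite /G /Gu; congr ((_ - _) / _)%:E.
  rewrite /delta vx; congr (_ + _ - _); near: k; exact: vu.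
have Gule : (\int[lam]_y Gu y <= I0 - (2 * eta)%:E)%E.
  have H := @cvg_monotone_convergence _ _ _ lam setT measurableT G mG
    (fun k y _ => G0 k y) (fun y _ => Gnd y).
  have -> : (\int[lam]_y Gu y = \int[lam]_y limn (fun k => G k y))%E.
    by apply: eq_integral => y _; rewrite limG.
  rewrite -(cvg_lim _ H)//; apply: lime_le; first by apply/cvg_ex; eexists; exact: H.
  exact: nearW.
have Gu0 y : (0 <= Gu y)%E.
  rewrite -limG; apply: lime_ge; last exact: nearW.
  by apply: ereal_nondecreasing_is_cvgn; exact: Gnd.
have iGu : lam.-integrable setT Gu.
  apply/integrableP; split => //.
  under eq_integral do rewrite gee0_abs//.
  by apply: (le_lt_trans Gule); rewrite -(fineK I0fin) -EFinB ltry.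
have E : dquot s u x A = (dquot s (v 0%N) x A \- Gu)%E.
  apply/funext => y; rewrite /dquot /Gu/= -EFinB; congr EFin.
  by move: (delta u x _) (delta (v 0%N) x _) (_^-1) => a b q; ring.
split => //; first by rewrite E; exact: integrableB.
rewrite E integralB// -/I0.
have Gufin := integrable_fin_num measurableT iGu.
move: Gule; rewrite -(fineK I0fin) -(fineK Gufin) -!EFinB !lee_fin => H.
lra.
Unshelve. all: by end_near. Qed.

(** Substitute the inverse matrix; the resulting statement no longer mentions [A] and feeds all
    other matrices. *)
Lemma touched_dq (A : 'M[R]_n) : A \in unitmx ->
  lam.-integrable setT (dquot s u x A) ->
  lam.-integrable setT (fun y => (delta u x y / enorm y `^ p)%:E).
Proof.
move=> Au H.
have mdA : measurable_fun [set: vec] (fun y => delta u x (A *m y)).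
  apply: (measurableT_comp (measurable_delta x mu)).
  exact: measurable_cV_mulmx.
have Vu : invmx A \in unitmx by rewrite unitmx_inv.
have := integrable_kernel_mulmx s01 Vu mdA H.
by under eq_fun do rewrite mulmxA mulmxV// mul1mx.
Qed.

Lemma touched_tail : tail_integrable s u x.
Proof.
apply: (@tail_integrable_L1 _ _ _ s01 u u x 0 mu mu Lu).
by move=> y; rewrite addr0.
Qed.

End touched_from_above.

(** * Averages of the directional operators *)

Section ae_integral.
Context d (T : measurableType d) (R : realType).
Variables (mu : {measure set T -> \bar R}) (D : set T) (mD : measurable D).

Lemma le_of_second_difference (a b : \bar R) (c m : R) :
  a \is a fin_num -> b \is a fin_num ->
  (a + a - 2%:E * b <= (2 * c)%:E * m%:E)%E -> (a <= b + (c * m)%:E)%E.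
Proof.
case: a b => [a| |] [b| |]// _ _.
by rewrite -!EFinM -!EFinD !lee_fin => H; lra.
Qed.

(** Replacing [f] by its minimum with [k] changes it only on a null set and makes the bound hold
    everywhere. *)
Lemma ae_integral_le_cst (f : T -> \bar R) (k : R) :
  (mu D < +oo)%E -> mu.-integrable D f ->
  {ae mu, forall x, D x -> (f x <= k%:E)%E} ->
  (\int[mu]_(x in D) f x <= k%:E * mu D)%E.
Proof.
move=> Dfin intf fk; pose g := (fun x => mine (f x) k%:E).
have [mf _] := integrableP _ _ _ intf.
have mg : measurable_fun D g by apply: measurable_mine => //; exact: measurable_cst.
have fg : ae_eq mu D f g.
  by move: fk; apply: filterS => x H Dx; rewrite /g min_l// H.
have ik : mu.-integrable D (cst k%:E).
  apply/integrableP; split; first exact: measurable_cst.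
  by rewrite integral_cst// lte_mul_pinfty.
have intg : mu.-integrable D g.
  apply: le_integrable (integrableD mD (integrable_abse intf) (integrable_abse ik)) => //.
  move=> x _; rewrite [leRHS]gee0_abs ?adde_ge0//= /g minEle.
  by case: ifP => _; rewrite ?leeDl ?leeDr.
rewrite (ae_eq_integral g f mD mf mg fg) -[leRHS]integral_cst//.
apply: le_integral => //.
by move=> x _; rewrite ge_min lexx orbT.
Qed.

End ae_integral.

(** * Averages of I^s over the ball of pairs *)

Section direction_integrals.
Context {R : realType} (n : nat) (s : R).
Hypothesis s01 : 0 < s < 1.
Local Notation vec := 'cV[R]_n.
Local Notation leb := (@lebesgue_measure R).
Local Notation lam := (lebesgue_cV R n).
Local Notation lam2 := (lam \x lam)%E.
Local Notation W := (@pair_ball R n).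
Local Notation p := (n%:R + 2 * s).

Let s0 : 0 < s. Proof. by case/andP: s01. Qed.

Lemma enorm_sqr_mx (y : vec) : enorm y ^+ 2 = (y^T *m y) ord0 ord0.
Proof. by rewrite enorm_sqr mxE; apply: eq_bigr => i _; rewrite mxE expr2. Qed.

Lemma measurable_pair_linear (A B : 'M[R]_n) :
  measurable_fun [set: vec * vec] (fun w => A *m w.1 + B *m w.2).
Proof.
apply: measurable_fun_cV_add.
  exact: (measurableT_comp (measurable_cV_mulmx A) measurable_fst).
exact: (measurableT_comp (measurable_cV_mulmx B) measurable_snd).
Qed.

(** The second-difference inequality holds off a null set of pairs and is to be evaluated at linear
    images of [g] and [g']. Invertibility of both maps keeps the exceptional set null, which is why
    [B^2 - A^2] will have to be strictly positive definite. *)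
Lemma ae_pair_mulmx (A B : 'M[R]_n) (Q : vec * vec -> Prop) :
  A \in unitmx -> B \in unitmx -> {ae lam2, forall w, Q w} ->
  {ae lam2, forall w, Q (A *m w.1, B *m w.2)}.
Proof.
move=> Au Bu [N [mN N0 NQ]].
have mM : measurable_fun [set: vec * vec] (fun w => (A *m w.1, B *m w.2)).
  apply/measurable_fun_pairP; split.
    exact: (measurableT_comp (measurable_cV_mulmx A) measurable_fst).
  exact: (measurableT_comp (measurable_cV_mulmx B) measurable_snd).
exists ((fun w => (A *m w.1, B *m w.2)) @^-1` N).
have mpre : measurable ((fun w : vec * vec => (A *m w.1, B *m w.2)) @^-1` N).
  by rewrite -[X in measurable X]setTI; exact: mM.
split=> //; last by move=> w H; apply: NQ.
pose g w : \bar R := (\1_N w)%:E.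
have mg : measurable_fun [set: vec * vec] g.
  by apply/measurable_EFinP; exact: measurable_indic.
have g0 w : (0 <= g w)%E by rewrite lee_fin.
have [a a0 HA] := ge0_integral_cV_mulmx Au.
have [b b0 HB] := ge0_integral_cV_mulmx Bu.
have mgM : measurable_fun [set: vec * vec] (fun w => g (A *m w.1, B *m w.2)).
  exact: measurableT_comp.
have -> : lam2 ((fun w : vec * vec => (A *m w.1, B *m w.2)) @^-1` N) =
    (\int[lam2]_w g (A *m w.1, B *m w.2)%R)%E.
  rewrite -[LHS]mul1e -(setIT (_ @^-1` _)) -[1%E]/(1%:E) mul1e -integral_indic//.
have intg : (\int[lam2]_w g w = 0)%E.
  by rewrite integral_indic// setIT.
rewrite fubini_tonelli1//.
have mF : measurable_fun [set: vec] (fubini_F lam g).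
  exact: measurable_fun_fubini_tonelli_F.
transitivity (\int[lam]_x (b%:E * fubini_F lam g (A *m x)%R))%E.
  apply: eq_integral => x _; rewrite /fubini_F/=.
  by rewrite (HB (fun y => g (A *m x, y)))//; exact: (measurableT_comp mg).
rewrite ge0_integralZl//.
- rewrite HA//; last by move=> x; exact: integral_ge0.
  by move: intg; rewrite fubini_tonelli1// => ->; rewrite !mule0.
- by apply: (measurableT_comp mF); exact: measurable_cV_mulmx.
- by move=> x _; exact: integral_ge0.
- by rewrite lee_fin ltW.
Qed.

Variables (u : vec -> R) (x : vec).
Hypothesis mu : measurable_fun [set: vec] u.
Hypothesis idq : lam.-integrable setT (fun y => (delta u x y / enorm y `^ p)%:E).

Let D := delta u x.
Let mD : measurable_fun [set: vec] D := measurable_delta x mu.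
(** Positive and negative parts are averaged separately, because the averaging identity is a Tonelli
    statement about nonnegative functions. *)
Let Dp (y : vec) : \bar R := (Num.max (D y) 0)%:E.
Let Dn (y : vec) : \bar R := (Num.max (- D y) 0)%:E.

Let mDp : measurable_fun [set: vec] Dp.
Proof. by apply/measurable_EFinP; exact: measurable_maxr. Qed.

Let mDn : measurable_fun [set: vec] Dn.
Proof.
apply/measurable_EFinP; apply: measurable_maxr => //.
exact: measurable_funN.
Qed.

Let Dp0 y : (0 <= Dp y)%E. Proof. by rewrite lee_fin le_max lexx orbT. Qed.
Let Dn0 y : (0 <= Dn y)%E. Proof. by rewrite lee_fin le_max lexx orbT. Qed.

Let line (h : vec -> \bar R) (y : vec) : \bar R :=
  (\int[leb]_r (h (r *: y)%R * (line_weight s r)%:E))%E.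

Let mline h : measurable_fun [set: vec] h -> (forall y, 0 <= h y)%E ->
  measurable_fun [set: vec] (line h).
Proof. exact: measurable_line_integral. Qed.

Let line0 h y : (forall y, 0 <= h y)%E -> (0 <= line h y)%E.
Proof.
by move=> h0; apply: integral_ge0 => r _; rewrite mule_ge0// lee_fin line_weight_ge0.
Qed.

Let Is_line y : Is s u x y = ((1 - s)%:E * (line Dp y - line Dn y))%E.
Proof.
rewrite /Is integralE; congr (_ * (_ - _))%E; apply: eq_integral => r _.
  rewrite funeposE /Dp /D -EFinM /line_weight maxr_pMl ?invr_ge0 ?powR_ge0//.
  by rewrite mul0r EFin_max.
rewrite funenegE /Dn /D -EFinM /line_weight maxr_pMl ?invr_ge0 ?powR_ge0//.
by rewrite mul0r EFin_max -EFinN mulNr.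
Qed.

Lemma measurable_Is : measurable_fun [set: vec] (Is s u x).
Proof.
rewrite (_ : Is s u x = (fun y => (1 - s)%:E * (line Dp y - line Dn y))%E).
  by apply: emeasurable_funM => //; apply: emeasurable_funB; exact: mline.
by apply/funext => y; exact: Is_line.
Qed.

Let integral_line (h : vec -> \bar R) (A : 'M[R]_n) :
  measurable_fun [set: vec] h -> (forall y, 0 <= h y)%E -> h 0 = 0%E ->
  (\int[lam2]_(w in W) line h (A *m w.1)%R =
   kernel_const n s * \int[lam]_y (h (A *m y)%R * ((enorm y `^ p)^-1)%:E))%E.
Proof.
move=> mh h0 h00.
have mhA : measurable_fun [set: vec] (fun y => h (A *m y)).
  by apply: (measurableT_comp mh); exact: measurable_cV_mulmx.
rewrite -(integral_ball_line s0 mhA (fun=> h0 _)); last by rewrite mulmx0.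
by apply: eq_integral => w _; apply: eq_integral => r _; rewrite -scalemxAr.
Qed.

(** Apply the averaging identity to both parts of the second difference. Each is dominated by the
    integrable [dquot], so their averages are finite and may be subtracted. *)
Lemma Is_ball (A : 'M[R]_n) : A \in unitmx ->
  lam2.-integrable W (fun w => Is s u x (A *m w.1)) /\
  (\int[lam2]_(w in W) Is s u x (A *m w.1)%R =
   (1 - s)%:E * (kernel_const n s * \int[lam]_y dquot s u x A y))%E.
Proof.
move=> Au; have mB := @measurable_pair_ball R n.
have idA := integrable_dquot s01 mu idq Au.
have [mdA dAoo] := integrableP _ _ _ idA.
have mker : measurable_fun [set: vec] (fun y => ((enorm y `^ p)^-1)%:E).
  by apply/measurable_EFinP; exact: measurable_kernel.
have ker0 (y : vec) : (0 <= ((enorm y `^ p)^-1)%:E)%E.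
  by rewrite lee_fin invr_ge0 powR_ge0.
have part h : measurable_fun [set: vec] h -> (forall y, 0 <= h y)%E -> h 0 = 0%E ->
    (forall y, (h y <= `|D y|%:E)%E) ->
    (\int[lam]_y (h (A *m y)%R * ((enorm y `^ p)^-1)%:E) < +oo)%E /\
    lam2.-integrable W (fun w => line h (A *m w.1)).
  move=> mh h0 h00 hD.
  have mhA : measurable_fun [set: vec] (fun y => h (A *m y)).
    by apply: (measurableT_comp mh); exact: measurable_cV_mulmx.
  have fin : (\int[lam]_y (h (A *m y)%R * ((enorm y `^ p)^-1)%:E) < +oo)%E.
    apply: le_lt_trans dAoo; apply: ge0_le_integral => //.
    - by move=> y _; exact: mule_ge0.
    - exact: emeasurable_funM.
    - exact: measurableT_comp.
    - move=> y _; rewrite /dquot abse_EFin normrM.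
      rewrite (ger0_norm (_ : 0 <= (enorm y `^ p)^-1)) ?invr_ge0 ?powR_ge0//.
      by rewrite EFinM lee_wpmul2r.
  split => //; apply/integrableP; split.
    apply: measurable_funTS.
    by apply: (measurableT_comp (mline mh h0)); apply: (measurableT_comp (measurable_cV_mulmx A)).
  under eq_integral do rewrite gee0_abs ?line0//.
  rewrite integral_line// lte_mul_pinfty ?kernel_const_ge0 ?kernel_const_fin//.
have D0 : D 0 = 0 by exact: delta0.
have [Pfin iP] := part Dp mDp Dp0 ltac:(by rewrite /Dp D0 maxxx)
  (fun y => ltac:(by rewrite lee_fin ge_max ler_norm normr_ge0)).
have [Nfin iN] := part Dn mDn Dn0 ltac:(by rewrite /Dn D0 oppr0 maxxx)
  (fun y => ltac:(by rewrite lee_fin ge_max -normrN ler_norm normr_ge0)).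
have iPN := integrableB mB iP iN.
have IsE : (fun w : vec * vec => Is s u x (A *m w.1)) =
    (fun w => (1 - s)%:E * ((fun w => line Dp (A *m w.1)) \-
                            (fun w => line Dn (A *m w.1))) w)%E.
  by apply/funext => w; rewrite Is_line.
split; first by rewrite IsE; exact: integrableZl.
under eq_integral do rewrite Is_line.
rewrite integralZl//; congr (_ * _)%E; rewrite integralB//.
rewrite !integral_line//; [|by rewrite /Dn D0 oppr0 maxxx|by rewrite /Dp D0 maxxx].
have kfin := kernel_const_fin n s0.
set X := (\int[lam]_y (Dp _ * _))%E in Pfin *; set Y := (\int[lam]_y (Dn _ * _))%E in Nfin *.
have X0 : (0 <= X)%E by apply: integral_ge0 => y _; exact: mule_ge0.
have Y0 : (0 <= Y)%E by apply: integral_ge0 => y _; exact: mule_ge0.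
have -> : (\int[lam]_y dquot s u x A y = X - Y)%E.
  rewrite integralE; congr (_ - _)%E; apply: eq_integral => y _.
    rewrite funeposE /Dp /D /dquot -EFinM maxr_pMl ?invr_ge0 ?powR_ge0//.
    by rewrite mul0r EFin_max.
  rewrite funenegE /Dn /D /dquot -EFinM maxr_pMl ?invr_ge0 ?powR_ge0//.
  by rewrite mul0r EFin_max -EFinN mulNr.
have Xfin : X \is a fin_num by rewrite ge0_fin_numE.
have Yfin : Y \is a fin_num by rewrite ge0_fin_numE.
by rewrite -(fineK kfin) -(fineK Xfin) -(fineK Yfin) -!EFinM -!EFinB mulrBr.
Qed.

(** Not divided by the mass of the ball, which therefore reappears as [ball_mass] in the
    estimates. *)
Definition ball_average (A : 'M[R]_n) : \bar R :=
  (\int[lam2]_(w in W) Is s u x (A *m w.1)%R)%E.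

Lemma ball_average_fin (A : 'M[R]_n) : A \in unitmx -> ball_average A \is a fin_num.
Proof.
move=> Au; have [iA _] := Is_ball Au.
by apply: (integrable_fin_num (@measurable_pair_ball R n)).
Qed.

Let mIs (A : 'M[R]_n) : measurable_fun [set: vec * vec] (fun w => Is s u x (A *m w.1)).
Proof.
apply: (measurableT_comp measurable_Is).
exact: (measurableT_comp (measurable_cV_mulmx A) measurable_fst).
Qed.

Lemma ball_average_orthogonal (A U : 'M[R]_n) : U *m U^T = 1%:M ->
  ball_average (A *m U) = ball_average A.
Proof.
move=> UU; have UU' : U^T *m U = 1%:M by exact: mulmx1C.
have mM : measurable_fun [set: vec * vec] (fun w => (U *m w.1, w.2)).
  apply/measurable_fun_pairP; split; last exact: measurable_snd.
  exact: (measurableT_comp (measurable_cV_mulmx U) measurable_fst).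
rewrite /ball_average -(@integral_pair_isometry R n (fun w => (U *m w.1, w.2))
  (fun w => (U^T *m w.1, w.2)) mM _ _ _ _ (mIs A)).
- by apply: eq_integral => w _; rewrite mulmxA.
- by move=> a b /=; rewrite mulmxDr.
- by move=> [a b] /=; rewrite mulmxA UU mul1mx.
- move=> w /=; congr (_ + _); rewrite !enorm_sqr_mx.
  by rewrite trmx_mul mulmxA -(mulmxA _ _ U) UU' mulmx1.
Qed.

Section reflection.
Variables P Q : 'M[R]_n.
Hypotheses (PT : P^T = P) (QT : Q^T = Q) (PQ : P *m Q = Q *m P).
Hypothesis PPQQ : P *m P + Q *m Q = 1%:M.

(** With this choice of the second component the block matrix is symmetric and orthogonal, so [M] is
    its own inverse. *)
Let M (w : vec * vec) := (P *m w.1 + Q *m w.2, Q *m w.1 - P *m w.2).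

Let measurable_M : measurable_fun [set: vec * vec] M.
Proof.
apply/measurable_fun_pairP; split; first exact: measurable_pair_linear.
have := measurable_pair_linear Q (- P); apply: eq_measurable_fun => w _.
by rewrite /M/= mulNmx.
Qed.

Let MK : cancel M M.
Proof.
move=> [a b]; rewrite /M/=; congr pair.
  rewrite !mulmxDr !mulmxN !mulmxA -PQ addrACA subrr addr0.
  by rewrite -mulmxDl PPQQ mul1mx.
rewrite mulmxDr mulmxBr !mulmxA PQ opprB [X in _ + X]addrC addrACA subrr add0r.
by rewrite -mulmxDl addrC PPQQ mul1mx.
Qed.

Let norm_M w : enorm (M w).1 ^+ 2 + enorm (M w).2 ^+ 2 =
  enorm w.1 ^+ 2 + enorm w.2 ^+ 2.
Proof.
have PPQQxy (a b : vec) : a^T *m P *m P *m b + a^T *m Q *m Q *m b = a^T *m b.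
  by rewrite -!mulmxA -mulmxDr !mulmxA -mulmxDl PPQQ mul1mx.
have PQxy (a b : vec) : a^T *m Q *m P *m b = a^T *m P *m Q *m b.
  by rewrite -!mulmxA; congr (_ *m _); rewrite !mulmxA PQ.
have key (a b : vec) : (P *m a + Q *m b)^T *m (P *m a + Q *m b) +
    (Q *m a - P *m b)^T *m (Q *m a - P *m b) = a^T *m a + b^T *m b.
  have -> : (P *m a + Q *m b)^T = a^T *m P + b^T *m Q.
    by rewrite raddfD/= !trmx_mul PT QT.
  have -> : (Q *m a - P *m b)^T = a^T *m Q - b^T *m P.
    by rewrite raddfB/= !trmx_mul PT QT.
  rewrite !(mulmxDl, mulmxDr, mulmxBl, mulmxBr, mulNmx, mulmxN, opprK) !mulmxA !PQxy.
  rewrite -(PPQQxy a a) -(PPQQxy b b).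
  move: (a^T *m P *m P *m a) (a^T *m Q *m Q *m a) (b^T *m P *m P *m b)
    (b^T *m Q *m Q *m b) (a^T *m P *m Q *m b) (b^T *m P *m Q *m a).
  by move=> c1 c2 c3 c4 c5 c6; apply/matrixP => i j; rewrite !mxE; ring.
by have /matrixP/(_ ord0 ord0) := key w.1 w.2; rewrite !enorm_sqr_mx mxE => ->; rewrite mxE.
Qed.

Lemma integral_reflection (f : vec * vec -> \bar R) :
  measurable_fun [set: vec * vec] f ->
  (\int[lam2]_(w in W) f (M w) = \int[lam2]_(w in W) f w)%E.
Proof.
move=> mf; apply: (integral_pair_isometry (Minv := M)) => //.
by move=> a b; rewrite /M/= !mulmxDr opprD !addrA; congr pair;
  rewrite -!addrA; congr (_ + _); rewrite addrCA.
Qed.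

End reflection.

Variable K : R.
Hypothesis K0 : 0 <= K.
Hypothesis second_diff : {ae lam2, forall yz : vec * vec,
  (Is s u x (yz.1 + yz.2) + Is s u x (yz.1 - yz.2) - 2%:E * Is s u x yz.1
    <= (2 * K * enorm yz.2 `^ (2 * s))%:E)%E}.

(* With [P^2 + Q^2 = 1], the vectors [P g + Q g'] and [P g - Q g'] have the same
   distribution as [g] when [(g, g')] is uniform in a ball, so averaging the
   second difference inequality compares the averages for [A] and [A P]. *)
Lemma ball_average_split (A P Q : 'M[R]_n) :
  A \in unitmx -> P \in unitmx -> Q \in unitmx ->
  P^T = P -> Q^T = Q -> P *m Q = Q *m P -> P *m P + Q *m Q = 1%:M ->
  (ball_average A <= ball_average (A *m P) +
     (K * \tr ((A *m Q) *m (A *m Q)^T) `^ s * ball_mass n)%:E)%E.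
Proof.
move=> Au Pu Qu PT QT PQ PPQQ.
have mB := @measurable_pair_ball R n.
have AP : A *m P \in unitmx by rewrite unitmx_mul Au.
have AQ : A *m Q \in unitmx by rewrite unitmx_mul Au.
set t := \tr _.
have t0 : 0 <= t by exact: trace_gram_ge0.
have integrable_refl (Q' : 'M[R]_n) : Q'^T = Q' -> P *m Q' = Q' *m P ->
    P *m P + Q' *m Q' = 1%:M ->
    lam2.-integrable W (fun w => Is s u x (A *m (P *m w.1 + Q' *m w.2))) /\
    (\int[lam2]_(w in W) Is s u x (A *m (P *m w.1 + Q' *m w.2))%R = ball_average A)%E.
  move=> QT' PQ' PPQQ'; have [/integrableP[miA Aoo] _] := Is_ball Au.
  split; last exact: (integral_reflection PT QT' PQ' PPQQ' (mIs A)).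
  apply/integrableP; split.
    apply: measurable_funTS; apply: (measurableT_comp measurable_Is).
    by apply: (measurableT_comp (measurable_cV_mulmx A)); exact: measurable_pair_linear.
  have mabs : measurable_fun [set: vec * vec] (fun w => `|Is s u x (A *m w.1)|%E).
    by apply: measurableT_comp => //; exact: mIs.
  by move: (integral_reflection PT QT' PQ' PPQQ' mabs) => /= ->.
have [i1 E1] := integrable_refl Q QT PQ PPQQ.
(* The same reflection with [- Q] in place of [Q] handles [P g - Q g']. *)
have QNT : (- Q)^T = - Q by rewrite linearN/= QT.
have PQN : P *m (- Q) = - Q *m P by rewrite mulmxN mulNmx PQ.
have PPQQN : P *m P + - Q *m - Q = 1%:M by rewrite mulmxN mulNmx opprK.
have [i2 E2] := integrable_refl (- Q) QNT PQN PPQQN.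
have [i3 _] := Is_ball AP.
have i3' : lam2.-integrable W (fun w => 2%:E * Is s u x (A *m P *m w.1))%E.
  exact: integrableZl.
have bound : {ae lam2, forall w, W w ->
    (Is s u x (A *m (P *m w.1 + Q *m w.2)) +
     Is s u x (A *m (P *m w.1 + (- Q) *m w.2)) -
     2%:E * Is s u x (A *m P *m w.1) <= (2 * K * t `^ s)%:E)%E}.
  apply: filterS (ae_pair_mulmx AP AQ second_diff) => w H Ww.
  have -> : A *m (P *m w.1 + Q *m w.2) = A *m P *m w.1 + A *m Q *m w.2.
    by rewrite mulmxDr !mulmxA.
  have -> : A *m (P *m w.1 + (- Q) *m w.2) = A *m P *m w.1 - A *m Q *m w.2.
    by rewrite mulmxDr mulNmx mulmxN !mulmxA.
  rewrite /= in H.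
  apply: (le_trans H).
  rewrite lee_fin; apply: ler_wpM2l; first exact: mulr_ge0.
  rewrite powRrM (powR_mulrn 2 (enorm_ge0 _)).
  (* The Frobenius bound together with [|g'| <= 1], which holds on the ball. *)
  have le_t : enorm (A *m Q *m w.2) ^+ 2 <= t.
    apply: (le_trans (enorm_mulmx (A *m Q) w.2)).
    rewrite -[leRHS]mulr1; apply: ler_wpM2l; first exact: t0.
    by apply: le_trans Ww; rewrite lerDr sqr_ge0.
  apply: (ge0_ler_powR (ltW s0)) le_t; rewrite nnegrE; [exact: sqr_ge0|exact: t0].
have i12 := integrableD mB i1 i2.
have E12 := etrans (integralD mB i1 i2) (f_equal2 adde E1 E2).
have := ae_integral_le_cst mB (pair_ball_lty n) (integrableB mB i12 i3') bound.
rewrite (etrans (integralB mB i12 i3')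
  (f_equal2 (fun a b => a - b)%E E12 (integralZl mB i3 2))).
rewrite -/(ball_average (A *m P)).
set mW := (X in (_ <= _ * X)%E).
have -> : mW = (ball_mass n)%:E by exact: ball_massE.
rewrite -mulrA; exact: (le_of_second_difference (ball_average_fin Au) (ball_average_fin AP)).
Qed.

End direction_integrals.

(** * Positive definite matrices *)

Section spectral.
Import complex.
Context {R : realType}.

Lemma trmx_mul_ge0 n (v : 'cV[R]_n) : 0 <= (v^T *m v) ord0 ord0.
Proof. by rewrite mxE; apply: sumr_ge0 => i _; rewrite mxE -expr2 sqr_ge0. Qed.

Lemma trmx_mul_eq0 n (v : 'cV[R]_n) : (v^T *m v) ord0 ord0 = 0 -> v = 0.
Proof.
rewrite mxE => /eqP; rewrite psumr_eq0 => [/allP h|i _]; last first.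
  by rewrite mxE -expr2 sqr_ge0.
apply/colP => i; have := h i (mem_index_enum i).
by rewrite !mxE /= mulf_eq0 orbb => /eqP.
Qed.

Lemma det0_cV n (A : 'M[R]_n) : \det A = 0 -> exists2 v : 'cV_n, v != 0 & A *m v = 0.
Proof.
move=> d0; have /eqP/det0P[v v0 vA] : \det A^T = 0 by rewrite det_tr.
exists v^T; first by rewrite -(inj_eq (@trmx_inj _ _ _)) trmxK trmx0.
by rewrite -[A]trmxK -trmx_mul vA trmx0.
Qed.

(* If [a + ib] is a complex eigenvalue of [A], the real matrix
   [(A - a)^2 + b^2] is singular, and its kernel consists of eigenvectors of [A]. *)
Lemma symmetric_eigenvector n (A : 'M[R]_n.+1) : A^T = A ->
  exists (a : R) (v : 'cV_n.+1), v != 0 /\ A *m v = a *: v.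
Proof.
move=> sA; pose f := real_complex R.
have [z] : exists z, root (char_poly (map_mx f A)) z.
  by apply/closed_rootP; rewrite size_char_poly.
rewrite -eigenvalue_root_char => /eigenvalueP[w wA w0].
pose a := complex.Re z; pose b := complex.Im z.
pose B := A - a%:M; pose M := B *m B + (b ^+ 2)%:M.
have fz : z = f a + 'i%C * f b by rewrite [LHS]complexE.
have [v v0 Mv] : exists2 v : 'cV_n.+1, v != 0 & M *m v = 0.
  apply: det0_cV; apply: (@fmorph_inj _ _ f); rewrite rmorph0 -det_map_mx.
  apply/eqP/det0P; exists w => //.
  have wB : w *m map_mx f B = ('i%C * f b) *: w.
    rewrite /B map_mxB mulmxBr wA map_scalar_mx mul_mx_scalar -scalerBl fz.
    by rewrite addrAC subrr add0r.
  rewrite /M map_mxD map_mxM mulmxDr mulmxA wB -scalemxAl wB map_scalar_mx.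
  rewrite mul_mx_scalar scalerA -scalerDl rmorphXn/=.
  rewrite (_ : _ + _ = 0) ?scale0r// mulrACA -expr2 sqr_i -expr2.
  by rewrite mulN1r addNr.
exists a, v; split=> //.
have sB : B^T = B by rewrite /B linearB/= sA tr_scalar_mx.
(* Pairing [M v = 0] with [v] gives [|B v|^2 + b^2 |v|^2 = 0], so both terms vanish and
   [B v = 0]. *)
have : ((B *m v)^T *m (B *m v)) ord0 ord0 + b ^+ 2 * (v^T *m v) ord0 ord0 = 0.
  rewrite trmx_mul sB -mulmxA (mulmxA B B v).
  have -> : B *m B *m v = - (b ^+ 2 *: v).
    apply/eqP; rewrite -addr_eq0 -mul_scalar_mx -mulmxDl; exact/eqP.
  by rewrite mulmxN -scalemxAr !mxE addNr.
move=> /eqP; rewrite paddr_eq0 ?trmx_mul_ge0//; last first.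
  by rewrite mulr_ge0 ?sqr_ge0 ?trmx_mul_ge0.
move=> /andP[/eqP/trmx_mul_eq0 + _].
by rewrite /B mulmxBl mul_scalar_mx => /eqP; rewrite subr_eq0 => /eqP.
Qed.

Lemma unit_vector_frame n (v : 'cV[R]_n.+1) : v^T *m v = 1%:M ->
  exists2 H : 'M[R]_n.+1, H *m H^T = 1%:M & H *m delta_mx ord0 ord0 = v.
Proof.
(* the Householder reflection exchanging [v] and the first basis vector *)
move=> v1; pose e : 'cV[R]_n.+1 := delta_mx ord0 ord0.
have e1 : e^T *m e = 1%:M.
  by rewrite trmx_delta mul_delta_mx; apply/matrixP => i j; rewrite !ord1 !mxE.
have [->|ve] := eqVneq v e.
  by exists 1%:M; rewrite ?mul1mx ?trmx1 ?mulmx1.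
pose w : 'cV[R]_n.+1 := v - e; pose t := (w^T *m w) ord0 ord0; pose p := (v^T *m e) ord0 ord0.
have pE : v^T *m e = p%:M by rewrite [LHS]mx11_scalar.
have pE' : e^T *m v = p%:M by rewrite -[LHS]trmxK trmx_mul trmxK pE tr_scalar_mx.
have tE : t = 2 - 2 * p.
  have -> : t = (w^T *m w) ord0 ord0 by [].
  have -> : w^T *m w = 1%:M - p%:M - (p%:M - 1%:M).
    have -> : w^T = v^T - e^T by rewrite raddfB.
    by rewrite (mulmxBl v^T e^T w) /w !mulmxBr v1 e1 pE pE'.
  by rewrite !mxE !eqxx !mulr1n; ring.
have wt : w^T *m w = t%:M by rewrite [LHS]mx11_scalar.
have t0 : t != 0.
  by apply: contra ve => /eqP /trmx_mul_eq0 /eqP; rewrite subr_eq0.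
pose H := 1%:M - (2 / t) *: (w *m w^T).
have HT : H^T = H by rewrite /H linearB/= linearZ/= trmx_mul trmxK trmx1.
exists H.
  rewrite HT /H mulmxBl mul1mx mulmxBr mulmx1 -!scalemxAl -!scalemxAr.
  rewrite mulmxA -(mulmxA w) wt mul_mx_scalar -!scalemxAl !scalerA.
  by rewrite (_ : 2 / t * (2 / t * t) = 2 / t + 2 / t) ?scalerDl; [rewrite opprB addrK subrK|field].
rewrite /H mulmxBl mul1mx -scalemxAl -mulmxA.
have -> : w^T *m delta_mx ord0 ord0 = (p - 1)%:M.
  by rewrite /w linearB/= mulmxBl pE e1 raddfB.
rewrite mul_mx_scalar scalerA (_ : 2 / t * (p - 1) = -1).
  by rewrite scaleN1r opprK addrC subrK.
have t0' : 2 - 2 * p != 0 by rewrite -tE.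
by rewrite tE; field.
Qed.

(** Induction on the dimension: rotate a unit eigenvector to the first basis vector. The first
    column of the conjugate is then a multiple of that vector, symmetry clears the first row, and
    the remaining block is symmetric. *)
Theorem symmetric_diagonalization n (A : 'M[R]_n) : A^T = A ->
  exists (O : 'M[R]_n) (d : 'rV[R]_n), O *m O^T = 1%:M /\ A = O^T *m diag_mx d *m O.
Proof.
elim: n A => [|n IH] A sA.
  by exists 1%:M, 0; rewrite trmx1 mulmx1; split=> //; apply/matrixP => -[].
have [a [v [v0 Av]]] := symmetric_eigenvector sA.
pose t := (v^T *m v) ord0 ord0.
have tgt0 : 0 < t.
  rewrite lt_def trmx_mul_ge0 andbT; apply: contra v0 => /eqP h.
  exact/eqP/trmx_mul_eq0.
pose v' : 'cV[R]_n.+1 := (Num.sqrt t)^-1 *: v.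
have v'1 : v'^T *m v' = 1%:M.
  have -> : v'^T = (Num.sqrt t)^-1 *: v^T by rewrite linearZ.
  rewrite /v' -scalemxAl -scalemxAr scalerA [_ *m _]mx11_scalar.
  rewrite -/t -invfM -expr2 sqr_sqrtr ?ltW// scale_scalar_mx mulVf//.
  exact: lt0r_neq0.
have [H HH He] := unit_vector_frame v'1.
have HH' : H^T *m H = 1%:M by exact: mulmx1C.
pose e : 'cV[R]_n.+1 := delta_mx ord0 ord0.
have [B [BE sB Be]] : exists B : 'M[R]_(1 + n),
    [/\ B = H^T *m A *m H, B^T = B & B *m e = a *: e].
  exists (H^T *m A *m H); split=> //; first by rewrite !trmx_mul trmxK sA mulmxA.
  rewrite -!mulmxA [H *m e]He /v' -scalemxAr Av scalerA mulrC -scalerA -/v' -He.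
  by rewrite -scalemxAr (mulmxA H^T) HH' mul1mx.
have dlB : dlsubmx B = 0.
  apply/matrixP => i j; rewrite !mxE ord1.
  move/matrixP/(_ (rshift 1 i) ord0) : Be; rewrite -colE !mxE/= mulr0 => <-.
  by congr (B _ _); apply/val_inj.
have urB : ursubmx B = 0.
  by rewrite -sB -[ursubmx _]trmxK trmx_ursub trmxK dlB trmx0.
have ulB : ulsubmx B = a%:M.
  apply/matrixP => i j; rewrite !ord1 !mxE eqxx mulr1n.
  move/matrixP/(_ (lshift n ord0) ord0) : Be.
  rewrite -colE !mxE/= mulr1 => <-.
  by congr (B _ _); apply/val_inj.
have sdB : (drsubmx B)^T = drsubmx B by rewrite trmx_drsub sB.
have [Q [d' [QQ dE]]] := IH _ sdB.
pose O : 'M[R]_(1 + n) := block_mx 1%:M 0 0 Q.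
have OO : O *m O^T = 1%:M.
  rewrite /O (@tr_block_mx _ 1 n 1 n) !trmx0 trmx1 mulmx_block !(mulmx0,mul0mx,mulmx1,mul1mx,addr0,add0r) QQ.
  by rewrite -scalar_mx_block.
have BO : B = O^T *m diag_mx (row_mx a%:M d') *m O.
  rewrite -[B]submxK dlB urB ulB dE /O diag_mx_row (@tr_block_mx _ 1 n 1 n).
  rewrite !mulmx_block !trmx0 trmx1 !(mulmx0,mul0mx,mulmx1,mul1mx,addr0,add0r).
  by congr block_mx; apply/matrixP => i j; rewrite !ord1 !mxE.
exists (O *m H^T), (row_mx a%:M d'); split.
  by rewrite trmx_mul trmxK mulmxA -(mulmxA O) HH' mulmx1.
transitivity (H *m B *m H^T).
  by rewrite BE !mulmxA HH mul1mx -mulmxA HH mulmx1.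
by rewrite BO trmx_mul trmxK !mulmxA.
Qed.
End spectral.

(** * Spectral calculus for symmetric matrices *)

Section spectral_calculus.
Context {R : realType} (n : nat).
Implicit Types (A B C O : 'M[R]_n) (d e : 'I_n -> R) (y : 'cV[R]_n).

(** For orthogonal [O] the eigenvectors are the rows of [O]. Matrices sharing [O] commute and are
    computed with entrywise in [d]. *)
Definition spectral O d : 'M[R]_n := O^T *m diag_mx (\row_i d i) *m O.

Lemma trmx_spectral O d : (spectral O d)^T = spectral O d.
Proof. by rewrite /spectral !trmx_mul trmxK tr_diag_mx mulmxA. Qed.

Lemma symmetric_spectral A : A^T = A ->
  exists O d, O *m O^T = 1%:M /\ A = spectral O d.
Proof.
move=> /symmetric_diagonalization[Q [d [QQ ->]]]; exists Q, (d ord0); split=> //.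
by rewrite /spectral; congr (_ *m diag_mx _ *m _); apply/rowP => i; rewrite mxE.
Qed.

Lemma spectralD O d e : spectral O d + spectral O e = spectral O (fun i => d i + e i).
Proof.
rewrite /spectral -mulmxDl -mulmxDr -raddfD; congr (_ *m diag_mx _ *m _).
by apply/rowP => i; rewrite !mxE.
Qed.

Lemma quad_form_spectral O d y :
  quad_form (spectral O d) y = \sum_i d i * (O *m y) i ord0 ^+ 2.
Proof.
rewrite /quad_form /spectral !mulmxA -trmx_mul -!mulmxA mxE; apply: eq_bigr => i _.
by rewrite mul_diag_mx !mxE; ring.
Qed.

Section orthogonal_frame.
Variable O : 'M[R]_n.
Hypothesis OO : O *m O^T = 1%:M.

Lemma spectralM d e : spectral O d *m spectral O e = spectral O (fun i => d i * e i).
Proof.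
rewrite /spectral !mulmxA -(mulmxA _ O O^T) OO mulmx1 -(mulmxA O^T) mulmx_diag.
by congr (_ *m diag_mx _ *m _); apply/rowP => i; rewrite !mxE.
Qed.

Lemma spectral_cst (a : R) : spectral O (fun=> a) = a%:M.
Proof.
rewrite /spectral (_ : \row__ _ = const_mx a); last by apply/rowP => i; rewrite !mxE.
by rewrite diag_const_mx mul_mx_scalar -scalemxAl (mulmx1C OO) scalemx1.
Qed.

Lemma trace_spectral d : \tr (spectral O d) = \sum_i d i.
Proof.
rewrite /spectral mxtrace_mulC mulmxA OO mul1mx mxtrace_diag.
by apply: eq_bigr => i _; rewrite mxE.
Qed.

Lemma char_poly_spectral d : char_poly (spectral O d) = \prod_i ('X - (d i)%:P).
Proof.
have <- : char_poly (diag_mx (\row_i d i)) = \prod_i ('X - (d i)%:P).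
  rewrite char_poly_trig ?diag_mx_is_trig//.
  by apply: eq_bigr => i _; rewrite !mxE eqxx mulr1n.
have OO' : O^T *m O = 1%:M by exact: mulmx1C.
rewrite /char_poly /char_poly_mx /spectral !map_mxM/=.
pose P := map_mx (@polyC R) O; pose P' := map_mx (@polyC R) O^T.
have PP : P' *m P = 1%:M by rewrite -map_mxM/= OO' map_mx1.
have XE : ('X%:M : 'M[{poly R}]_n) = P' *m 'X%:M *m P.
  by rewrite mul_mx_scalar -scalemxAl PP scalemx1.
by rewrite [in LHS]XE -mulmxBl -mulmxBr !det_mulmx mulrAC -det_mulmx PP det1 mul1r.
Qed.

Lemma spectral_pos_def d : (forall i, 0 < d i) -> pos_def (spectral O d).
Proof.
move=> d0; split; first exact: trmx_spectral.
move=> y y0; rewrite quad_form_spectral lt_def sumr_ge0 ?andbT; last first.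
  by move=> i _; rewrite mulr_ge0 ?sqr_ge0// ltW.
apply: contra y0; rewrite psumr_eq0 => [/allP h|i _]; last first.
  by rewrite mulr_ge0 ?sqr_ge0// ltW.
have Oy : O *m y = 0.
  apply/colP => i; have := h i (mem_index_enum i).
  by rewrite mulf_eq0 gt_eqF//= sqrf_eq0 [RHS]mxE => /eqP.
by rewrite -(mul1mx y) -(mulmx1C OO) -mulmxA Oy mulmx0.
Qed.

Lemma pos_def_spectral d : pos_def (spectral O d) -> forall i, 0 < d i.
Proof.
move=> [_ h] i; pose y := O^T *m delta_mx i (ord0 : 'I_1).
have Oy : O *m y = delta_mx i ord0 by rewrite mulmxA OO mul1mx.
have y0 : y != 0.
  apply/eqP => y0; move: Oy; rewrite y0 mulmx0 => /matrixP/(_ i ord0).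
  by rewrite !mxE !eqxx => /eqP; rewrite eq_sym oner_eq0.
have := h _ y0; rewrite quad_form_spectral Oy (bigD1 i)//= big1 => [|j ji].
  by rewrite mxE !eqxx expr1n mulr1 addr0.
by rewrite mxE (negbTE ji) expr0n mulr0.
Qed.
End orthogonal_frame.

Lemma pos_def_unit A : pos_def A -> A \in unitmx.
Proof.
move=> [_ h]; rewrite unitmxE unitfE; apply/negP => /eqP /det0_cV[v v0 Av].
by have := h _ v0; rewrite /quad_form -mulmxA Av mulmx0 mxE ltxx.
Qed.

Lemma pos_def_congruence A C : A \in unitmx -> pos_def C -> pos_def (A *m C *m A^T).
Proof.
move=> Au [sC h]; split; first by rewrite !trmx_mul trmxK sC mulmxA.
move=> y y0; have Ay0 : A^T *m y != 0 by rewrite mulmx_eq0// unitmx_tr.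
by have := h _ Ay0; rewrite /quad_form trmx_mul trmxK !mulmxA.
Qed.

Lemma pos_def_sqrt C : pos_def C -> exists2 P, pos_def P & P *m P = C.
Proof.
move=> pC; have [V [d [OO CE]]] := symmetric_spectral pC.1.
have d0 : forall i, 0 < d i by apply: (pos_def_spectral OO); rewrite -CE.
exists (spectral V (fun i => Num.sqrt (d i))).
  by apply: spectral_pos_def => // i; rewrite sqrtr_gt0.
rewrite spectralM// CE; congr spectral; apply/funext => i.
by rewrite -expr2 sqr_sqrtr// ltW.
Qed.

(** Both roots are taken in one eigenframe of [C], which is why they commute. *)
Lemma pos_def_sqrt_pair C : pos_def C -> pos_def (1%:M - C) ->
  exists P Q, [/\ pos_def P, pos_def Q, P *m P = C, P *m Q = Q *m P &
    P *m P + Q *m Q = 1%:M].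
Proof.
move=> pC pC'; have [V [d [OO CE]]] := symmetric_spectral pC.1.
have C'E : 1%:M - C = spectral V (fun i => 1 - d i).
  apply/eqP; rewrite subr_eq CE spectralD -(spectral_cst OO).
  by apply/eqP; congr spectral; apply/funext => i; rewrite subrK.
have d0 : forall i, 0 < d i by apply: (pos_def_spectral OO); rewrite -CE.
have d1 : forall i, 0 < 1 - d i by apply: (pos_def_spectral OO); rewrite -C'E.
exists (spectral V (fun i => Num.sqrt (d i))), (spectral V (fun i => Num.sqrt (1 - d i))).
split.
- by apply: spectral_pos_def => // i; rewrite sqrtr_gt0.
- by apply: spectral_pos_def => // i; rewrite sqrtr_gt0.
- rewrite spectralM// CE; congr spectral; apply/funext => i.
  by rewrite -expr2 sqr_sqrtr// ltW.
- by rewrite !spectralM//; congr spectral; apply/funext => i; rewrite mulrC.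
- rewrite !spectralM// spectralD -(spectral_cst OO); congr spectral.
  by apply/funext => i; rewrite -!expr2 !sqr_sqrtr ?ltW// addrC subrK.
Qed.

Lemma loewner_spectral_le O d (c : R) : O *m O^T = 1%:M -> (forall i, d i <= c) ->
  loewner_le (spectral O d) c%:M.
Proof.
move=> OO dc y; rewrite -(spectral_cst OO) !quad_form_spectral.
by apply: ler_sum => i _; rewrite ler_wpM2r ?sqr_ge0.
Qed.

Lemma loewner_spectral_ge O d (c : R) : O *m O^T = 1%:M -> (forall i, c <= d i) ->
  loewner_le c%:M (spectral O d).
Proof.
move=> OO dc y; rewrite -(spectral_cst OO) !quad_form_spectral.
by apply: ler_sum => i _; rewrite ler_wpM2r ?sqr_ge0.
Qed.

End spectral_calculus.

(** * Continuity and compactness for matrices *)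

Section matrix_continuity.
Context {R : realType}.

Lemma continuous_mx (T : topologicalType) m n (f : T -> 'M[R]_(m, n)) :
  (forall i j, continuous (fun x => f x i j)) -> continuous f.
Proof.
move=> cf x; apply/cvg_ballP => e e0.
have H : nbhs x [set y | forall i j, `|f x i j - f y i j| < e].
  apply: (@filter_forall _ _ (fun i y => forall j, `|f x i j - f y i j| < e)) => i.
  apply: (@filter_forall _ _ (fun j y => `|f x i j - f y i j| < e)) => j.
  by have /cvgrPdist_lt/(_ _ e0) := cf i j x.
by apply: filterS H => y H; split.
Qed.

Lemma continuous_sum (T : topologicalType) (I : finType) (f : I -> T -> R) :
  (forall i, continuous (f i)) -> continuous (fun x => \sum_i f i x).
Proof.
by move=> cf x; apply: cvg_big => [|i _]; [exact: add_continuous|exact: cf].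
Qed.

Lemma continuous_mulmx (T : topologicalType) m n p
    (f : T -> 'M[R]_(m, n)) (g : T -> 'M[R]_(n, p)) :
  continuous f -> continuous g -> continuous (fun x => f x *m g x).
Proof.
move=> cf cg; apply: continuous_mx => i j.
rewrite (_ : (fun _ => _) = fun x => \sum_k f x i k * g x k j); last first.
  by apply/funext => x; rewrite mxE.
apply: continuous_sum => k x.
have ci q r (h : T -> 'M[R]_(q, r)) (a : 'I_q) (b : 'I_r) : continuous h ->
    {for x, continuous (fun x => h x a b)}.
  move=> ch; apply: (@continuous_comp _ _ _ h (fun M : 'M[R]_(q, r) => M a b)).
    exact: ch.
  exact: coord_continuous.
by apply: cvgM; apply: ci.
Qed.

Lemma continuous_trace n : continuous (fun A : 'M[R]_n => \tr A).
Proof. by apply: continuous_sum => i; exact: coord_continuous. Qed.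

(** Heine-Borel for row vectors, transported by the continuous map [vec_mx]. *)
Lemma compact_mx m n (S : set 'M[R]_(m, n)) (T : R) :
  closed S -> (forall A, S A -> forall i j, `|A i j| <= T) -> compact S.
Proof.
move=> cS bS; pose S' := (@vec_mx R m n) @^-1` S.
have cv : continuous (@vec_mx R m n).
  apply: continuous_mx => i j.
  rewrite (_ : (fun _ => _) = fun v : 'rV_(m * n) => v ord0 (mxvec_index i j)); last first.
    by apply/funext => v; rewrite mxE.
  exact: coord_continuous.
have cS' : compact S'.
  apply: (@subclosed_compact _ _ [set v : 'rV[R]_(m * n) | forall k, `[- T, T]%classic (v ord0 k)]).
  - by apply: closed_comp => // v _; exact: cv.
  - apply: (@rV_compact _ _ (fun=> `[- T, T]%classic)) => k.
    exact: segment_compact.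
  - move=> v Sv k; rewrite /= in_itv/= -ler_norml.
    have [i j] := mxvec_indexP k.
    by have := bS _ Sv i j; rewrite mxE.
rewrite (_ : S = vec_mx @` S').
  by apply: continuous_compact => //; apply: continuous_subspaceT.
apply/seteqP; split => [A SA|_ [v Sv <-]//].
by exists (mxvec A) => //=; [rewrite /S' /= mxvecK|rewrite mxvecK].
Qed.

End matrix_continuity.

Lemma natr_pred_ge2 (R : realType) (n : nat) : (3 <= n)%N -> 2 <= n%:R - 1 :> R.
Proof. by move=> n3; have : (3%:R : R) <= n%:R; [rewrite ler_nat|lra]. Qed.

(** * [A2] as a trace equation *)

Section trace_equation.
Context {R : realType} (n : nat).
Hypothesis n3 : (3 <= n)%N.
Implicit Types (A O : 'M[R]_n) (d : 'I_n -> R).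

(** For symmetric [A] the sum of the squared eigenvalues, and [trace4] that of their fourth powers.
    Both are polynomial in the entries, so continuity requires no ordering of the eigenvalues. *)
Definition trace2 A := \tr (A *m A).
Definition trace4 A := \tr (A *m A *m (A *m A)).

Let N : R := n%:R - 1.
Let N_ge2 : 2 <= N.
Proof. exact: natr_pred_ge2. Qed.
Let N0 : N != 0. Proof. by rewrite gt_eqF// (lt_le_trans _ N_ge2)// ltr0n. Qed.

Let sum_quadratic (c k : R) (f g : 'I_n -> R) :
  \sum_i (c - k * f i + g i) = (N + 1) * c - k * (\sum_i f i) + \sum_i g i.
Proof.
rewrite big_split/= sumrB mulr_sumr sumr_const card_ord -[LHS]/(_ - _ + _).
by rewrite -mulr_natl /N subrK.
Qed.

Lemma sigma2E (zeta : 'I_n -> R) :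
  2 * sigma2 zeta = sigma1 zeta ^+ 2 - \sum_i zeta i ^+ 2.
Proof.
rewrite /sigma2 /sigma1 expr2 mulr_suml.
have -> : \sum_i zeta i * (\sum_j zeta j) = \sum_(i < n) \sum_(j < n | (i < j)%N) zeta i * zeta j
    + \sum_(i < n) \sum_(j < n | (j < i)%N) zeta i * zeta j + \sum_i zeta i ^+ 2.
  rewrite -!big_split/=; apply: eq_bigr => i _.
  rewrite mulr_sumr (bigD1 i)//= -expr2 addrC; congr (_ + _).
  rewrite (bigID (fun j : 'I_n => (i < j)%N))/=; congr (_ + _).
    by apply: eq_bigl => j; rewrite -val_eqE/=; case: ltngtP.
  by apply: eq_bigl => j; rewrite -val_eqE/=; case: ltngtP.
have -> : \sum_(i < n) \sum_(j < n | (j < i)%N) zeta i * zeta j =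
    \sum_(i < n) \sum_(j < n | (i < j)%N) zeta i * zeta j.
  rewrite (exchange_big_dep xpredT)//=; apply: eq_bigr => i _.
  by apply: eq_bigr => j _; rewrite mulrC.
by ring.
Qed.

(* [trace2 A / (n - 1)] is [sigma_1 zeta], whence
   [zeta i = trace2 A / (n - 1) - lambda_i ^ 2]. *)
Lemma A2_trace_equation A : A2 A <->
  pos_def A /\ trace2 A ^+ 2 / (n%:R - 1) - trace4 A = 2.
Proof.
rewrite -/N; split=> [[pA [lam [zeta [eA G z1 lz]]]]|[pA eqA]].
  split=> //; have [Q [d [QQ AE]]] := symmetric_spectral pA.1.
  (* Both families are the roots of one characteristic polynomial, hence permutations of each
     other. *)
  have dl (f : R -> R) : \sum_i f (d i) = \sum_i f (lam i).
    have : perm_eq [seq d i | i <- index_enum 'I_n] [seq lam i | i <- index_enum 'I_n].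
      apply: prod_XsubC_eq; rewrite !big_map.
      by rewrite -(char_poly_spectral QQ) -AE.
    move=> /(perm_big _)/= H.
    have := H R +%R 0 xpredT f.
    by rewrite !big_map.
  have t2 : trace2 A = \sum_i lam i ^+ 2.
    by rewrite /trace2 AE spectralM// trace_spectral// -(dl (fun x => x * x)).
  have t4 : trace4 A = \sum_i (lam i ^+ 2) ^+ 2.
    by rewrite /trace4 AE !spectralM// trace_spectral// -(dl (fun x => x * x * (x * x))).
  have zE i : zeta i = sigma1 zeta - lam i ^+ 2.
    by rewrite lz /sigma1 (bigD1 i)//= addrK.
  have s1 : trace2 A = N * sigma1 zeta.
    have : sigma1 zeta = \sum_i (sigma1 zeta - lam i ^+ 2) by apply: eq_bigr => i _.
    by rewrite sumrB -t2 sumr_const card_ord -mulr_natl /N => H; lra.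
  have := sigma2E zeta; rewrite z1 mulr1.
  have -> : \sum_i zeta i ^+ 2 = \sum_i (sigma1 zeta ^+ 2 - 2 * sigma1 zeta * lam i ^+ 2 + (lam i ^+ 2) ^+ 2).
    by apply: eq_bigr => i _; rewrite zE; ring.
  rewrite sum_quadratic -t2 -t4 s1 => ->.
  by field.
split=> //; have [Q [d [QQ AE]]] := symmetric_spectral pA.1.
have d0 : forall i, 0 < d i by apply: (pos_def_spectral QQ); rewrite -AE.
have t2 : trace2 A = \sum_i d i ^+ 2.
  by rewrite /trace2 AE spectralM// trace_spectral//.
have t4 : trace4 A = \sum_i (d i ^+ 2) ^+ 2.
  by rewrite /trace4 AE !spectralM// trace_spectral//.
pose zeta i := trace2 A / N - d i ^+ 2.
have s1 : sigma1 zeta = trace2 A / N.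
  rewrite /sigma1 sumrB -t2 sumr_const card_ord -mulr_natl.
  have -> : (n%:R : R) = N + 1 by rewrite /N subrK.
  by field.
have s2 : sigma2 zeta = 1.
  apply: (mulfI (_ : 2 != 0 :> R)) => //; rewrite sigma2E s1 mulr1 -[RHS]eqA.
  have -> : \sum_i zeta i ^+ 2 = \sum_i ((trace2 A / N) ^+ 2 - 2 * (trace2 A / N) * d i ^+ 2 + (d i ^+ 2) ^+ 2).
    by apply: eq_bigr => i _; rewrite /zeta; ring.
  rewrite sum_quadratic -t2 -t4.
  by field.
have t2_gt0 : 0 < trace2 A.
  have i0 : 'I_n := Ordinal (ltn_trans (isT : (0 < 2)%N) n3).
  rewrite t2 (bigD1 i0)//= ltr_pwDl ?exprn_gt0// sumr_ge0// => j _.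
  exact: sqr_ge0.
exists d, zeta; split=> //.
- by rewrite /eigenvalues_of AE char_poly_spectral.
- by split; rewrite ?s1 ?s2// divr_gt0// (lt_le_trans _ N_ge2).
- move=> i; have := s1; rewrite /sigma1 (bigD1 i)//= => H.
  apply: (addrI (zeta i)); rewrite H.
  by rewrite /zeta subrK.
Qed.

End trace_equation.

(** * The set A2 *)

Section pos_def_open.
Context {R : realType} (n : nat).
Implicit Types (A B : 'M[R]_n) (y : 'cV[R]_n).

Lemma quad_formD A B y : quad_form (A + B) y = quad_form A y + quad_form B y.
Proof. by rewrite /quad_form mulmxDr mulmxDl mxE. Qed.

Lemma quad_formZ (a : R) A y : quad_form (a *: A) y = a * quad_form A y.
Proof. by rewrite /quad_form -scalemxAr -scalemxAl mxE. Qed.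

Lemma quad_form_scalar (a : R) y : quad_form a%:M y = a * enorm y ^+ 2.
Proof.
rewrite /quad_form mul_mx_scalar -scalemxAl mxE enorm_sqr mxE; congr (_ * _).
by apply: eq_bigr => i _; rewrite mxE expr2.
Qed.

Lemma quad_form_bound A y : quad_form A y ^+ 2 <= \tr (A *m A^T) * (enorm y ^+ 2) ^+ 2.
Proof.
have -> : quad_form A y = \sum_i y i ord0 * (A *m y) i ord0.
  by rewrite /quad_form -mulmxA mxE; apply: eq_bigr => i _; rewrite mxE.
apply: (le_trans (cauchy_schwarz _ _)); rewrite -!enorm_sqr.
rewrite (_ : \tr _ * _ ^+ 2 = enorm y ^+ 2 * (\tr (A *m A^T) * enorm y ^+ 2)); last by ring.
by rewrite ler_wpM2l ?sqr_ge0// enorm_mulmx.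
Qed.

Lemma pos_defD A B : pos_def A -> pos_def B -> pos_def (A + B).
Proof.
move=> [sA pA] [sB pB]; split; first by rewrite linearD/= sA sB.
by move=> y y0; rewrite quad_formD addr_gt0 ?pA ?pB.
Qed.

Lemma pos_defZ (a : R) A : 0 < a -> pos_def A -> pos_def (a *: A).
Proof.
move=> a0 [sA pA]; split; first by rewrite linearZ/= sA.
by move=> y y0; rewrite quad_formZ mulr_gt0 ?pA.
Qed.

Lemma pos_def_scalar (a : R) : 0 < a -> pos_def (a%:M : 'M[R]_n).
Proof.
move=> a0; split; first exact: tr_scalar_mx.
by move=> y y0; rewrite quad_form_scalar mulr_gt0// exprn_gt0// enorm_gt0.
Qed.

Lemma pos_def_sqr A : pos_def A -> pos_def (A *m A).
Proof.
move=> pA; have := pos_def_congruence (pos_def_unit pA) (pos_def_scalar ltr01).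
by rewrite mulmx1 pA.1.
Qed.

Lemma pos_def_loewner A : pos_def A -> exists2 c : R, 0 < c & loewner_le c%:M A.
Proof.
move=> pA; have [Q [d [QQ AE]]] := symmetric_spectral pA.1.
have d0 : forall i, 0 < d i by apply: (pos_def_spectral QQ); rewrite -AE.
have s0 : 0 <= \sum_i (d i)^-1 by apply: sumr_ge0 => i _; rewrite invr_ge0 ltW.
(* Lies below every eigenvalue; a sum of inverses in place of a minimum also covers dimension 0. *)
exists (1 + \sum_i (d i)^-1)^-1; first by rewrite invr_gt0 ltr_pwDl.
rewrite AE; apply: loewner_spectral_ge => // i.
rewrite -[leRHS]invrK lef_pV2 ?posrE ?invr_gt0 ?ltr_pwDl//.
rewrite (bigD1 i)//= addrCA lerDl addr_ge0// sumr_ge0// => j _.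
by rewrite invr_ge0 ltW.
Qed.

Lemma loewner_pos_def (c : R) A : 0 < c -> A^T = A -> loewner_le c%:M A -> pos_def A.
Proof.
move=> c0 sA cA; split=> // y y0; apply: lt_le_trans (cA y).
by rewrite quad_form_scalar mulr_gt0// exprn_gt0// enorm_gt0.
Qed.

(** A perturbation of Frobenius norm less than [c] changes the quadratic form by less than
    [c |y|^2]. Positivity is open only among symmetric matrices, hence the premise on [B']. *)
Lemma pos_def_near B : pos_def B -> \forall B' \near B, B'^T = B' -> pos_def B'.
Proof.
move=> pB; have [c c0 cB] := pos_def_loewner pB.
have ct : continuous (fun M : 'M[R]_n => \tr ((M - B) *m (M - B)^T)).
  move=> M; apply: (@continuous_comp _ _ _ (fun M : 'M[R]_n => (M - B) *m (M - B)^T)); last first.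
    exact: continuous_trace.
  apply: continuous_mulmx; apply: continuous_mx => i j.
    rewrite (_ : (fun _ => _) = fun M : 'M[R]_n => M i j - B i j); last first.
      by apply/funext => N; rewrite !mxE.
    by move=> N; apply: continuousB; [exact: coord_continuous|exact: cst_continuous].
  rewrite (_ : (fun _ => _) = fun M : 'M[R]_n => M j i - B j i); last first.
    by apply/funext => N; rewrite !mxE.
  by move=> N; apply: continuousB; [exact: coord_continuous|exact: cst_continuous].
have /cvgrPdist_lt/(_ (c ^+ 2)) := ct B.
rewrite exprn_gt0// => /(_ isT); apply: filterS => M.
rewrite subrr mul0mx mxtrace0 sub0r normrN => H sM; split=> // y y0.
have -> : M = (M - B) + B by rewrite subrK.
rewrite quad_formD; have := cB y; rewrite quad_form_scalar.
have e0 : 0 < enorm y ^+ 2 by rewrite exprn_gt0// enorm_gt0.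
have ce0 : 0 < c * enorm y ^+ 2 by rewrite mulr_gt0.
have : quad_form (M - B) y ^+ 2 < (c * enorm y ^+ 2) ^+ 2.
  apply: (le_lt_trans (quad_form_bound _ _)); rewrite [ltRHS]exprMn.
  rewrite ltr_pM2r; last exact: exprn_gt0.
  exact: le_lt_trans (ler_norm _) H.
rewrite -ltr_sqrt ?exprn_gt0// !sqrtr_sqr (gtr0_norm ce0) ltr_norml => /andP[+ _].
by lra.
Qed.

End pos_def_open.

(** * Ellipticity, shifts and compactness in [A2] *)

Section A2_family.
Context {R : realType} (n : nat).
Hypothesis n3 : (3 <= n)%N.
Implicit Types A B : 'M[R]_n.

Let N : R := n%:R - 1.
Let N_ge2 : 2 <= N.
Proof. exact: natr_pred_ge2. Qed.
Let N0 : N != 0. Proof. by rewrite gt_eqF// (lt_le_trans _ N_ge2)// ltr0n. Qed.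
Let nE : (n%:R : R) = N + 1. Proof. by rewrite /N subrK. Qed.

Lemma trace2_ge0 A : A^T = A -> 0 <= trace2 A.
Proof. by move=> sA; rewrite /trace2 -{2}sA trace_gram_ge0. Qed.

Lemma A2_trace2_gt0 A : A2 A -> 0 < trace2 A.
Proof.
move=> /(A2_trace_equation n3)[pA eqA]; rewrite lt_def trace2_ge0 ?andbT ?pA.1//.
apply/eqP => t0; move: eqA; rewrite t0 expr0n/= mul0r sub0r.
have : 0 <= trace4 A.
  have := trace2_ge0 (A := A *m A); rewrite trmx_mul pA.1; exact.
by move=> h h'; lra.
Qed.

(** On [A2] the trace alone controls the smallest eigenvalue: with [sg = trace2 A / (n - 1)] the
    numbers [zeta i = sg - d i ^+ 2] have squares summing to [sg^2 - 2], so none of them can come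
    too close to [sg]. *)
Lemma A2_elliptic A (T : R) : A2 A -> trace2 A <= T -> 1 <= T -> elliptic T A.
Proof.
move=> A2A tT T1; have t0 := A2_trace2_gt0 A2A.
move: A2A => /(A2_trace_equation n3)[pA eqA].
have [Q [d [QQ AE]]] := symmetric_spectral pA.1.
have d0 : forall i, 0 < d i by apply: (pos_def_spectral QQ); rewrite -AE.
have t2 : trace2 A = \sum_i d i ^+ 2 by rewrite /trace2 AE spectralM// trace_spectral.
have t4 : trace4 A = \sum_i (d i ^+ 2) ^+ 2.
  by rewrite /trace4 AE !spectralM// trace_spectral.
pose sg := trace2 A / N.
have sg0 : 0 < sg by rewrite divr_gt0// (lt_le_trans _ N_ge2).
have sgT : 2 * sg <= T.
  apply: le_trans tT; rewrite /sg mulrCA ger_pMr// ler_pdivrMr ?mul1r//.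
  exact: lt_le_trans N_ge2.
have T0 : 0 < T by exact: lt_le_trans T1.
have TT : T <= T ^+ 2 by rewrite expr2 ler_peMr// ltW.
split=> //.
- rewrite AE; apply: loewner_spectral_ge => // i.
  have zeta2 : \sum_i (sg - d i ^+ 2) ^+ 2 = sg ^+ 2 - 2.
    have -> : \sum_i (sg - d i ^+ 2) ^+ 2 =
        \sum_i (sg ^+ 2 - 2 * sg * d i ^+ 2 + (d i ^+ 2) ^+ 2).
      by apply: eq_bigr => j _; ring.
    rewrite big_split/= sumrB -t4 -[X in _ - X + _]mulr_sumr -t2 sumr_const card_ord.
    rewrite -(mulr_natl (sg ^+ 2) n) nE.
    have tN : trace2 A = N * sg by rewrite /sg; field; exact: N0.
    have q : trace2 A ^+ 2 / N = N * sg ^+ 2 by rewrite /sg; field; exact: N0.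
    by move: eqA; rewrite -/N q tN => eqA; nra.
  have zi : (sg - d i ^+ 2) ^+ 2 <= sg ^+ 2 - 2.
    rewrite -zeta2 (bigD1 i)//= lerDl sumr_ge0// => j _; exact: sqr_ge0.
  (* With [q = d i ^+ 2] the bound [zi] says [2 <= q (2 sg - q)], which is at most
     [2 sg q <= T q]. *)
  have di0 := d0 i; have di : 1 <= T * d i ^+ 2.
    have : 0 < d i ^+ 2 by rewrite exprn_gt0.
    by move: (d i ^+ 2) zi => q zi q0; nra.
  rewrite -ler_pV2 ?inE ?unitfE ?gt_eqF ?invr_gt0 ?invr_neq0//= invrK.
  rewrite -ler_sqr ?nnegrE ?invr_ge0 ?(ltW di0) ?(ltW T0)// exprVn.
  apply: le_trans TT; rewrite -[leLHS]mul1r ler_pdivrMr ?exprn_gt0//.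
- rewrite AE; apply: loewner_spectral_le => // i.
  rewrite -ler_sqr ?nnegrE ?(ltW (d0 i)) ?(ltW T0)//; apply: le_trans TT.
  apply: le_trans tT; rewrite t2 (bigD1 i)//= lerDl sumr_ge0// => j _; exact: sqr_ge0.
Qed.

(** For [a] times the identity the trace equation becomes [n a^4 / (n - 1) = 2]. *)
Definition isotropic : R := Num.sqrt (Num.sqrt (2 * (n%:R - 1) / n%:R)).

Let n_gt0 : (0 : R) < n%:R. Proof. by rewrite ltr0n (leq_trans _ n3). Qed.

Lemma isotropic_gt0 : 0 < isotropic.
Proof.
by rewrite !sqrtr_gt0 divr_gt0// mulr_gt0// (lt_le_trans _ N_ge2).
Qed.

Lemma isotropicE : n%:R * isotropic ^+ 4 = 2 * (n%:R - 1).
Proof.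
have h : 0 <= 2 * (n%:R - 1) / n%:R :> R.
  by rewrite divr_ge0 ?mulr_ge0 ?(ltW n_gt0)// (le_trans _ N_ge2).
rewrite (_ : isotropic ^+ 4 = (isotropic ^+ 2) ^+ 2); last by rewrite -exprM.
rewrite /isotropic sqr_sqrtr ?sqrtr_ge0// sqr_sqrtr//; field.
exact: lt0r_neq0.
Qed.

Lemma A2_isotropic : A2 (isotropic%:M : 'M[R]_n).
Proof.
have a0 := isotropic_gt0; have := isotropicE; set a := isotropic in a0 * => aE.
apply/(A2_trace_equation n3); split; first exact: pos_def_scalar.
rewrite /trace2 /trace4 -!scalar_mxM !mxtrace_scalar -/N.
have {}aE : (N + 1) * a ^+ 4 = 2 * N by rewrite -nE.
rewrite -(mulr_natl (a * a) n) -(mulr_natl (a * a * (a * a)) n) nE.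
transitivity ((N + 1) * a ^+ 4 / N); first by field; exact: N0.
by rewrite aE; field; exact: N0.
Qed.

(** Inserting [t A^2 + d] into the trace equation, and using that equation for [A], leaves the
    quadratic [2 t^2 + 2 b t = c]. Its positive root satisfies [2 b t <= c <= 2], hence
    [t <= 1 / b]. *)
Lemma A2_sqrt_shift A (d : R) : A2 A -> 0 < d -> d <= 2^-1 ->
  exists t B, [/\ 0 < t, t <= (n%:R - 1) / (d * trace2 A), A2 B &
    B *m B = t *: (A *m A) + d%:M].
Proof.
move=> A2A d0 d2; have tau0 := A2_trace2_gt0 A2A.
move: A2A => /(A2_trace_equation n3)[pA eqA].
have A2E B : A2 B <-> pos_def B /\ trace2 B ^+ 2 / N - trace4 B = 2.
  exact: A2_trace_equation.
move: A2E nE N0 N_ge2 eqA; rewrite -/N; move: N => M A2E ME M0 M_ge2 eqA.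
set tau := trace2 A in tau0 eqA *.
pose b := d * tau / M; pose c := 2 - d ^+ 2 * n%:R / M.
have Mgt0 : 0 < M by exact: lt_le_trans M_ge2.
have b0 : 0 < b by rewrite /b divr_gt0// mulr_gt0.
(* This is where [d <= 1/2] enters: [d^2 n / (n - 1)] stays below 2, so the quadratic has a positive
   root. *)
have c0 : 0 < c.
  have dd : d ^+ 2 <= 2^-1 by rewrite expr2; nra.
  have dN : d ^+ 2 * (M + 1) <= 2^-1 * (M + 1) by apply: ler_wpM2r => //; lra.
  have : d ^+ 2 * n%:R / M < 2 by rewrite ltr_pdivrMr// ME; lra.
  by rewrite /c; lra.
have c2 : c <= 2.
  have : 0 <= d ^+ 2 * n%:R / M by rewrite divr_ge0 ?mulr_ge0 ?sqr_ge0// ltW.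
  by rewrite /c; lra.
pose t := (Num.sqrt (b ^+ 2 + 2 * c) - b) / 2.
have tE : 2 * t ^+ 2 + 2 * b * t = c.
  have sq : Num.sqrt (b ^+ 2 + 2 * c) ^+ 2 = b ^+ 2 + 2 * c.
    by rewrite sqr_sqrtr// addr_ge0 ?sqr_ge0// mulr_ge0// ltW.
  move: sq; rewrite /t; move: (Num.sqrt _) => q sq.
  have -> : 2 * ((q - b) / 2) ^+ 2 + 2 * b * ((q - b) / 2) = (q ^+ 2 - b ^+ 2) / 2 by field.
  by rewrite sq; field.
have t0 : 0 < t.
  rewrite divr_gt0// subr_gt0 -[ltLHS]gtr0_norm// -sqrtr_sqr ltr_sqrt ?ltrDl ?mulr_gt0//.
  by rewrite addr_gt0 ?exprn_gt0// mulr_gt0.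
have pC : pos_def (t *: (A *m A) + d%:M).
  by apply: pos_defD; [apply: pos_defZ => //; exact: pos_def_sqr|exact: pos_def_scalar].
have [B pB BB] := pos_def_sqrt pC.
exists t, B; split=> //.
  have -> : M / (d * tau) = b^-1 by rewrite /b invf_div.
  rewrite -[leRHS]mul1r ler_pdivlMr//; have := sqr_ge0 t; nra.
apply/A2E; split=> //; rewrite /trace2 /trace4 BB.
have tr2 : \tr (t *: (A *m A) + d%:M) = t * tau + d * n%:R.
  by rewrite mxtraceD mxtraceZ mxtrace_scalar mulr_natr.
have tr4 : \tr ((t *: (A *m A) + d%:M) *m (t *: (A *m A) + d%:M)) =
    t ^+ 2 * trace4 A + 2 * t * d * tau + d ^+ 2 * n%:R.
  rewrite mulmxDl !mulmxDr -!scalemxAl -!scalemxAr mul_mx_scalar mul_scalar_mx -scalar_mxM.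
  rewrite !mxtraceD !mxtraceZ mxtrace_scalar -mulr_natr -/(trace4 A) -/tau.
  by ring.
rewrite tr2 tr4.
have t4E : trace4 A = tau ^+ 2 / M - 2 by lra.
apply: (mulIf M0); move: tE; rewrite /b /c t4E ME => tE.
have {}tE : 2 * t ^+ 2 * M + 2 * (d * tau) * t = 2 * M - d ^+ 2 * (M + 1).
  have -> : 2 * M - d ^+ 2 * (M + 1) = (2 - d ^+ 2 * (M + 1) / M) * M by field.
  by rewrite -tE; field.
transitivity (2 * t ^+ 2 * M + 2 * (d * tau) * t + d ^+ 2 * (M + 1)); last by rewrite tE; ring.
by field.
Qed.

(** Positive definiteness is not a closed condition, but under the trace bound it may be replaced by
    the closed condition that [A] is at least [1 / T]. *)
Lemma A2_compact (T : R) : 1 <= T -> compact [set A : 'M[R]_n | A2 A /\ trace2 A <= T].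
Proof.
move=> T1; have T0 : 0 < T by exact: lt_le_trans T1.
pose S1 := [set A : 'M[R]_n | A^T = A].
pose S2 := [set A : 'M[R]_n | loewner_le (T^-1)%:M A].
pose S3 := [set A : 'M[R]_n | trace2 A ^+ 2 / (n%:R - 1) - trace4 A = 2].
pose S4 := [set A : 'M[R]_n | trace2 A <= T].
have -> : [set A : 'M[R]_n | A2 A /\ trace2 A <= T] = S1 `&` S2 `&` S3 `&` S4.
  apply/seteqP; split=> A.
    move=> [A2A tT]; have [[sA _] l _] := A2_elliptic A2A tT T1.
    by move: A2A => /(A2_trace_equation n3)[_ eqA].
  move=> [[[sA l] eqA] tT]; split=> //; apply/(A2_trace_equation n3); split=> //.
  by apply: loewner_pos_def l => //; rewrite invr_gt0.
have cid : continuous (@id 'M[R]_n) by move=> A; exact: cvg_id.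
have c2 : continuous (fun A : 'M[R]_n => A *m A) by apply: continuous_mulmx.
have ct2 : continuous (@trace2 R n).
  move=> A; apply: (@continuous_comp _ _ _ (fun A => A *m A)); first exact: c2.
  exact: continuous_trace.
have ct4 : continuous (@trace4 R n).
  move=> A; apply: (@continuous_comp _ _ _ (fun A => A *m A *m (A *m A))).
    by apply: continuous_mulmx.
  exact: continuous_trace.
have ceq : continuous (fun A : 'M[R]_n => trace2 A ^+ 2 / (n%:R - 1) - trace4 A).
  have gen (X : topologicalType) (f g : X -> R) (k : R) : continuous f -> continuous g ->
      continuous (fun x => f x ^+ 2 / k - g x).
    move=> cf cg x; apply: cvgB; last exact: cg.
    by apply: cvgM; [apply: cvgM; exact: cf|exact: cvg_cst].
  exact: gen.
apply: (@compact_mx _ _ _ _ T); last first.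
  move=> A [[[sA _] _] tT] i j; rewrite -ler_sqr ?nnegrE ?normr_ge0 ?(ltW T0)//.
  apply: (@le_trans _ _ T); last by rewrite expr2 ler_peMr// ltW.
  have tE : trace2 A = \sum_i \sum_j A i j ^+ 2.
    by rewrite -trace_gram (sA : A^T = A).
  apply: le_trans tT; rewrite tE -normrX ger0_norm ?sqr_ge0//.
  rewrite (bigD1 i)//= (bigD1 j)//= -addrA lerDl addr_ge0// sumr_ge0// => k _.
    exact: sqr_ge0.
  by apply: sumr_ge0 => l _; exact: sqr_ge0.
apply: closedI; last first.
  by apply: (@closed_comp _ _ (@trace2 R n) [set x | x <= T]) => // A _; exact: ct2.
apply: closedI; last first.
  apply: (@closed_comp _ _ (fun A => trace2 A ^+ 2 / (n%:R - 1) - trace4 A) [set x | x = 2]).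
    by move=> A _; exact: ceq.
  exact: closed_eq.
apply: closedI.
  have -> : S1 = \bigcap_(i in [set: 'I_n]) \bigcap_(j in [set: 'I_n])
      ((fun A : 'M[R]_n => A j i - A i j) @^-1` [set x | x = 0]).
    apply/seteqP; split=> A.
      by move=> sA i _ j _ /=; rewrite -{1}sA mxE subrr.
    move=> H; apply/matrixP => i j; rewrite mxE.
    by apply/eqP; rewrite -subr_eq0; apply/eqP; exact: H.
  apply: closed_bigI => i _; apply: closed_bigI => j _.
  apply: closed_comp; last exact: closed_eq.
  by move=> A _; apply: continuousB; exact: coord_continuous.
have -> : S2 = \bigcap_(y in [set: 'cV[R]_n])
    ((fun A : 'M[R]_n => quad_form A y) @^-1` [set x | quad_form (T^-1)%:M y <= x]).
  by apply/seteqP; split=> A H => [y _|y]; exact: H.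
apply: closed_bigI => y _; apply: closed_comp; last exact: closed_ge.
move=> A _.
apply: (@continuous_comp _ _ _ (fun A : 'M[R]_n => y^T *m A *m y) (fun M : 'M[R]_1 => M ord0 ord0)).
  apply: continuous_mulmx; last exact: cst_continuous.
  by apply: continuous_mulmx => //; exact: cst_continuous.
exact: coord_continuous.
Qed.

End A2_family.

(** * Minimization *)

Section power_bounds.
Context {R : realType}.

Lemma powR_invK (x r : R) : 0 <= x -> 0 < r -> (x `^ r^-1) `^ r = x.
Proof. by move=> x0 r0; rewrite -powRrM mulVf ?gt_eqF// powRr1. Qed.

End power_bounds.

Section minimization.
Context {R : realType} (n : nat).
Hypothesis n3 : (3 <= n)%N.
Implicit Types A B : 'M[R]_n.

Let N : R := n%:R - 1.
Let N_ge2 : 2 <= N.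
Proof. exact: natr_pred_ge2. Qed.

Let Ngt0 : 0 < n%:R - 1 :> R. Proof. by rewrite (lt_le_trans _ N_ge2). Qed.

(* In the application [kap] is [K] times the measure of the ball of pairs, and
   [eta0] a lower bound of the averages which does not depend on [s >= s0]. *)
Variables (kap s0 eta0 : R).
Hypotheses (kap0 : 0 <= kap) (s00 : 0 < s0) (eta00 : 0 < eta0).

Let a : R := @isotropic R n.
Let q : R := n%:R * a ^+ 2.
(** An upper bound for [j] at the isotropic matrix, whose [trace2] is [q]. *)
Let U : R := kap * q / (2 `^ s0 - 1).
(** Chosen, with [n d = w / 2], so that the error [kap (n d)^s] is at most [eta0 / 2]. The cap at 1
    gives [w^s <= w^s0] for every [s >= s0], and also [d <= 1/2]. *)
Let w : R := Num.min 1 ((eta0 / (2 * (kap + 1))) `^ s0^-1).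
Let d : R := w / (2 * n%:R).

(** The first summand forces [j >= U] beyond the bound, [q] places the isotropic matrix within it,
    and 1 makes the bound an admissible ellipticity constant. *)
Definition trace_bound : R := (n%:R - 1) / d * (1 + (2 * U / eta0) `^ s0^-1) + q + 1.

Let n0 : (0 : R) < n%:R. Proof. by rewrite ltr0n (leq_trans _ n3). Qed.

Let a0 : 0 < a. Proof. exact: isotropic_gt0. Qed.
Let aE : n%:R * a ^+ 4 = 2 * (n%:R - 1). Proof. exact: isotropicE. Qed.

Let q1 : 1 <= q.
Proof.
have : 1 <= a ^+ 2.
  rewrite -(ler_sqr (x := 1)) ?nnegrE ?sqr_ge0// expr1n -exprM.
  have := aE; have : (3%:R : R) <= n%:R by rewrite ler_nat.
  by move: (n%:R : R) (a ^+ (2 * 2)) => m b m3 e; nra.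
have : (1 : R) <= n%:R by rewrite ler1n (leq_trans _ n3).
by rewrite /q; nra.
Qed.

Let w0 : 0 < w.
Proof.
by rewrite lt_min ltr01 powR_gt0// divr_gt0// mulr_gt0// ltr_wpDl.
Qed.
Let d0 : 0 < d. Proof. by rewrite divr_gt0// mulr_gt0. Qed.
Let d_le : d <= 2^-1.
Proof.
rewrite ler_pdivrMr ?mulr_gt0// mulrA mulVf// mul1r.
apply: (@le_trans _ _ 1); first by rewrite ge_min lexx.
by rewrite ler1n (leq_trans _ n3).
Qed.

Let pow2_gt0 : 0 < 2 `^ s0 - 1.
Proof.
have p1 : 1 `^ s0 = 1 :> R by rewrite powR1.
rewrite subr_gt0 -[ltLHS]p1.
by apply: (gt0_ltr_powR s00); rewrite ?nnegrE ?ltr1n.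
Qed.

Let U0 : 0 <= U.
Proof. by rewrite divr_ge0 ?(ltW pow2_gt0)// mulr_ge0// (le_trans _ q1). Qed.

Lemma trace_bound_ge1 : 1 <= trace_bound.
Proof.
rewrite /trace_bound -/N lerDr addr_ge0 ?(le_trans _ q1)//.
rewrite mulr_ge0 ?addr_ge0 ?powR_ge0// divr_ge0 ?(ltW d0)//.
exact: le_trans N_ge2.
Qed.

Variables (s : R) (j : 'M[R]_n -> R).
Hypotheses (s0s : s0 <= s) (s1 : s <= 1).
Hypothesis j_le : forall A B, A \in unitmx -> B \in unitmx -> A^T = A -> B^T = B ->
  pos_def (B *m B - A *m A) -> j B <= j A + kap * \tr (B *m B - A *m A) `^ s.
Hypothesis j_scale : forall (t : R) A, 0 < t -> A \in unitmx ->
  j (t *: A) = (t ^+ 2) `^ s * j A.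
Hypothesis j_ge : forall A, A2 A -> eta0 <= j A.

Let s_gt0 : 0 < s. Proof. exact: lt_le_trans s0s. Qed.

(** Compare the isotropic matrix with its multiple by the square root of 2: homogeneity gives
    [2^s j <= j + kap q^s], from which [j] can be isolated. *)
Let j_scalar_le : j a%:M <= U.
Proof.
have au : (a%:M : 'M[R]_n) \in unitmx by apply: pos_def_unit; exact: pos_def_scalar.
pose b := Num.sqrt 2 : R; have b0 : 0 < b by rewrite sqrtr_gt0.
have b2 : b ^+ 2 = 2 by rewrite sqr_sqrtr.
have E : b *: a%:M *m (b *: a%:M) - a%:M *m a%:M = (a ^+ 2)%:M :> 'M[R]_n.
  rewrite -scalemxAl -scalemxAr scalerA -expr2 b2 -scalar_mxM scale_scalar_mx.
  by rewrite -raddfB; congr (_%:M); ring.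
have bu : b *: (a%:M : 'M[R]_n) \in unitmx.
  by rewrite unitmxZ// unitfE gt_eqF.
have := j_le au bu; rewrite linearZ/= tr_scalar_mx E.
move=> /(_ erefl erefl (pos_def_scalar n (exprn_gt0 2 a0))).
rewrite j_scale// b2 mxtrace_scalar -(mulr_natl (a ^+ 2) n) -/q => H.
have qs : q `^ s <= q by rewrite -[leRHS]powRr1 ?(le_trans _ q1)// ler_powR.
have p2 : 2 `^ s0 <= 2 `^ s :> R by apply: ler_powR => //; rewrite ler1n.
have j0 : 0 <= j a%:M.
  by apply: le_trans (ltW eta00) _; apply: j_ge; exact: A2_isotropic.
rewrite /U ler_pdivlMr; last exact: pow2_gt0.
have kq : kap * q `^ s <= kap * q by apply: ler_wpM2l.
have : (2 `^ s0 - 1) * j a%:M <= (2 `^ s - 1) * j a%:M.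
  by apply: ler_wpM2r => //; rewrite lerB.
move: H kq; move: (j _) (kap * q) (kap * _) (2 `^ s) (2 `^ s0) => x y z e f H kq h.
by lra.
Qed.

Let kap_d : kap * (n%:R * d) `^ s <= eta0 / 2.
Proof.
have nd : n%:R * d = w / 2 by rewrite /d; field; exact: lt0r_neq0.
have w1 : w <= 1 by rewrite ge_min lexx.
have ws : (w / 2) `^ s <= eta0 / (2 * (kap + 1)).
  apply: (@le_trans _ _ (w `^ s)).
    apply: (ge0_ler_powR (ltW s_gt0)); rewrite ?nnegrE ?divr_ge0 ?(ltW w0)//.
    by rewrite ler_pdivrMr// ler_peMr ?(ltW w0)// ler1n.
  apply: (@le_trans _ _ (w `^ s0)); first by apply: ger_powR => //; rewrite w0.
  have e0 : 0 <= eta0 / (2 * (kap + 1)).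
    by rewrite divr_ge0 ?(ltW eta00)// mulr_ge0// addr_ge0.
  rewrite -[leRHS](powR_invK e0 s00).
  apply: (ge0_ler_powR (ltW s00)); rewrite ?nnegrE ?powR_ge0 ?(ltW w0)//.
  by rewrite /w ge_min lexx orbT.
rewrite nd; apply: (@le_trans _ _ (kap * (eta0 / (2 * (kap + 1))))).
  exact: ler_wpM2l.
have k1 : 0 < kap + 1 by rewrite ltr_wpDl.
rewrite (_ : _ * _ = eta0 / 2 * (kap / (kap + 1))); last first.
  by field; rewrite gt_eqF.
rewrite ler_piMr ?divr_ge0 ?(ltW eta00)// ler_pdivrMr// mul1r lerDl//.
Qed.

(** The shifted matrix [B] lies in [A2], so [eta0 <= j B <= t^s j A + eta0 / 2]. A large trace makes
    [t] small, and [j A] must be large. *)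
Lemma value_ge_of_large_trace A : A2 A -> trace_bound < trace2 A -> U <= j A.
Proof.
move=> A2A tA; have tau0 := A2_trace2_gt0 n3 A2A.
have [t [B [t0 tN A2B BB]]] := A2_sqrt_shift n3 A2A d0 d_le.
set X := (n%:R - 1) / (d * trace2 A) in tN.
have X0 : 0 < X.
  by rewrite divr_gt0// mulr_gt0.
have pA : pos_def A by case: A2A.
have pB : pos_def B by case: A2B.
have st0 : 0 < Num.sqrt t by rewrite sqrtr_gt0.
have Au := pos_def_unit pA.
have tAu : Num.sqrt t *: A \in unitmx by rewrite unitmxZ// unitfE gt_eqF.
have E : B *m B - Num.sqrt t *: A *m (Num.sqrt t *: A) = d%:M.
  rewrite BB -scalemxAl -scalemxAr scalerA -expr2 sqr_sqrtr ?(ltW t0)//.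
  by rewrite addrAC subrr add0r.
have := j_le tAu (pos_def_unit pB); rewrite linearZ/= pA.1 E.
move=> /(_ erefl pB.1 (pos_def_scalar n d0)).
rewrite j_scale// sqr_sqrtr ?(ltW t0)// mxtrace_scalar -(mulr_natl d n) => H.
have jA0 : 0 <= j A by apply: le_trans (ltW eta00) (j_ge A2A).
have H1 : eta0 / 2 <= t `^ s * j A by have := j_ge A2B; have := kap_d; lra.
have tX : t `^ s <= X `^ s.
  by apply: (ge0_ler_powR (ltW s_gt0)); rewrite ?nnegrE ?(ltW t0) ?(ltW X0).
have H2 : eta0 / 2 <= X `^ s * j A.
  by apply: (le_trans H1); apply: ler_wpM2r.
(* The base used below is [1 + v] rather than [v]: being at least 1, its power [s] dominates its
   power [s0], hence [2 U / eta0]. *)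
pose v := (2 * U / eta0) `^ s0^-1.
have v0 : 0 <= v by rewrite powR_ge0.
have XV : X * (1 + v) <= 1.
  have XE : X * (1 + v) = (n%:R - 1) / d * (1 + v) / trace2 A.
    by rewrite /X invfM; ring.
  rewrite XE ler_pdivrMr// mul1r.
  by move: tA; rewrite /trace_bound -/v; move: q1; lra.
have V0 : 0 <= (1 + v) `^ s by rewrite powR_ge0.
have XVs : X `^ s * (1 + v) `^ s <= 1.
  rewrite -powRM ?(ltW X0) ?addr_ge0//.
  have p1 : 1 `^ s = 1 :> R by rewrite powR1.
  rewrite -[leRHS]p1; apply: (ge0_ler_powR (ltW s_gt0)); rewrite ?nnegrE//.
  by rewrite mulr_ge0 ?addr_ge0// ltW.
have H3 : eta0 / 2 * (1 + v) `^ s <= j A.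
  apply: (@le_trans _ _ (X `^ s * j A * (1 + v) `^ s)); first exact: ler_wpM2r.
  by rewrite mulrAC; apply: ler_piMl.
apply: le_trans H3.
have vU : 2 * U / eta0 <= (1 + v) `^ s.
  have u0 : 0 <= 2 * U / eta0.
    by apply: divr_ge0; [apply: mulr_ge0|exact: ltW].
  rewrite -[leLHS](powR_invK u0 s00) -/v; apply: (@le_trans _ _ ((1 + v) `^ s0)).
    by apply: (ge0_ler_powR (ltW s00)); rewrite ?nnegrE ?addr_ge0// lerDr.
  by apply: ler_powR => //; rewrite lerDl.
rewrite [leLHS](_ : _ = eta0 / 2 * (2 * U / eta0)); last first.
  by field; rewrite gt_eqF.
by apply: ler_wpM2l => //; rewrite divr_ge0// ltW.
Qed.

(** Lower semicontinuity in neighbourhood form. Every [B] in [A2] near [A] can be compared with [A]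
    multiplied by the square root of [1 + r], since [(1 + r) A^2 - B^2] is then positive definite
    with small trace; homogeneity and [j A >= 0] absorb the factor. *)
Lemma value_le_of_adherent A (m : R) : A2 A ->
  (forall e : R, 0 < e -> forall V, nbhs A V -> exists2 B, V B & A2 B /\ j B <= m + e) ->
  j A <= m.
Proof.
move=> A2A H; apply/ler_addgt0Pr => e e0.
have pA : pos_def A by case: A2A.
have tau0 := A2_trace2_gt0 n3 A2A.
(* Makes [kap (r (trace2 A + 1))^s] at most [e / 2]; the summand 1 keeps the trace inequality strict
   near [A]. *)
pose r := ((e / 2) / (kap + 1)) `^ s^-1 / (trace2 A + 1).
have k1 : 0 < kap + 1 by rewrite ltr_wpDl.
have t1 : 0 < trace2 A + 1 by rewrite ltr_wpDl// ltW.
have r0 : 0 < r by rewrite divr_gt0// powR_gt0// divr_gt0// divr_gt0.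
pose f (B : 'M[R]_n) : 'M[R]_n := (1 + r) *: (A *m A) - B *m B.
have cid : continuous (@id 'M[R]_n) by move=> B; exact: cvg_id.
have cf : continuous f.
  apply: continuous_mx => i k.
  have cg : continuous (fun B : 'M[R]_n => (B *m B) i k).
    move=> B; apply: (@continuous_comp _ _ _ (fun B : 'M[R]_n => B *m B)
      (fun M : 'M[R]_n => M i k)).
      by apply: continuous_mulmx.
    exact: coord_continuous.
  rewrite (_ : (fun _ => _) = fun B => ((1 + r) *: (A *m A)) i k - (B *m B) i k); last first.
    by apply/funext => B; rewrite /f !mxE.
  have gen (X : topologicalType) (c : R) (g : X -> R) : continuous g ->
      continuous (fun x => c - g x).
    by move=> cg' x; apply: cvgB; [exact: cvg_cst|exact: cg'].
  exact: gen.
have fA : f A = r *: (A *m A) by rewrite /f scalerDl scale1r addrAC subrr add0r.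
have near1 : \forall B \near A, (f B)^T = f B -> pos_def (f B).
  have : pos_def (f A) by rewrite fA; apply: pos_defZ => //; exact: pos_def_sqr.
  by move=> /pos_def_near; apply: cf.
have near2 : \forall B \near A, \tr (f B) < r * (trace2 A + 1).
  have trf : \tr (f A) < r * (trace2 A + 1).
    by rewrite fA mxtraceZ ltr_pM2l// ltrDl.
  have ct : {for A, continuous (fun B => \tr (f B))}.
    apply: (@continuous_comp _ _ _ f); first exact: cf.
    exact: continuous_trace.
  have : nbhs (\tr (f A)) [set x | x < r * (trace2 A + 1)].
    by apply: open_nbhs_nbhs; split => //; exact: open_lt.
  exact: ct.
have e20 : 0 < e / 2 by rewrite divr_gt0.
have [B [nB1 nB2] [A2B jB]] := H _ e20 _ (filterI near1 near2).
have pB : pos_def B by case: A2B.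
pose b := Num.sqrt (1 + r); have b0 : 0 < b by rewrite sqrtr_gt0 addr_gt0.
have bb : b ^+ 2 = 1 + r by rewrite sqr_sqrtr// addr_ge0 ?(ltW r0).
have Au := pos_def_unit pA.
have bAu : b *: A \in unitmx by rewrite unitmxZ// unitfE gt_eqF.
have E : b *: A *m (b *: A) - B *m B = f B.
  by rewrite /f -bb -scalemxAl -scalemxAr scalerA -expr2.
have sf : (f B)^T = f B by rewrite /f linearB/= linearZ/= !trmx_mul pA.1 pB.1.
have := j_le (pos_def_unit pB) bAu; rewrite linearZ/= pA.1 E.
move=> /(_ pB.1 erefl (nB1 sf)); rewrite j_scale// bb => Hj.
have jA0 : 0 <= j A by apply: le_trans (ltW eta00) (j_ge A2A).
have r1 : 1 <= (1 + r) `^ s.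
  by rewrite -[leLHS](powRr0 (1 + r)) ler_powR// ?(ltW s_gt0)// lerDl ltW.
have jAr : j A <= (1 + r) `^ s * j A by rewrite ler_peMl.
have trs : kap * \tr (f B) `^ s <= e / 2.
  have trf0 : 0 <= \tr (f B).
    have [P pP PP] := pos_def_sqrt (nB1 sf).
    by rewrite -PP; exact: (trace2_ge0 pP.1).
  have e1 : 0 <= e / 2 / (kap + 1) by rewrite divr_ge0 ?(ltW e20)// ltW.
  apply: (@le_trans _ _ (kap * (e / 2 / (kap + 1)))).
    apply: ler_wpM2l => //; rewrite -[leRHS](powR_invK e1 s_gt0).
    apply: (ge0_ler_powR (ltW s_gt0)); rewrite ?nnegrE ?powR_ge0//.
    apply: (le_trans (ltW nB2)); rewrite /r divfK//.
    by rewrite gt_eqF.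
  by rewrite mulrCA ler_piMr ?(ltW e20)// ler_pdivrMr// mul1r lerDl.
by lra.
Qed.

Theorem minimum_attained :
  exists A0, [/\ A2 A0, trace2 A0 <= trace_bound & forall A, A2 A -> j A0 <= j A].
Proof.
pose S := [set A : 'M[R]_n | A2 A /\ trace2 A <= trace_bound].
have cS : compact S := A2_compact n3 trace_bound_ge1.
have Sa : S a%:M.
  split; first exact: A2_isotropic.
  rewrite /trace2 -scalar_mxM mxtrace_scalar -(mulr_natl (a * a) n) -expr2 -/q /trace_bound.
  rewrite addrAC lerDr addr_ge0// mulr_ge0 ?addr_ge0 ?powR_ge0// divr_ge0 ?(ltW d0)//.
  exact: le_trans N_ge2.
pose J := [set j A | A in S].
have iJ : has_inf J.
  split; first by exists (j a%:M), a%:M.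
  by exists eta0 => _ [A [A2A _] <-]; exact: j_ge.
(* The filter of almost-minimizers in the compact set; a cluster point of it is the minimizer. *)
pose F := filter_from [set e : R | 0 < e] (fun e => [set A | S A /\ j A <= inf J + e]).
have FF : ProperFilter F.
  apply: filter_from_proper.
    apply: filter_from_filter; first by exists 1 => /=.
    move=> e1 e2 /= e10 e20; exists (Num.min e1 e2); first by rewrite /= lt_min e10.
    move=> A [SA jA]; split; split=> //; apply: (le_trans jA); rewrite lerD2l.
      by rewrite ge_min lexx.
    by rewrite ge_min lexx orbT.
  move=> e /= e0; have [_ [A SA <-] jA] := inf_adherent e0 iJ.
  by exists A; split => //; exact: ltW.
have [A0 [SA0 clA0]] : S `&` cluster F !=set0.
  by apply: cS; exists 1 => //= A [].
have jA0 : j A0 <= inf J.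
  apply: value_le_of_adherent; first by case: SA0.
  move=> e e0 V nV.
  have [B [[[A2B _] jB] VB]] : [set A | S A /\ j A <= inf J + e] `&` V !=set0.
    by apply: clA0 => //; exists e.
  by exists B.
exists A0; split; [by case: SA0|by case: SA0|move=> A A2A].
have [tA|tA] := leP (trace2 A) trace_bound.
  by apply: (le_trans jA0); apply: ge_inf; [case: iJ|exists A].
(* Beyond the trace bound [j] is at least [U], which dominates its value at the isotropic
   competitor. *)
apply: (@le_trans _ _ U); last exact: value_ge_of_large_trace.
apply: (le_trans jA0); apply: le_trans j_scalar_le.
by apply: ge_inf; [case: iJ|exists a%:M].
Qed.

End minimization.

(** * Minimization applied to the averages of I^s *)

Section ellipticity.
Context {R : realType} (n : nat) (s : R).
Hypothesis s01 : 0 < s < 1.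
Local Notation vec := 'cV[R]_n.
Local Notation lam := (lebesgue_cV R n).
Local Notation p := (n%:R + 2 * s).
Variables (u : vec -> R) (x : vec).
Hypothesis mu : measurable_fun [set: vec] u.
Hypothesis idq : lam.-integrable setT (fun y => (delta u x y / enorm y `^ p)%:E).
Implicit Types A B : 'M[R]_n.

Definition dquot_mass A : R := fine (\int[lam]_y dquot s u x A y)%E.

(** The factor between the average over the ball of pairs and the singular integral. *)
Definition average_const : R := (1 - s) * fine (kernel_const n s : \bar R).

Lemma average_const_gt0 : 0 < average_const.
Proof.
case/andP: s01 => s0 s1; rewrite mulr_gt0 ?subr_gt0// -lte_fin.
by rewrite fineK ?kernel_const_fin// kernel_const_gt0// s0 ltW.
Qed.

Lemma integral_dquotE A : A \in unitmx ->
  (\int[lam]_y dquot s u x A y = (dquot_mass A)%:E)%E.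
Proof.
move=> Au; rewrite fineK//.
exact: (integrable_fin_num measurableT (integrable_dquot s01 mu idq Au)).
Qed.

Lemma ball_averageE A : A \in unitmx ->
  ball_average s u x A = (average_const * dquot_mass A)%:E.
Proof.
move=> Au; rewrite /ball_average (Is_ball s01 mu idq Au).2.
have s0 : 0 < s by case/andP: s01.
rewrite integral_dquotE// -(fineK (kernel_const_fin n s0)) -!EFinM.
by rewrite mulrA.
Qed.

Lemma dquot_scale (t : R) A (y : vec) : 0 < t ->
  dquot s u x (t *: A) y = ((t `^ p)%:E * dquot s u x A (t *: y)%R)%E.
Proof.
move=> t0; rewrite /dquot -EFinM -scalemxAl -scalemxAr enormZ gtr0_norm//.
rewrite powRM ?enorm_ge0 ?(ltW t0)// invfM.
congr EFin; move: (delta _ _ _) (_ `^ _)^-1 => a b.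
by rewrite [RHS]mulrCA mulVKf// gt_eqF// powR_gt0.
Qed.

(** The substitution of [t y] for [y] gives [t^(n+2s) t^-n]. The form [(t^2)^s] suits the square
    roots by which matrices are later multiplied. *)
Lemma dquot_mass_scale (t : R) A : 0 < t -> A \in unitmx ->
  dquot_mass (t *: A) = (t ^+ 2) `^ s * dquot_mass A.
Proof.
move=> t0 Au; have tn0 : t != 0 by rewrite gt_eqF.
have mA : measurable_fun [set: vec] (dquot s u x A).
  by have [] := integrableP _ _ _ (integrable_dquot s01 mu idq Au).
pose k : R := t `^ p.
have k0 : 0 <= k by rewrite powR_ge0.
have part (f : \bar R -> \bar R) :
    (forall z, (0 <= f z)%E) -> (forall z, f (k%:E * z) = (k%:E * f z)%E)%E ->
    measurable_fun setT (fun y => f (dquot s u x A y)) ->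
    (\int[lam]_y f (dquot s u x (t *: A) y) =
     ((t ^+ 2) `^ s)%:E * \int[lam]_y f (dquot s u x A y))%E.
  move=> f0 fk mf.
  under eq_integral do rewrite dquot_scale// fk.
  have mft : measurable_fun setT (fun y : vec => f (dquot s u x A (t *: y)%R)).
    by apply: (measurableT_comp mf); exact: measurable_cV_scaler.
  rewrite (ge0_integralZl_EFin _ measurableT (fun (y : vec) _ => f0 (dquot s u x A (t *: y)%R)) mft k0).
  rewrite (ge0_integral_cV_scale tn0 mf (fun y => f0 _)).
  rewrite muleA -EFinM gtr0_norm//; congr (_%:E * _)%E.
  rewrite /k powRD ?tn0 ?implybT// powR_mulrn ?(ltW t0)// mulrAC mulfV ?mul1r ?expf_neq0//.
  by rewrite powRrM powR_mulrn ?(ltW t0).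
have Au' : t *: A \in unitmx by rewrite unitmxZ// unitfE.
have kmax (b : \bar R) (c : R) : (maxe (k%:E * b) 0 = k%:E * maxe b 0)%E.
  by rewrite maxe_pMr// ?mule0.
have kpos (b : \bar R) : (maxe (k%:E * b) 0 = k%:E * maxe b 0)%E.
  by rewrite maxe_pMr ?mule0.
have iA := integrable_dquot s01 mu idq Au.
have Pfin := integrable_pos_fin_num measurableT iA.
have Nfin := integrable_neg_fin_num measurableT iA.
have HP : (\int[lam]_y (dquot s u x (t *: A))^\+ y =
    ((t ^+ 2) `^ s)%:E * \int[lam]_y (dquot s u x A)^\+ y)%E.
  rewrite !(eq_integral _ _ (fun y _ => funeposE _ y)).
  apply: (part (fun z => maxe z 0)%E) => [z|z|]; first by rewrite le_max lexx orbT.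
    exact: kpos.
  rewrite (_ : (fun _ => _) = (dquot s u x A)^\+%E); first exact: measurable_funepos.
  by apply/funext => y; rewrite funeposE.
have HN : (\int[lam]_y (dquot s u x (t *: A))^\- y =
    ((t ^+ 2) `^ s)%:E * \int[lam]_y (dquot s u x A)^\- y)%E.
  rewrite !(eq_integral _ _ (fun y _ => funenegE _ y)).
  apply: (part (fun z => maxe (- z) 0)%E) => [z|z|]; first by rewrite le_max lexx orbT.
    by rewrite -muleN; exact: kpos.
  rewrite (_ : (fun _ => _) = (dquot s u x A)^\-%E); first exact: measurable_funeneg.
  by apply/funext => y; rewrite funenegE.
rewrite /dquot_mass integralE HP HN [in RHS]integralE -(fineK Pfin) -(fineK Nfin).
by rewrite -!EFinM -!EFinB/=; ring.
Qed.

Variable K : R.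
Hypothesis K0 : 0 <= K.
Hypothesis second_diff : {ae (lam \x lam)%E, forall yz : vec * vec,
  (Is s u x (yz.1 + yz.2) + Is s u x (yz.1 - yz.2) - 2%:E * Is s u x yz.1
     <= (2 * K * enorm yz.2 `^ (2 * s))%:E)%E}.

Lemma ball_average_le A B : A \in unitmx -> B \in unitmx -> A^T = A -> B^T = B ->
  pos_def (B *m B - A *m A) ->
  average_const * dquot_mass B <= average_const * dquot_mass A +
    K * ball_mass n * \tr (B *m B - A *m A) `^ s.
Proof.
move=> Au Bu sA sB pD; have Vu : invmx B \in unitmx by rewrite unitmx_inv.
have sV : (invmx B)^T = invmx B by rewrite trmx_inv sB.
pose C := invmx B *m (A *m A) *m invmx B.
have pC : pos_def C.
  have pAA : pos_def (A *m A).
    by have := pos_def_congruence Au (pos_def_scalar n ltr01); rewrite mulmx1 sA.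
  by rewrite /C -[X in _ *m X]sV; exact: pos_def_congruence.
have pC' : pos_def (1%:M - C).
  have -> : 1%:M - C = invmx B *m (B *m B - A *m A) *m (invmx B)^T.
    by rewrite sV mulmxBr mulmxBl -/C (mulmxA _ B B) mulVmx// mul1mx mulmxV.
  exact: pos_def_congruence.
have [P [Q [pP pQ PP PQ PPQQ]]] := pos_def_sqrt_pair pC pC'.
have Pu := pos_def_unit pP; have Qu := pos_def_unit pQ.
have := ball_average_split s01 mu idq K0 second_diff Bu Pu Qu pP.1 pQ.1 PQ PPQQ.
have BCB : B *m C *m B = A *m A.
  by rewrite /C !mulmxA mulmxV// mul1mx -!mulmxA mulVmx// mulmx1.
have -> : B *m Q *m (B *m Q)^T = B *m B - A *m A.
  rewrite trmx_mul sB pQ.1 !mulmxA -(mulmxA B).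
  have -> : Q *m Q = 1%:M - C by rewrite -PPQQ PP addrAC subrr add0r.
  by rewrite mulmxBr mulmx1 mulmxBl BCB.
(* Orthogonal because [B P^2 B = B C B = A^2]; it makes the averages at [B P] and at [A] equal. *)
pose U := invmx A *m (B *m P).
have UU : U *m U^T = 1%:M.
  rewrite /U !trmx_mul sB pP.1 trmx_inv sA !mulmxA -(mulmxA _ P P) PP.
  by rewrite -(mulmxA _ _ C) -(mulmxA _ _ B) BCB !mulmxA mulVmx// mul1mx mulmxV.
have -> : ball_average s u x (B *m P) = ball_average s u x A.
  rewrite -(ball_average_orthogonal s x mu A UU); congr ball_average.
  by rewrite /U mulmxA mulmxV// mul1mx.
by rewrite (ball_averageE Au) (ball_averageE Bu) -EFinD lee_fin [K * _ * _]mulrAC.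
Qed.

Lemma attained_bound (eta0 c s0 : R) (n3 : (3 <= n)%N) (T := trace_bound n (K * ball_mass n) s0 c) :
  0 < s0 <= s -> 0 < c ->
  c <= average_const * eta0 -> (forall A, A2 A -> eta0 <= dquot_mass A) ->
  exists A0, [/\ A2 A0, elliptic T A0 & forall A, A2 A -> dquot_mass A0 <= dquot_mass A].
Proof.
move=> /andP[s00 s0s] c0 ceta H; have k0 := average_const_gt0.
have m0 : 0 <= K * ball_mass n by rewrite mulr_ge0// ltW// ball_mass_gt0.
have s1 : s <= 1 by case/andP: s01 => _ /ltW.
have jscale (t : R) A : 0 < t -> A \in unitmx ->
    average_const * dquot_mass (t *: A) = (t ^+ 2) `^ s * (average_const * dquot_mass A).
  by move=> t0 Au; rewrite dquot_mass_scale// mulrCA.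
have jge A : A2 A -> c <= average_const * dquot_mass A.
  by move=> A2A; apply: (le_trans ceta); rewrite ler_pM2l// H.
have [A0 [A2A0 tA0 minA0]] :=
  minimum_attained n3 m0 s00 c0 s0s s1 ball_average_le jscale jge.
exists A0; split=> //.
  exact: (A2_elliptic n3 A2A0 tA0 (trace_bound_ge1 n3 s0 m0 c0)).
by move=> A /minA0; rewrite ler_pM2l.
Qed.

End ellipticity.

(** The factor [1 - s] of [average_const] cancels against [C_ns <= M (1 - s)], and [kernel_const]
    has a lower bound independent of [s]. *)
Lemma average_lower_bound (R : realType) (n : nat) (eta0 : R) : 0 < eta0 ->
  exists2 c, 0 < c & forall s, 2^-1 <= s < 1 -> 0 < C_ns n s ->
    c <= average_const n s * (2 * (eta0 / C_ns n s)).
Proof.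
move=> e0; have [M M0 CM] := @C_ns_le R n; have [c0 c00 kc] := @kernel_const_ge R n.
exists (c0 * (2 * (eta0 / M))).
  by rewrite mulr_gt0// mulr_gt0// divr_gt0.
move=> s /andP[s2 s1] C0; have s0 : 0 < s by apply: lt_le_trans s2.
have s'0 : 0 < 1 - s by rewrite subr_gt0.
have Cs : C_ns n s <= M * (1 - s) by apply: CM; rewrite s2.
have kc' : c0 <= fine (kernel_const n s).
  by rewrite -lee_fin fineK ?kernel_const_fin// kc// s0 ltW.
have -> : c0 * (2 * (eta0 / M)) = (1 - s) * c0 * (2 * (eta0 / (M * (1 - s)))).
  by field; rewrite (gt_eqF M0) (gt_eqF s'0).
apply: ler_pM.
- by rewrite mulr_ge0// ltW.
- by rewrite mulr_ge0// divr_ge0 ?mulr_ge0// ltW.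
- by apply: ler_wpM2l => //; exact: ltW.
apply: ler_wpM2l => //; apply: ler_wpM2l; first exact: ltW.
by rewrite lef_pV2 ?posrE// mulr_gt0.
Qed.

Theorem theorem1p2 (R : realType) (n : nat) (K eta0 : R) :
  (3 <= n)%N -> 0 < K -> 0 < eta0 ->
  exists Lambda : R -> R,
    (forall s : R, 0 < s < 1 ->
       1 <= Lambda s /\
       forall (Omega : set 'cV[R]_n) (u : 'cV[R]_n -> R),
         domain Omega -> continuous u -> L1_omega s u ->
         Ks_ge_viscosity s Omega u eta0 ->
         Is_second_difference_le s Omega u K ->
         forall x, Omega x -> touchable_from_above Omega u x ->
           exists m : \bar R,
             is_min [set pv s u x A | A in A2 `&` elliptic (Lambda s)] m /\
             Ks s u x = ((C_ns n s)%:E * m)%E) /\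
    Lambda =O_ ((1 : R)^'-) (fun=> 1 : R).
Proof.
move=> n3 K0 eta00; have [c c0 Hc] := average_lower_bound n eta00.
(* For [s >= 1/2] both [h s] and [e s] are constant, so the ellipticity constant does not vary
   there; this gives the bound as [s] tends to 1. *)
pose h (s : R) : R := Num.min s 2^-1.
pose e (s : R) : R :=
  if s < 2^-1 then average_const n s * (2 * (eta0 / C_ns n s)) else c.
pose T (s : R) : R := trace_bound n (K * ball_mass n) (h s) (e s).
exists (fun s => Num.max 1 (T s)); split; last first.
  apply/eqO_exP; exists (Num.max 1 (trace_bound n (K * ball_mass n) 2^-1 c)).
    by rewrite lt_max ltr01.
  near=> s; have s2 : 2^-1 <= s by near: s; apply: nbhs_left_ge; rewrite invf_lt1 ?ltr1n.
  by rewrite /T /h /e ltNge s2/= min_r// normr1 mulr1 ger0_norm// le_max ler01.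
move=> s s01; split; first by rewrite le_max lexx.
move=> Omega u _ cu Lu visc sd x Ox touch.
have {}sd := sd x Ox touch; have [N [psi {}touch]] := touch.
have mu : measurable_fun [set: 'cV[R]_n] u by exact: continuous_measurable_cV.
have A2u (A : 'M[R]_n) : A2 A -> A \in unitmx by case=> pA _; exact: pos_def_unit.
have int_ge (A : 'M[R]_n) (A2A : A2 A) :=
  touched_integral s01 cu Lu touch eta00 Ox visc A2A (A2u A A2A).
have iso := @A2_isotropic R n n3.
have [Cgt0 iiso _] := int_ge _ iso.
(* One member of [A2] is enough to transfer integrability to every invertible matrix; the isotropic
   one shows that [A2] has a member. *)
have idq := touched_dq s01 cu (A2u _ iso) iiso.
have pvE (A : 'M[R]_n) : A2 A -> pv s u x A = (2^-1 * dquot_mass s u x A)%:E.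
  move=> A2A; rewrite (pv_half s01 mu (@touched_tail R n s s01 u x cu Lu) idq (A2u A A2A)).
  by rewrite (integral_dquotE s01 mu idq (A2u A A2A)).
have mass_ge (A : 'M[R]_n) : A2 A -> 2 * (eta0 / C_ns n s) <= dquot_mass s u x A.
  move=> A2A; have [_ _] := int_ge A A2A.
  by rewrite (integral_dquotE s01 mu idq (A2u A A2A)) lee_fin.
have q0 : 0 < 2 * (eta0 / C_ns n s) by rewrite mulr_gt0// divr_gt0.
have e0 : 0 < e s.
  by rewrite /e; case: ifP => // _; rewrite mulr_gt0// average_const_gt0.
have e_le : e s <= average_const n s * (2 * (eta0 / C_ns n s)).
  rewrite /e; case: ifPn => //; rewrite -leNgt => s2; apply: Hc => //.
  by rewrite s2; case/andP: s01.
have hs : 0 < h s <= s.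
  by rewrite /h lt_min ge_min lexx/= invr_gt0 ltr0n !andbT; case/andP: s01.
have [A0 [A2A0 eA0 minA0]] :=
  attained_bound s01 mu idq (ltW K0) sd n3 hs e0 e_le mass_ge.
have T1 : 1 <= T s.
  by apply: trace_bound_ge1 => //; rewrite mulr_ge0 ?(ltW K0)// ltW// ball_mass_gt0.
rewrite max_r//; exists (pv s u x A0).
have pv_min (A : 'M[R]_n) : A2 A -> (pv s u x A0 <= pv s u x A)%E.
  move=> A2A; rewrite (pvE _ A2A0) (pvE _ A2A) lee_fin.
  by apply: ler_wpM2l; rewrite ?minA0.
split; first split.
- by exists A0.
- by move=> _ [A [A2A _] <-]; exact: pv_min.
(* [A0] minimizes over all of [A2], so its principal value is the unrestricted infimum as well. *)
rewrite /Ks; congr (_ * _)%E; apply/eqP; rewrite eq_le; apply/andP; split.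
  by apply: ereal_inf_lbound; exists A0.
by apply: le_ereal_inf_tmp => _ [A A2A <-]; exact: pv_min.
Unshelve. all: by end_near. Qed.
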